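(* Let $K$ be a field of characteristic different from $2$. Let $G$ be a $2$-reduced finite group of order $n$ with $n\equiv 0$ or $2 \bmod 8$. Then for any $G$-Galois algebra $L/K$ one has $$w_2(q_L)=(2)\cdot(d_{L/K})\quad\text{in } H^2(G_K,\mathbf Z/2\mathbf Z).$$
   Context: A finite group $G$ is called $2$-reduced if $H^2(G,\mathbf Z/2\mathbf Z)$ contains no non-zero nilpotent element of the mod $2$ cohomology ring $H^*(G,\mathbf Z/2\mathbf Z)$. $K^s$ is a separable closure of $K$ and $G_K=\mathrm{Gal}(K^s/K)$. A $G$-Galois algebra over $K$ is an étale $K$-algebra $L$ of degree $n=|G|$ endowed with an action of $G$ such that the induced action of $G$ on $\mathrm{Hom}_{K\text{-alg}}(L,K^s)$ is simply transitive. Its trace form is the quadratic form $q_L:L\to K$, $q_L(x)=\mathrm{Tr}_{L/K}(x^2)$. The discriminant of the étale algebra $L/K$ (equivalently of $q_L$) is denoted $d_{L/K}$; it is well defined modulo squares. For $a\in K^\times$, $(a)$ is its class in $K^\times/(K^\times)^2\simeq H^1(G_K,\mathbf Z/2\mathbf Z)$, and $\cdot$ is the cup product. For a non-degenerate quadratic form $q\simeq\langle a_1,\dots,a_n\rangle$ over $K$, the $m$-th Hasse-Witt invariant is $w_m(q)=\sum_{1\le i_1<\cdots<i_m\le n}(a_{i_1})\cdots(a_{i_m})\in H^m(G_K,\mathbf Z/2\mathbf Z)$ for $1\le m\le n$ (independent of the diagonalisation). *)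

(* Defs.v *)
From HB Require Import structures.
From mathcomp Require Import all_boot all_order all_algebra all_fingroup all_field.
From mathcomp Require Import generic_quotient ring_quotient.
From mathcomp Require Import boolp classical_sets functions topology.

Set Implicit Arguments.
Unset Strict Implicit.
Unset Printing Implicit Defensive.

Import GRing.Theory.
Local Open Scope ring_scope.
Local Open Scope quotient_scope.
Local Open Scope classical_set_scope.

(* The library only has additive topological groups. *)
HB.mixin Record isTopologicalGroup G of monoid.Group G & Topological G := {
  mulg_continuous : continuous (fun xy : G * G => (xy.1 * xy.2)%g);
  invg_continuous : continuous (fun x : G => x^-1%g)
}.

#[short(type="topGroupType")]
HB.structure Definition TopologicalGroup :=
  {G of monoid.Group G & Topological G & isTopologicalGroup G}.

Lemma cvg_initial (S : choiceType) (T : topologicalType) (f : S -> T)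
    (F : set_system S) (s : S) :
  Filter F -> f @ F --> f s -> F --> (s : initial_topology f).
Proof.
move=> FF fF A; rewrite (@nbhsE (initial_topology f)) => -[B [[C Co <-] Cs] CA].
rewrite nbhs_filterE; apply: filterS CA _.
by apply: fF; exact: open_nbhs_nbhs.
Qed.

(* Continuous cohomology H^m(G, Z/2), trivial action, by inhomogeneous cochains. *)
Section Cohomology.
Variable G : topGroupType.

Local Notation cochain m := (('I_m -> G) -> 'F_2).

(* Continuity of a map from G^m with the product topology to the discrete space
   'F_2. *)
Definition locally_constant m (f : cochain m) : Prop :=
  forall x : {ptws 'I_m -> G}, \forall y \near x, f y = f x.

(* face 0 drops the first entry, face m.+1 the last one, and for 0 < i <= m
   face i multiplies the (consecutive) entries number i.-1 and i. *)
Definition face m (i : nat) (x : 'I_m.+1 -> G) (j : 'I_m) : G :=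
  if (j.+1 < i)%N then x (widen_ord (leqnSn m) j)
  else if j.+1 == i then (x (widen_ord (leqnSn m) j) * x (lift ord0 j))%g
  else x (lift ord0 j).

(* The signs of the usual formula are irrelevant in characteristic 2. *)
Definition cobound m (f : cochain m) : cochain m.+1 :=
  fun x => \sum_(i < m.+2) f (face i x).

Definition cocycles m : {pred cochain m} :=
  fun f => `[< locally_constant f /\ cobound f = 0 >].

Arguments cocycles : clear implicits.

Lemma cocyclesP m (f : cochain m) :
  reflect (locally_constant f /\ cobound f = 0) (f \in cocycles m).
Proof. exact: asboolP. Qed.

Lemma locally_constant0 m : locally_constant (0 : cochain m).
Proof.
by move=> x; have ? := nbhs_filter x; apply: filterE.
Qed.

Lemma locally_constantB m (f g : cochain m) :
  locally_constant f -> locally_constant g -> locally_constant (f - g).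
Proof.
move=> fc gc x; have ? := nbhs_filter x.
move: (fc x) (gc x); apply: filterS2 => y fE gE.
by rewrite /= !fctE /= fE gE.
Qed.

Lemma cobound0 m : cobound (0 : cochain m) = 0.
Proof. by apply/funext => x; rewrite /cobound big1. Qed.

Lemma coboundB m (f g : cochain m) : cobound (f - g) = cobound f - cobound g.
Proof. by apply/funext => x; rewrite /cobound !fctE /= -sumrB. Qed.

Lemma cocycles_zmod m : zmod_closed (cocycles m).
Proof.
split; first by apply/cocyclesP; split; [exact: locally_constant0|exact: cobound0].
move=> f g /cocyclesP[fc f0] /cocyclesP[gc g0]; apply/cocyclesP; split.
  exact: locally_constantB.
by rewrite coboundB f0 g0 subrr.
Qed.

HB.instance Definition _ m :=
  GRing.isZmodClosed.Build (cochain m) (cocycles m) (cocycles_zmod m).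

Record cocycle m := Cocycle {
  cocycle_val :> cochain m;
  cocycleP : cocycle_val \in cocycles m }.

HB.instance Definition _ m := [isSub for @cocycle_val m].
HB.instance Definition _ m := [Choice of cocycle m by <:].
HB.instance Definition _ m := [SubChoice_isSubZmodule of cocycle m by <:].

Definition coboundary m : cochain m -> Prop :=
  match m with
  | 0 => fun f => f = 0
  | k.+1 => fun f => exists2 c : cochain k, locally_constant c & f = cobound c
  end.

Definition coboundaries m : {pred cocycle m} := fun z => `[< coboundary z >].

Arguments coboundaries : clear implicits.

Lemma coboundaries_zmod m : zmod_closed (coboundaries m).
Proof.
split.
  apply/asboolP; case: m => [|m] //=.
  by exists 0; [exact: locally_constant0|rewrite cobound0].
move=> f g /asboolP fb /asboolP gb; apply/asboolP.
have -> : cocycle_val (f - g) = cocycle_val f - cocycle_val g by exact: (raddfB \val).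
case: m f g fb gb => [|m] f g /=.
  by move=> -> ->; rewrite subrr.
move=> [c cc ->] [b bc ->]; exists (c - b); first exact: locally_constantB.
by rewrite coboundB.
Qed.

HB.instance Definition _ m :=
  GRing.isZmodClosed.Build (cocycle m) (coboundaries m) (coboundaries_zmod m).

Definition cohomology m := {ideal_quot (coboundaries m)}.

HB.instance Definition _ m := GRing.Zmodule.on (cohomology m).

Lemma reindex_continuous m p (phi : 'I_p -> 'I_m) :
  continuous ((fun x => x \o phi) : {ptws 'I_m -> G} -> {ptws 'I_p -> G}).
Proof.
move=> x; have Fx := nbhs_filter x; apply/cvg_sup => i.
apply: (@cvg_initial _ _ (fun y : 'I_p -> G => y i)) => A.
exact: (@proj_continuous 'I_m (fun=> G) (phi i) x).
Qed.

Lemma locally_constant_reindex m p (phi : 'I_p -> 'I_m) (f : cochain p) :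
  locally_constant f -> locally_constant (fun x => f (x \o phi)).
Proof. by move=> fc x; apply: (@reindex_continuous m p phi x _ (fc (x \o phi))). Qed.

Definition cup_cochain m p (f : cochain m) (g : cochain p) : cochain (m + p) :=
  fun x => f (x \o @lshift m p) * g (x \o @rshift m p).


Lemma locally_constant_cup m p (f : cochain m) (g : cochain p) :
  locally_constant f -> locally_constant g -> locally_constant (cup_cochain f g).
Proof.
move=> fc gc x; have ? := nbhs_filter x.
move: (locally_constant_reindex (@lshift m p) fc x).
move: (locally_constant_reindex (@rshift m p) gc x).
by apply: filterS2 => y gE fE; rewrite /cup_cochain gE fE.
Qed.

Lemma face_ext m (i : nat) (X : nat -> G) (j : 'I_m) :
  face i (fun k : 'I_m.+1 => X k) j =
  if (j.+1 < i)%N then X j else if j.+1 == i then (X j * X j.+1)%g else X j.+1.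
Proof. by rewrite /face /= /bump add1n. Qed.

Lemma addff2 (a : 'F_2) : a + a = 0.
Proof. by rewrite -mulr2n -mulr_natl (_ : 2%:R = 0) ?mul0r //; apply: val_inj. Qed.

Lemma oppF2 (a : 'F_2) : - a = a.
Proof. by apply/eqP; rewrite eq_sym -addr_eq0 addff2. Qed.

Lemma cup_cocycle m p (f : cochain m) (g : cochain p) :
  f \in cocycles m -> g \in cocycles p -> cup_cochain f g \in cocycles (m + p).
Proof.
move=> /cocyclesP[fc f0] /cocyclesP[gc g0]; apply/cocyclesP.
split; first exact: locally_constant_cup.
apply/funext => x; rewrite /cobound.
pose X k := x (inord k).
have -> : x = fun k : 'I_(m + p).+1 => X k.
  by apply/funext => k; rewrite /X inord_val.
move: X => X {x}.
pose Y k := X (m + k)%N.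
rewrite -(big_mkord xpredT
  (fun i => cup_cochain f g (face i (fun k : 'I_(m + p).+1 => X k)))).
rewrite (@big_cat_nat _ _ _ m.+1) //=; last by rewrite !ltnS leqW ?leq_addr.
pose fX := f (fun k : 'I_m => X k); pose gY := g (fun k : 'I_p => Y k.+1).
have -> : \sum_(0 <= i < m.+1)
    cup_cochain f g (face i (fun k : 'I_(m + p).+1 => X k)) = fX * gY.
  have : cobound f (fun k : 'I_m.+1 => X k) = 0 by rewrite f0.
  rewrite /cobound big_ord_recr /= => /eqP; rewrite addr_eq0 => /eqP fE.
  have -> : fX = \sum_(i < m.+1) f (face i (fun k : 'I_m.+1 => X k)).
    rewrite fE oppF2 /fX; congr (f _).
    by apply/funext => k; rewrite face_ext ltnS ltn_ord.
  rewrite mulr_suml big_mkord; apply: eq_bigr => i _; congr (f _ * g _).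
  apply/funext => k /=; rewrite face_ext /= /Y addnS.
  have ltik : (i < (m + k).+1)%N.
    by rewrite ltnS (leq_trans (ltnSE (ltn_ord i))) ?leq_addr.
  by rewrite ltnNge (ltnW ltik) /= gtn_eqF.
have -> : \sum_(m.+1 <= i < (m + p).+2)
    cup_cochain f g (face i (fun k : 'I_(m + p).+1 => X k)) = fX * gY.
  have : cobound g (fun k : 'I_p.+1 => Y k) = 0 by rewrite g0.
  rewrite /cobound big_ord_recl /= => /eqP; rewrite addr_eq0 => /eqP gE.
  have -> : gY = \sum_(i < p.+1) g (face i.+1 (fun k : 'I_p.+1 => Y k)).
    have -> : gY = g (face 0 (fun k : 'I_p.+1 => Y k)).
      by rewrite /gY; congr (g _); apply/funext => k; rewrite face_ext.
    by rewrite gE oppF2.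
  rewrite -{1}[m.+1]add0n big_addn (_ : ((m + p).+2 - m.+1)%N = p.+1); last first.
    by rewrite subSS -addnS addKn.
  rewrite big_mkord mulr_sumr.
  apply: eq_bigr => i _; congr (f _ * g _).
    apply/funext => k /=; rewrite !face_ext /=.
    by rewrite addnS ltnS (leq_trans (ltn_ord k)) ?leq_addl.
  apply/funext => k /=; rewrite !face_ext /= /Y.
  by rewrite [(i + _)%N]addnC addSn !addnS !ltnS !eqSS ltn_add2l eqn_add2l.
exact: addff2.
Qed.

(* By the Leibniz rule the class below does not depend on the representatives. *)
Definition cup m p (a : cohomology m) (b : cohomology p) :
    cohomology (m + p) :=
  \pi_(cohomology (m + p)) (Cocycle (cup_cocycle (cocycleP (repr a)) (cocycleP (repr b)))).

Lemma cst1_cocycle : (fun=> 1) \in cocycles 0.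
Proof.
apply/cocyclesP; split; last first.
  by apply/funext => x; rewrite /cobound big_ord_recl big_ord1 addff2.
by move=> x; have ? := nbhs_filter x; apply: filterE.
Qed.

Definition cohomology1 : cohomology 0 := \pi_(cohomology 0) (Cocycle cst1_cocycle).

Fixpoint cup_exp m (a : cohomology m) (k : nat) : cohomology (k * m) :=
  match k with
  | 0 => cohomology1
  | k'.+1 => cup a (cup_exp a k')
  end.

Fixpoint cup_prod m : ('I_m -> cohomology 1) -> cohomology m :=
  match m with
  | 0 => fun=> cohomology1
  | k.+1 => fun c => cup (c ord0) (cup_prod (fun i => c (lift ord0 i)))
  end.

End Cohomology.

Arguments cocycles : clear implicits.
Arguments coboundaries : clear implicits.
Arguments cohomology : clear implicits.

HB.instance Definition _ (gT : groupType) :=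
  monoid.Group.copy (discrete_topology gT) gT.

Section DiscreteGroup.
Variable gT : groupType.
Local Notation G := (discrete_topology gT).

Lemma discrete_mulg_continuous :
  continuous (fun xy : G * G => (xy.1 * xy.2)%g : G).
Proof.
move=> [x y] A /principal_filterP Axy.
exists ([set x], [set y]); first by split; exact: discrete_set1.
by move=> [u v] [/= -> ->].
Qed.

Lemma discrete_invg_continuous : continuous (fun x : G => x^-1%g : G).
Proof.
move=> x A /principal_filterP Ax.
by apply/principal_filterP.
Qed.

HB.instance Definition _ := isTopologicalGroup.Build G
  discrete_mulg_continuous discrete_invg_continuous.

End DiscreteGroup.

(* A homogeneous element x of degree 2 is nilpotent in the graded ring H^*(G, Z/2)
   iff some power of it vanishes in H^(2k). *)
Definition two_reduced (gT : finGroupType) : Prop :=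
  forall x : cohomology (discrete_topology gT) 2,
    (exists k, cup_exp x k = 0) -> x = 0.

Record separable_closure (K Ks : fieldType) (iota : {rmorphism K -> Ks}) : Prop :=
  SeparableClosure {
  separable_closure_algebraic : forall x : Ks,
    exists2 p : {poly K}, separable_poly p & root (map_poly iota p) x;
  separable_closure_closed : forall q : {poly Ks},
    separable_poly q -> size q != 1%N -> exists x, root q x }.

Section AbsoluteGaloisGroup.
Variables (K Ks : fieldType) (iota : {rmorphism K -> Ks}).

Definition is_galois_aut (s : Ks -> Ks) : Prop :=
  [/\ GRing.zmod_morphism s, GRing.monoid_morphism s, bijective s
    & forall a, s (iota a) = iota a].

Record galois_group := GaloisAut {
  galois_fun :> Ks -> Ks;
  galois_funP : `[< is_galois_aut galois_fun >] }.

HB.instance Definition _ := [isSub for galois_fun].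
HB.instance Definition _ := [Choice of galois_group by <:].

Implicit Types s t : galois_group.

Lemma galois_is_aut s : is_galois_aut s.
Proof. by apply/asboolP; case: s. Qed.

Lemma galois_ext s t : s =1 t -> s = t.
Proof. by move=> st; apply: val_inj; exact/funext. Qed.

Lemma galois_inv_subproof s : {t | cancel s t /\ cancel t s}.
Proof.
by apply: cid; have [_ _ [t st ts] _] := galois_is_aut s; exists t.
Qed.

Definition galois_inv_fun s : Ks -> Ks := sval (galois_inv_subproof s).

Lemma galois_funK s : cancel s (galois_inv_fun s).
Proof. exact: (svalP (galois_inv_subproof s)).1. Qed.

Lemma galois_invK s : cancel (galois_inv_fun s) s.
Proof. exact: (svalP (galois_inv_subproof s)).2. Qed.

Lemma galois_one_subproof : `[< is_galois_aut id >].
Proof. by apply/asboolP; split=> //; exists id. Qed.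

Lemma galois_mul_subproof s t : `[< is_galois_aut (s \o t) >].
Proof.
have [sB [s1 sM] sb si] := galois_is_aut s.
have [tB [t1 tM] tb ti] := galois_is_aut t.
apply/asboolP; split.
- by move=> x y /=; rewrite tB sB.
- by split=> [|x y] /=; [rewrite t1 s1|rewrite tM sM].
- exact: bij_comp.
- by move=> a /=; rewrite ti si.
Qed.

Lemma galois_inv_subproof2 s : `[< is_galois_aut (galois_inv_fun s) >].
Proof.
have [sB [s1 sM] sb si] := galois_is_aut s.
have sI := can_inj (galois_funK s).
apply/asboolP; split.
- by move=> x y; apply: sI; rewrite sB !galois_invK.
- by split=> [|x y]; apply: sI; rewrite ?s1 ?sM !galois_invK.
- by exists s; [exact: galois_invK|exact: galois_funK].
- by move=> a; apply: sI; rewrite si galois_invK.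
Qed.

Definition galois_one : galois_group := GaloisAut galois_one_subproof.
Definition galois_mul s t : galois_group := GaloisAut (galois_mul_subproof s t).
Definition galois_inv s : galois_group := GaloisAut (galois_inv_subproof2 s).

Lemma galois_mulA : associative galois_mul.
Proof. by move=> s t u; exact: galois_ext. Qed.

Lemma galois_mul1 : left_id galois_one galois_mul.
Proof. by move=> s; exact: galois_ext. Qed.

Lemma galois_mulr1 : right_id galois_one galois_mul.
Proof. by move=> s; exact: galois_ext. Qed.

Lemma galois_mulV : left_inverse galois_one galois_inv galois_mul.
Proof. by move=> s; apply: galois_ext => x /=; rewrite galois_funK. Qed.

Lemma galois_mulrV : right_inverse galois_one galois_inv galois_mul.
Proof. by move=> s; apply: galois_ext => x /=; rewrite galois_invK. Qed.

HB.instance Definition _ := isGroup.Build galois_group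
  galois_mulA galois_mul1 galois_mulr1 galois_mulV galois_mulrV.

(* The Krull topology is the topology of pointwise convergence for the discrete
   topology on Ks. *)
Definition galois_eval : galois_group -> {ptws Ks -> discrete_topology Ks} :=
  galois_fun.

HB.instance Definition _ :=
  Topological.copy galois_group (initial_topology galois_eval).

Lemma nbhs_galois s (x : Ks) : nbhs s [set t : galois_group | t x = s x].
Proof.
have := @initial_continuous _ _ galois_eval s.
move=> /(_ _ (@proj_continuous Ks (fun=> discrete_topology Ks) x _ _
  (discrete_set1 _))).
exact.
Qed.

Lemma cvg_galois (F : set_system galois_group) s :
  Filter F -> (forall x, F [set t : galois_group | t x = s x]) -> F --> s.
Proof.
move=> FF Fs; apply: (@cvg_initial _ _ galois_eval) => //.
apply/cvg_sup => x; apply: (@cvg_initial _ (discrete_topology Ks)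
  (fun y : Ks -> discrete_topology Ks => y x)).
move=> A /principal_filterP As.
suff : F [set t : galois_group | A (t x)] by [].
by apply: filterS (Fs x) => t /= ->.
Qed.

Lemma galois_mul_continuous :
  continuous (fun st : galois_group * galois_group => (st.1 * st.2)%g).
Proof.
move=> [s t]; apply: cvg_galois => x.
exists ([set u : galois_group | u (t x) = s (t x)],
        [set v : galois_group | v x = t x]).
  by split; exact: nbhs_galois.
by move=> [u v] [/= us vt]; rewrite vt us.
Qed.

Lemma galois_inv_continuous : continuous (fun s : galois_group => (s^-1)%g).
Proof.
move=> s; have Fs := nbhs_filter (s : galois_group); apply: cvg_galois => x.
suff : nbhs s [set t : galois_group | galois_inv_fun t x = galois_inv_fun s x].
  by [].
apply: filterS (nbhs_galois s (galois_inv_fun s x)) => t /= tE.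
by apply: (can_inj (galois_funK t)); rewrite galois_invK tE galois_invK.
Qed.

HB.instance Definition _ := isTopologicalGroup.Build galois_group
  galois_mul_continuous galois_inv_continuous.

(* A fixed square root of a; it exists when char K <> 2 and Ks is separably
   closed. For a != 0, kummer a below is the class (a), for any choice of the
   root; kummer 0 is 0 and is not meaningful. *)
Definition root2 (a : K) : Ks := xget 0 [set r | r ^+ 2 = iota a].

Lemma galois_root2 s a : s (root2 a) = root2 a \/ s (root2 a) = - root2 a.
Proof.
have [sB [s1 sM] _ si] := galois_is_aut s.
rewrite /root2; case: xgetP => [r _ /= r2|_]; last first.
  by left; have := sB 0 0; rewrite !subrr.
have : (s r == r) || (s r == - r).
  by rewrite -eqf_sqr expr2 -sM -expr2 r2 si.
by case/orP => /eqP ->; [left|right].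
Qed.

Definition kummer_cochain (a : K) : ('I_1 -> galois_group) -> 'F_2 :=
  fun x => (x ord0 (root2 a) != root2 a)%:R.

Lemma kummer_cocycle a : kummer_cochain a \in cocycles galois_group 1.
Proof.
apply/cocyclesP; split.
  move=> x; have Fx := nbhs_filter x.
  have : nbhs x [set y : {ptws 'I_1 -> galois_group} |
      y ord0 (root2 a) = x ord0 (root2 a)].
    exact: (@proj_continuous 'I_1 (fun=> galois_group) ord0 x _
      (nbhs_galois (x ord0) (root2 a))).
  by apply: filterS => y /= yx; rewrite /kummer_cochain yx.
apply/funext => x; rewrite /cobound /kummer_cochain !big_ord_recl big_ord0 /=.
set s := x (widen_ord (leqnSn 1) ord0); set t := x (lift ord0 ord0).
rewrite -/(t (root2 a)).
have -> : face 0 x ord0 = t by [].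
have -> : face (bump 0 (bump 0 0)) x ord0 = s by [].
set r := root2 a; rewrite addr0.
have [sB _ _ _] := galois_is_aut s.
have [-> | tr] := galois_root2 t a; first by rewrite eqxx /= add0r addff2.
have sN : s (- r) = - s r.
  by have := sB 0 r; have := sB 0 0; rewrite !subrr !sub0r => -> ->; rewrite sub0r.
rewrite -/r in tr; rewrite tr sN.
have [-> | ->] := galois_root2 s a; first by rewrite eqxx /= addr0 addff2.
by rewrite -/r opprK eqxx /= add0r addff2.
Qed.

Definition kummer (a : K) : cohomology galois_group 1 :=
  \pi_(cohomology galois_group 1) (Cocycle (kummer_cocycle a)).

Definition diagonalizes (V : vectType K) (q : V -> K)
    (e : (\dim {:V}).-tuple V) (a : 'I_(\dim {:V}) -> K) : Prop :=
  [/\ basis_of {:V} e, forall i, a i != 0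
    & forall x : 'I_(\dim {:V}) -> K,
        q (\sum_i x i *: tnth e i) = \sum_i a i * x i ^+ 2].

(* w_m of the diagonal form <a_0, ..., a_{n-1}>; the sum is over the strictly
   increasing m-tuples of indices. *)
Definition hasse_witt_diag n m (a : 'I_n -> K) : cohomology galois_group m :=
  \sum_(i : {ffun 'I_m -> 'I_n} |
         [forall j : 'I_m, forall k : 'I_m, (j < k)%N ==> (i j < i k)%N])
    cup_prod (fun j => kummer (a (i j))).

(* The value does not depend on the diagonalization picked by xget; the default
   0 is only used for maps q that have no diagonalization. *)
Definition hasse_witt (V : vectType K) (m : nat) (q : V -> K) :
    cohomology galois_group m :=
  xget 0 [set w | exists e a, diagonalizes q e a /\ w = hasse_witt_diag m a].

End AbsoluteGaloisGroup.

Section TraceForm.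
Variables (K : fieldType) (L : falgType K).

Definition alg_trace (x : L) : K :=
  \tr (passmx.mxof (vbasis {:L}) (vbasis {:L}) (amull x)).

Definition trace_form (x : L) : K := alg_trace (x ^+ 2).

Definition alg_disc : K :=
  \det (\matrix_(i < \dim {:L}, j < \dim {:L})
          alg_trace ((vbasis {:L})`_i * (vbasis {:L})`_j)).

(* L is K-isomorphic to a finite product of finite separable extensions of K; in
   particular L is commutative. *)
Definition etale : Prop :=
  exists (r : nat) (E : 'I_r -> fieldExtType K)
         (p : forall i, {lrmorphism L -> E i}),
    (forall i, separable 1 {:E i}%VS) /\
    (forall y : forall i, E i, exists! x : L, forall i, p i x = y i).

End TraceForm.

Record galois_algebra (K Ks : fieldType) (iota : {rmorphism K -> Ks})
    (gT : finGroupType) (L : falgType K) (act : gT -> {lrmorphism L -> L}) : Prop :=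
  GaloisAlgebra {
  galois_algebra_etale : etale L;
  galois_algebra_degree : \dim {:L} = #|gT|;
  galois_algebra_act1 : forall x, act 1%g x = x;
  galois_algebra_actM : forall g h x, act (g * h)%g x = act g (act h x);
  (* the induced left action on Hom_K(L, Ks) is (g, f) |-> f \o act g^-1 *)
  galois_algebra_simply_transitive :
    forall f f' : {lrmorphism L -> Ks | iota \; *%R},
      exists! g : gT, forall x, f (act g^-1%g x) = f' x }.

(* Main.v *)
(* Over Ks the Galois conjugates of an orthogonal K-basis of L, divided by square
   roots of the diagonal coefficients a_i of q_L, form an orthonormal basis of Ks^G.
   Let U be a lift of this basis to the Pin group.  If s in G_K acts on the
   conjugates through right multiplication by phi s, then
     s(U) = +- tau(phi s)^-1 U E(s),
   where tau g is a lift of the permutation of G given by g, and E(s) is the product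
   of the generators e_i with s(sqrt a_i) = - sqrt a_i.  When tau is multiplicative,
   comparing (s t)(U) with s(t(U)) shows that w_2(q_L) - (2)(d) is the coboundary of
   the sign: products of the E(s) produce w_2(q_L), and (2)(d) appears because the
   transposition (i j) lifts to (e_i - e_j) / sqrt 2.

   It remains to find a multiplicative tau, i.e. to show that the class x in
   H^2(G, Z/2) of the regular representation vanishes.  If a Sylow 2-subgroup is
   cyclic, this is seen on a generator.  Otherwise G contains a Klein four-group or
   a quaternion group H, and x is the transfer of the analogous class y of H.  For
   quaternion H the class y vanishes.  For a Klein four-group H the restriction of x
   to H vanishes because n = 0, 2 mod 8, hence x^2 = tr(y . res x) = 0, and x = 0
   because G is 2-reduced. *)

From HB Require Import structures.
Require Import Defs.
From mathcomp Require Import all_boot all_order all_algebra all_fingroup all_solvable all_field.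
From mathcomp Require Import generic_quotient ring_quotient.
From mathcomp Require Import boolp classical_sets functions topology.
From mathcomp Require Import ring.

Set Implicit Arguments.
Unset Strict Implicit.
Unset Printing Implicit Defensive.

Import GRing.Theory.
Local Open Scope ring_scope.

(** * Pin groups in matrix form *)

(** A lift of an isometry is a matrix subject to a few relations, which determine it up to sign
    ([pin_unique]). So every cocycle here is the boolean sign in an identity between matrices, and
    its cocycle condition is associativity; the cohomology ring of G enters only through
    [two_reduced].

    The residues 0 and 2 come from a binomial coefficient. A product of m disjoint transpositions
    lifts, up to sign, to a product of m anticommuting elements of square 1, whose square is
    (-1)^C(m,2). An involution of G acts on G with m = n/2, and C(n/2,2) is even exactly when n/2 =
    0 or 1 mod 4.

    Passing from H to G costs reordering signs, which disappear when 4 divides |H|; a cyclic Sylow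
    subgroup may have order 2, whence its separate treatment. The quaternion group is rescued by its
    automorphism of order 3, which makes the signs in three relations equal.

    Cochains on H are replaced, in the style of Shapiro's lemma, by functions on G invariant under
    left translation by H, so that transfer is a sum over a transversal. *)

Section Clifford.
Variables (F : fieldType) (I : finType).
Local Notation A := ('M[F]_#|{set I}|).
Implicit Types (S T : {set I}) (i j k : I) (U W : A).

Definition flip i S : {set I} := [set j | (j \in S) (+) (j == i)].

Lemma flipK i : involutive (flip i).
Proof. by move=> S; apply/setP => j; rewrite !inE addbK. Qed.

Lemma flipC i j S : flip i (flip j S) = flip j (flip i S).
Proof. by apply/setP => k; rewrite !inE addbAC. Qed.

Definition parity (P : pred I) S : bool := \big[addb/false]_(j | P j) (j \in S).

Lemma parity_flip P i S : parity P (flip i S) = parity P S (+) P i.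
Proof.
rewrite /parity; under eq_bigr do rewrite inE.
rewrite big_split /=; congr (_ (+) _).
rewrite big_mkcond (bigD1 i) //= eqxx big1 ?addbF; first by case: (P i).
by move=> j /negPf ->; case: (P j).
Qed.

Lemma parity0 P : parity P finset.set0 = false.
Proof. by rewrite /parity big1 // => j _; rewrite inE. Qed.

(** A signed permutation matrix for row vectors. A product applies its left factor first, so
    products of right multiplications keep the order of the Clifford product. *)
Definition spm (f : {set I} -> {set I}) (s : {set I} -> bool) : A :=
  \matrix_(a, b) ((-1) ^+ s (enum_val a) *+ (f (enum_val a) == enum_val b)).

Definition entry U S T : F := U (enum_rank S) (enum_rank T).

Lemma entryP U W : (forall S T, entry U S T = entry W S T) -> U = W.
Proof.
move=> UW; apply/matrixP => a b.
by rewrite -[a]enum_valK -[b]enum_valK; exact: UW.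
Qed.

Lemma entry_sign (b : bool) U S T : entry ((-1) ^+ b * U) S T = (-1) ^+ b * entry U S T.
Proof. by case: b; rewrite ?expr1 ?expr0 ?mul1r // !mulN1r /entry mxE. Qed.

Lemma entry_spm f s S T : entry (spm f s) S T = (-1) ^+ s S *+ (f S == T).
Proof. by rewrite /entry mxE !enum_rankK. Qed.

Lemma entry_mul U W S T : entry (U * W) S T = \sum_R entry U S R * entry W R T.
Proof.
rewrite /entry mxE (reindex (@enum_rank {set I})) //.
by exists enum_val => ? _; rewrite ?enum_valK ?enum_rankK.
Qed.

Lemma entry_spmM f s W S T : entry (spm f s * W) S T = (-1) ^+ s S * entry W (f S) T.
Proof.
rewrite entry_mul (bigD1 (f S)) //= big1 ?addr0 => [|R /negPf RS].
  by rewrite entry_spm eqxx.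
by rewrite entry_spm eq_sym RS mul0r.
Qed.

Lemma entry_Mspm f s W S T : involutive f ->
  entry (W * spm f s) S T = entry W S (f T) * (-1) ^+ s (f T).
Proof.
move=> fK; rewrite entry_mul (bigD1 (f T)) //= big1 ?addr0 => [|R RS].
  by rewrite entry_spm fK eqxx.
by rewrite entry_spm (inv_eq fK) (negPf RS) mulr0.
Qed.

Lemma entry1 S T : entry 1 S T = (S == T)%:R.
Proof. by rewrite /entry mxE (can_eq enum_rankK). Qed.

Lemma map_spm (s : {rmorphism F -> F}) f g : map_mx s (spm f g) = spm f g.
Proof. by apply/matrixP => a b; rewrite !mxE rmorphMn /= rmorph_sign. Qed.

Definition lt_rank i j : bool := (enum_rank i < enum_rank j)%N.

(* Right and left multiplication by the generator number i on the standard basis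
   e_S of the Clifford algebra of the form \sum_i x_i^2. *)
Definition gam i : A := spm (flip i) (parity (lt_rank i)).
Definition rho i : A := spm (flip i) (parity (lt_rank^~ i)).
(** The main involution of the Clifford algebra, with eigenvalue -1 on the odd part. *)
Definition grade : A := spm id (parity predT).

Lemma lt_rankNsym i j : i != j -> lt_rank i j = ~~ lt_rank j i.
Proof.
move=> ij; rewrite /lt_rank -leqNgt [RHS]leq_eqVlt.
by rewrite (inj_eq (@ord_inj _)) (inj_eq enum_rank_inj) (negPf ij).
Qed.

Lemma lt_rankxx i : lt_rank i i = false.
Proof. exact: ltnn. Qed.

Lemma gam_sqr i : gam i * gam i = 1.
Proof.
apply: entryP => S T.
rewrite entry_spmM entry_spm entry1 flipK parity_flip lt_rankxx addbF.
by rewrite mulrnAr -signr_addb addbb.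
Qed.

Lemma gam_anti i j : i != j -> gam i * gam j = - (gam j * gam i).
Proof.
move=> ij; apply: entryP => S T; rewrite -mulN1r -(expr1 (-1)).
rewrite (entry_sign true) !entry_spmM !entry_spm !parity_flip flipC.
rewrite !mulrnAr -!signr_addb; congr ((-1) ^+ (nat_of_bool _) *+ _).
rewrite (lt_rankNsym ij).
by case: (parity _ _); case: (parity _ _); case: (lt_rank _ _).
Qed.

Lemma gam_rho i j : gam i * rho j = rho j * gam i.
Proof.
apply: entryP => S T.
rewrite !entry_spmM !entry_spm !parity_flip flipC !mulrnAr -!signr_addb.
by rewrite addbCA addbA (addbC (parity _ S)) -!addbA.
Qed.

Lemma grade_gam i : grade * gam i = - (gam i * grade).
Proof.
apply: entryP => S T; rewrite -mulN1r -(expr1 (-1)).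
rewrite (entry_sign true) !entry_spmM !entry_spm !parity_flip /= !mulrnAr -!signr_addb.
by congr (_ *+ _); case: (parity _ _); case: (parity _ _); rewrite /= ?expr0 ?expr1 ?mulr1 ?mulrNN ?mulr1.
Qed.

Lemma gam_tr i : (gam i)^T = gam i.
Proof.
apply: entryP => S T; rewrite {1}/entry mxE -/(entry (gam i) T S) !entry_spm.
rewrite (inv_eq (flipK i)) eq_sym.
by case: eqP => // <-; rewrite parity_flip lt_rankxx addbF.
Qed.

Hypothesis F2 : (2%:R : F) != 0.

Lemma sign_inj (a b : bool) : (-1) ^+ a = (-1) ^+ b :> F -> a = b.
Proof.
have neq1 : -1 != 1 :> F by rewrite eq_sym -subr_eq0 opprK -mulr2n.
move: a b => [] [] //=; rewrite ?expr1 ?expr0 => /eqP; first by rewrite (negPf neq1).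
by rewrite eq_sym (negPf neq1).
Qed.

Lemma parity_split i S : parity predT S = parity (lt_rank i) S (+) parity (lt_rank^~ i) S (+) (i \in S).
Proof.
rewrite /parity (bigD1 i) //= addbC; congr (_ (+) _).
rewrite (bigID (lt_rank i)) /=; congr (_ (+) _); apply: eq_bigl => j.
  by have [->|] := eqVneq j i; rewrite ?lt_rankxx.
by have [->|/lt_rankNsym ->] := eqVneq j i; rewrite ?lt_rankxx.
Qed.

(** The twisted centre reduces to scalars in every dimension, whereas the product of an odd number
    of generators is central in the ordinary sense. Commutation with the [rho i] makes the row at
    the empty set determine [U]. *)
Lemma twisted_central U (e : bool) :
    (forall i, U * rho i = rho i * U) -> grade * U = (-1) ^+ e * (U * grade) ->
    (forall i, U * gam i = (-1) ^+ e * (gam i * U)) ->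
  exists a : F, U = a%:M.
Proof.
move=> Urho Ugrade Ugam; exists (entry U finset.set0 finset.set0).
(* For [i \in T] the three relations compare signs of the same entry; [parity_split] makes them
   incompatible unless the entry is 0. *)
have row0 T : T != finset.set0 -> entry U finset.set0 T = 0.
  case/set0Pn => i iT; apply/eqP/negP => /negP UT0.
  have := congr1 (fun W => entry W finset.set0 (flip i T)) (Ugam i).
  have := congr1 (fun W => entry W finset.set0 (flip i T)) (Urho i).
  have := congr1 (fun W => entry W finset.set0 T) Ugrade.
  rewrite !entry_sign !entry_spmM !entry_Mspm //; try exact: flipK.
  rewrite !parity0 !expr0 !mul1r !flipK => gr <-.
  rewrite mulrCA => /(mulfI UT0); rewrite -signr_addb => /sign_inj gE.
  move: gr; rewrite mulrCA -{1}[entry _ _ _]mulr1 => /(mulfI UT0).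
  rewrite -signr_addb -(expr0 (-1)) => /(@sign_inj false).
  by rewrite (parity_split i) gE iT; case: (e); case: (parity _ _).
have inv i : involutive (flip i) by exact: flipK.
(* [rho i] with [i \in S] relates the row [S] to the smaller row [flip i S]. *)
apply: entryP => S; have [m] := ubnP #|S|; elim: m S => // m IHm S.
rewrite ltnS => leSm T.
have -> : entry (entry U finset.set0 finset.set0)%:M S T =
  entry U finset.set0 finset.set0 *+ (S == T).
  by rewrite {1}/entry mxE (can_eq enum_rankK).
have [->|/set0Pn[i iS]] := eqVneq S finset.set0.
  by rewrite eq_sym; have [->|/row0 ->] := eqVneq T finset.set0.
have S'm : (#|flip i S| < m)%N.
  apply: leq_trans leSm; apply: proper_card; apply/properP; split.
    by apply/fintype.subsetP => j; rewrite inE; case: eqP => [-> |]; rewrite ?addbF ?iS.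
  by exists i; rewrite ?inE ?iS ?eqxx.
have := congr1 (fun W => entry W (flip i S) T) (Urho i).
rewrite entry_spmM entry_Mspm // flipK (IHm _ S'm).
rewrite {1}/entry mxE (can_eq enum_rankK) (can_eq (inv i)).
have [<-|_] := eqVneq S T; last first.
  by rewrite mul0r => /esym/eqP; rewrite mulf_eq0 signr_eq0 => /eqP.
by rewrite mulrC => /(mulfI (negbT (signr_eq0 _ _))).
Qed.

End Clifford.

Lemma signrCA (R : pzRingType) (b : bool) (x y : R) :
  x * ((-1) ^+ b * y) = (-1) ^+ b * (x * y).
Proof. by case: b; rewrite ?expr0 ?mul1r // !mulN1r mulrN. Qed.

Lemma signrMK (R : pzRingType) (b : bool) : involutive ( *%R ((-1 : R) ^+ b)).
Proof. by move=> x; rewrite mulrA -signr_addb addbb mul1r. Qed.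

Lemma sign_comb (R : pzRingType) (a b : bool) (x : R) :
  (-1) ^+ a * ((-1) ^+ b * x) = (-1) ^+ (a (+) b) * x.
Proof. by rewrite mulrA signr_addb. Qed.

Section Pin.
Variables (F : fieldType) (I : finType).
Hypothesis F2 : (2%:R : F) != 0.
Local Notation A := ('M[F]_#|{set I}|).
Local Notation gam := (@gam F I).
Local Notation rho := (@rho F I).
Local Notation grade := (@grade F I).
Implicit Types (i j k : I) (U W : A) (p a b : bool) (v : I -> A) (f g : {perm I}).

(* U is in the Pin group and its twisted conjugation action maps the basis vector
   gam i to v i; p is the parity of U.  Commuting with all rho i means that U
   lies in the Clifford algebra, and U U^T = 1 normalizes the spinor norm. *)
Record pin U p v : Prop := Pin {
  pin_unit : U * U^T = 1;
  pin_rho : forall i, U * rho i = rho i * U;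
  pin_grade : grade * U = (-1) ^+ p * (U * grade);
  pin_gam : forall i, U * gam i = (-1) ^+ p * (v i * U) }.

Lemma pin_trK U p v : pin U p v -> U^T * U = 1.
Proof. by case=> UU _ _ _; exact: mulmx1C. Qed.

Lemma pin_trA U p v x : pin U p v -> U^T * (U * x) = x.
Proof. by move/pin_trK => UU; rewrite mulrA UU mul1r. Qed.

Lemma set_entry_neq0 (a : F) : a%:M = 0 :> A -> a = 0.
Proof.
move=> /matrixP/(_ (enum_rank finset.set0) (enum_rank finset.set0)).
by rewrite !mxE eqxx.
Qed.

Lemma sign_injA U W a b : W * U = 1 -> (-1) ^+ a * U = (-1) ^+ b * U -> a = b.
Proof.
move=> WU ab; apply: (@sign_inj F F2); apply/eqP; rewrite -subr_eq0; apply/eqP.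
apply: set_entry_neq0; rewrite rmorphB !rmorph_sign.
have := congr1 (fun x => W * x) ab; rewrite /= !signrCA WU !mulr1 => ->.
by rewrite subrr.
Qed.

(** [U^T * U'] is twisted central, hence a scalar; the normalization of [pin] makes its square 1. A
    non-zero scalar commutes with [grade], which forces equal parities. *)
Lemma pin_unique U U' p p' v : pin U p v -> pin U' p' v ->
  p = p' /\ exists b, U' = (-1) ^+ b * U.
Proof.
move=> pU pU'; pose W := U^T * U'.
have UU := pin_trK pU; have UU' := pin_trK pU'.
have UW : U' = U * W by rewrite mulrA (pin_unit pU) mul1r.
have Wgrade : grade * W = (-1) ^+ (p (+) p') * (W * grade).
  have Ut : grade * U^T = (-1) ^+ p * (U^T * grade).
    have := congr1 (fun x => x * U^T) (pin_grade pU).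
    rewrite -!mulrA => /(congr1 (fun x => (-1) ^+ p * (U^T * x))).
    by rewrite signrCA signrMK (pin_trA _ pU) => <-; rewrite (pin_unit pU) mulr1.
  by rewrite mulrA Ut -!mulrA (pin_grade pU') signrCA sign_comb.
have Wrho i : W * rho i = rho i * W.
  have Ut : rho i * U^T = U^T * rho i.
    rewrite -[LHS](pin_trA _ pU); congr (_ * _).
    by rewrite mulrA (pin_rho pU) -mulrA (pin_unit pU) mulr1.
  by rewrite mulrA Ut -!mulrA (pin_rho pU').
have Wgam i : W * gam i = (-1) ^+ (p (+) p') * (gam i * W).
  have Ut : gam i * U^T = (-1) ^+ p * (U^T * v i).
    rewrite -[LHS](pin_trA _ pU).
    rewrite [U * _]mulrA (pin_gam pU) -!mulrA (pin_unit pU) mulr1.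
    by rewrite signrCA.
  rewrite /W -mulrA (pin_gam pU') signrCA [gam i * _]mulrA Ut -!mulrA sign_comb.
  by rewrite addbAC addbb.
have [a Wa] := twisted_central F2 Wrho Wgrade Wgam.
have aa : a * a = 1.
  have : W * W^T = 1.
    rewrite /W; have -> : (U^T * U')^T = U'^T * U by rewrite trmx_mul trmxK.
    by rewrite -mulrA (mulrA U') (pin_unit pU') mul1r.
  rewrite Wa tr_scalar_mx -[_ * _]scalar_mxM => /eqP.
  rewrite -subr_eq0 -raddfB /= => /eqP/set_entry_neq0/eqP.
  by rewrite subr_eq0 => /eqP.
have [b ab] : exists b, a = (-1) ^+ b.
  have : a ^+ 2 == 1 ^+ 2 by rewrite expr1n expr2 aa.
  by rewrite eqf_sqr => /orP[] /eqP ->; [exists false|exists true].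
have Wb : W = (-1) ^+ b by rewrite Wa ab; case: (b); rewrite ?raddfN.
split; last by exists b; rewrite UW Wb; exact: commr_sign.
move: Wgrade; rewrite Wb commr_sign => /(congr1 ( *%R ((-1) ^+ b))).
rewrite signrMK signrCA signrMK.
have gg : grade * grade = 1.
  apply: entryP => S T; rewrite entry_spmM entry_spm entry1 mulrnAr.
  by rewrite -signr_addb addbb.
rewrite -[grade in LHS]mul1r -(expr0 (-1)) => /(@sign_injA _ _ false _ gg).
by case: (p); case: (p').
Qed.

Lemma pin1 : pin 1 false gam.
Proof.
have t1 : (1 : A)^T = 1 by exact: trmx1.
by split=> [|i||i]; rewrite ?t1 ?mulr1 ?mul1r.
Qed.

Lemma pinM U U' p p' v v' v'' : pin U p v -> pin U' p' v' ->
  (forall i, U * v' i = (-1) ^+ p * (v'' i * U)) -> pin (U * U') (p (+) p') v''.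
Proof.
move=> pU pU' v''E; split=> [|i||i].
- have -> : (U * U')^T = U'^T * U^T by exact: trmx_mul.
  by rewrite -mulrA (mulrA U') (pin_unit pU') mul1r (pin_unit pU).
- by rewrite -mulrA (pin_rho pU') !mulrA (pin_rho pU).
- by rewrite mulrA (pin_grade pU) -!mulrA (pin_grade pU') signrCA sign_comb.
- rewrite -mulrA (pin_gam pU') signrCA [U * (_ * _)]mulrA v''E -!mulrA sign_comb.
  by rewrite addbC.
Qed.

Lemma pin_ext U p v v' : v =1 v' -> pin U p v -> pin U p v'.
Proof. by move=> vv' [? ? ? Ug]; split=> // i; rewrite -vv'. Qed.

Lemma pin_sign b U p v : pin U p v -> pin ((-1) ^+ b * U) p v.
Proof.
move=> [UU Ur Ud Ug].
have sT : ((-1) ^+ b * U)^T = (-1) ^+ b * U^T.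
  by case: (b); rewrite ?expr0 ?mul1r // !mulN1r raddfN.
split=> [|i||i]; rewrite ?sT.
- by rewrite signrCA mulrA signrMK.
- by rewrite -mulrA Ur signrCA.
- by rewrite signrCA Ud -mulrA signrCA.
- by rewrite -mulrA Ug (signrCA b (v i)) signrCA.
Qed.

Lemma pin_map (s : {rmorphism F -> F}) U p v : pin U p v ->
  pin (map_mx s U) p (fun i => map_mx s (v i)).
Proof.
have sgE b : map_mx s ((-1 : A) ^+ b) = (-1) ^+ b by exact: rmorph_sign.
move=> [UU Ur Ud Ug]; split=> [|i||i].
- by rewrite map_trmx -rmorphM UU rmorph1.
- by have := congr1 (map_mx s) (Ur i); rewrite !rmorphM /= map_spm.
- by have := congr1 (map_mx s) Ud; rewrite !rmorphM /= map_spm sgE.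
- by have := congr1 (map_mx s) (Ug i); rewrite !rmorphM /= map_spm sgE.
Qed.

Lemma scaleAl (c : F) U W : (c *: U) * W = c *: (U * W).
Proof. exact/esym/scalemxAl. Qed.

Lemma scaleAr (c : F) U W : U * (c *: W) = c *: (U * W).
Proof. exact/esym/scalemxAr. Qed.

Definition gvec (u : I -> F) : A := \sum_k u k *: gam k.

Lemma gvecM (u w : I -> F) :
  gvec u * gvec w + gvec w * gvec u = (2%:R * \sum_k u k * w k)%:M.
Proof.
rewrite /gvec !mulr_suml -scalemx1 mulr_sumr scaler_suml.
under eq_bigr do rewrite mulr_sumr.
under [X in _ + X]eq_bigr do rewrite mulr_sumr.
rewrite [X in _ + X]exchange_big -big_split /=; apply: eq_bigr => k _.
rewrite -big_split /= (bigD1 k) //= big1 ?addr0 => [|l lk].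
  rewrite !scaleAl !scaleAr gam_sqr !scalerA (mulrC (w k)) -scalerDl.
  by rewrite -mulr2n mulr_natl.
rewrite !scaleAl !scaleAr (gam_anti _ lk) !scalerN !scalerA (mulrC (w l)).
by rewrite subrr.
Qed.

Lemma gvec_sqr u : \sum_k u k ^+ 2 = 1 -> gvec u * gvec u = 1.
Proof.
move=> u1; have := gvecM u u.
rewrite (eq_bigr _ (fun k _ => esym (expr2 (u k)))) u1 mulr1 -scalemx1.
by rewrite -mulr2n -scaler_nat => /(scalerI F2).
Qed.

Lemma gvec_delta i : gvec (fun k => (k == i)%:R) = gam i.
Proof.
rewrite /gvec (bigD1 i) //= eqxx scale1r big1 ?addr0 // => k /negPf ->.
by rewrite scale0r.
Qed.

Lemma gvec_reflect u w :
  gvec u * gvec w = - ((gvec w - (2%:R * \sum_k u k * w k) *: gvec u) * gvec u)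
    + (2%:R * \sum_k u k * w k) *: (1 - gvec u * gvec u).
Proof.
apply: (addIr (gvec w * gvec u)); rewrite gvecM mulrBl scaleAl opprB scalerBr.
by rewrite -scalemx1 addrAC subrK addrC subrK.
Qed.

Lemma gvecB u w : gvec (fun k => u k - w k) = gvec u - gvec w.
Proof. by rewrite /gvec -sumrB; apply: eq_bigr => k _; rewrite scalerBl. Qed.

Lemma gvecZ (a : F) u : gvec (fun k => a * u k) = a *: gvec u.
Proof. by rewrite /gvec scaler_sumr; apply: eq_bigr => k _; rewrite scalerA. Qed.

(** Twisted conjugation by a unit vector is the reflection in the orthogonal hyperplane; without the
    twist it would be the opposite map. *)
Lemma gvec_pin u : \sum_k u k ^+ 2 = 1 ->
  pin (gvec u) true (fun i => gam i - (2%:R * u i) *: gvec u).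
Proof.
move=> u1; have uu := gvec_sqr u1; split=> [|i||i].
- suff -> : (gvec u)^T = gvec u by [].
  rewrite /gvec raddf_sum /=; apply: eq_bigr => k _.
  by rewrite linearZ /= gam_tr.
- rewrite mulr_suml mulr_sumr; apply: eq_bigr => k _.
  by rewrite scaleAl scaleAr gam_rho.
- rewrite mulr_suml mulr_sumr mulr_sumr; apply: eq_bigr => k _.
  by rewrite scaleAl scaleAr grade_gam expr1 mulN1r scalerN.
- have := gvec_reflect u (fun k => (k == i)%:R).
  rewrite gvec_delta uu subrr scaler0 addr0 => ->.
  rewrite (bigD1 i) //= eqxx mulr1 big1 ?addr0 ?mulN1r // => k /negPf ->.
  by rewrite mulr0.
Qed.

(** Permutations compose from left to right; with the inverse, lifts multiply in the same order. *)
Definition pinp U f : Prop := pin U (odd_perm f) (fun i => gam ((f^-1)%g i)).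

Lemma pinp_gam U f i : pinp U f -> U * gam (f i) = (-1) ^+ (odd_perm f) * (gam i * U).
Proof. by move=> pU; rewrite (pin_gam pU) permK. Qed.

Lemma pinp1 : pinp 1 1%g.
Proof. by rewrite /pinp odd_perm1; apply: pin_ext pin1 => i; rewrite invg1 perm1. Qed.

Lemma pinpM U U' f g : pinp U f -> pinp U' g -> pinp (U * U') (f * g)%g.
Proof.
move=> pU pU'; rewrite /pinp odd_permM; apply: (pinM pU pU') => i.
by rewrite (pin_gam pU) invMg permM.
Qed.

Lemma pinpV U f : pinp U f -> pinp U^T f^-1%g.
Proof.
move=> pU; have UU := pin_unit pU; have UU' := pin_trK pU.
have gU i : gam i * U^T = (-1) ^+ (odd_perm f) * (U^T * gam ((f^-1)%g i)).
  have := congr1 (fun x => U^T * x * U^T) (pin_gam pU i).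
  by rewrite /= mulrA UU' mul1r => ->; rewrite signrCA -!mulrA UU mulr1.
rewrite /pinp odd_permV; split=> [|i||i].
- by rewrite trmxK.
- have := congr1 (fun x => U^T * x * U^T) (pin_rho pU i).
  by rewrite /= (pin_trA _ pU) -!mulrA UU mulr1.
- have := congr1 (fun x => U^T * x * U^T) (pin_grade pU).
  rewrite /= signrCA (pin_trA _ pU) -!mulrA UU mulr1 => ->.
  by rewrite signrMK.
- rewrite invgK; apply: (inv_inj (signrMK (odd_perm f))); rewrite signrMK gU.
  by rewrite permK.
Qed.

Lemma pinp_unique U U' f : pinp U f -> pinp U' f -> exists b, U' = (-1) ^+ b * U.
Proof. by move=> pU pU'; have [] := pin_unique pU pU'. Qed.

End Pin.

(** * Lifts of permutations and their signs *)

Section Lifts.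
Variables (F : fieldType) (I : finType).
Hypothesis F2 : (2%:R : F) != 0.
Variable r : F.
Hypothesis r2 : r ^+ 2 = 2%:R.
Local Notation A := ('M[F]_#|{set I}|).
Local Notation gam := (@gam F I).
Implicit Types (i j k : I) (U W : A) (p a b : bool) (f g : {perm I}).

Lemma r_neq0 : r != 0.
Proof. by apply: contraNneq F2 => r0; rewrite -r2 r0 expr0n. Qed.

Definition tlift i j : A := r^-1 *: (gam i - gam j).

Let tvec i j k : F := r^-1 * ((k == i)%:R - (k == j)%:R).

Lemma tliftE i j : tlift i j = gvec (tvec i j).
Proof. by rewrite gvecZ gvecB !gvec_delta. Qed.

Lemma rV2 : 2%:R * (r^-1 * r^-1) = 1 :> F.
Proof. by rewrite -r2 expr2 -invfM mulfV // mulf_neq0 // r_neq0. Qed.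

Lemma tvec_unit i j : i != j -> \sum_k tvec i j k ^+ 2 = 1.
Proof.
move=> ij; rewrite (bigD1 i) //= (bigD1 j) 1?eq_sym //= big1 => [|k /andP[ki kj]].
  rewrite /tvec !eqxx (negPf ij) [j == i]eq_sym (negPf ij) subr0 sub0r addr0.
  by rewrite mulr1 mulrN1 sqrrN -mulr2n -mulr_natl expr2 rV2.
by rewrite /tvec (negPf ki) (negPf kj) subrr mulr0 expr0n.
Qed.

Lemma tlift_pinp i j : i != j -> pinp (tlift i j) (tperm i j).
Proof.
move=> ij; rewrite /pinp odd_tperm ij tliftE.
apply: pin_ext (gvec_pin F2 (tvec_unit ij)) => k.
rewrite -tliftE /tlift /tvec scalerA tpermV.
have E x : 2%:R * (r^-1 * x) * r^-1 = x.
  by rewrite -mulrA [r^-1 * x]mulrC -!mulrA mulrCA rV2 mulr1.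
rewrite E; case: tpermP => [->|->|/eqP ki /eqP kj].
- by rewrite eqxx (negPf ij) subr0 scale1r subKr.
- by rewrite eqxx eq_sym (negPf ij) sub0r scaleN1r opprK addrC subrK.
- by rewrite (negPf ki) (negPf kj) subrr scale0r subr0.
Qed.

(* Induction over a factorization of f into transpositions of its support. *)
Lemma perm_lift_ind f (Q : A -> bool -> Prop) :
  Q 1 false ->
  (forall i j U p, f i != i -> f j != j -> i != j -> Q U p ->
     Q (tlift i j * U) (~~ p)) ->
  exists2 U, pinp U f & Q U (odd_perm f).
Proof.
move=> Q1 QM; suff: forall n g, (#|[set i | g i != i]| < n)%N ->
    {subset [pred i | g i != i] <= [pred i | f i != i]} ->
    exists2 U, pinp U g & Q U (odd_perm g) by apply; [exact: ltnSn|].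
elim=> // n IHn g; rewrite ltnS => gn gf.
have [/setP g0|[i]] := set_0Vmem [set i | g i != i].
  have -> : g = 1%g.
    by apply/permP => i; have := g0 i; rewrite !inE perm1 => /negbFE/eqP.
  by exists 1; [exact: pinp1|rewrite odd_perm1].
rewrite inE => gi; pose t := tperm i (g i); pose g' := (t * g)%g.
have gE : g = (t * g')%g by rewrite mulgA tperm2 mul1g.
have g'fix : g' (g i) = g i by rewrite permM tpermR.
have g'g j : g' j != j -> g j != j.
  rewrite permM; case: tpermP => [->|->|//] //.
  by rewrite eqxx.
have [|j /=|U pU QU] := IHn g'.
- apply: leq_trans gn; apply: proper_card; apply/properP; split.
    by apply/fintype.subsetP => j; rewrite !inE; exact: g'g.
  by exists (g i); rewrite !inE ?g'fix ?eqxx // (inj_eq perm_inj).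
- by move/g'g => gj; apply: gf.
have ig : i != g i by rewrite eq_sym.
have pTU := pinpM (tlift_pinp ig) pU.
exists (tlift i (g i) * U); first by rewrite -gE in pTU.
have -> : odd_perm g = ~~ odd_perm g'.
  by rewrite {1}gE odd_permM odd_tperm eq_sym gi.
have ggi : g (g i) != g i by rewrite (inj_eq perm_inj).
exact: QM (gf i gi) (gf (g i) ggi) ig QU.
Qed.

Lemma perm_lift f : exists U, pinp U f.
Proof. by have [//|//|U] := @perm_lift_ind f (fun _ _ => True); exists U. Qed.

(* The lift may be written with the vectors gam j, j in the support of f, only. *)
Lemma pinp_supercomm U f W p : pinp U f ->
    (forall j, f j != j -> gam j * W = (-1) ^+ p * (W * gam j)) ->
  U * W = (-1) ^+ (odd_perm f && p) * (W * U).
Proof.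
move=> pU fW; pose Q U' b := U' * W = (-1) ^+ (b && p) * (W * U').
have [|i j U' b fi fj ij|U' pU'] := @perm_lift_ind f Q.
- by rewrite /Q /= expr0 !mul1r mulr1.
- rewrite /Q => U'W; rewrite -mulrA U'W signrCA (mulrA _ W).
  have -> : tlift i j * W = (-1) ^+ p * (W * tlift i j).
    by rewrite /tlift scaleAl !scaleAr mulrBl !fW // -!mulrBr.
  by rewrite -!mulrA sign_comb; congr ((-1) ^+ _ * _); case: (b); case: (p).
rewrite /Q => QU'; have [b ->] := pinp_unique F2 pU' pU.
by rewrite -mulrA QU' signrCA [W * (_ * _)]signrCA.
Qed.

(** [U] is written with vectors [gam j] whose indices are fixed by [f'], and each of these
    supercommutes with [U']. *)
Lemma pinp_disjoint U f U' f' : pinp U f -> pinp U' f' ->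
    (forall j, f j != j -> f' j = j) ->
  U * U' = (-1) ^+ (odd_perm f && odd_perm f') * (U' * U).
Proof.
move=> pU pU' ff'; apply: (pinp_supercomm pU) => j /ff' fj.
by rewrite -[in RHS]fj (pinp_gam _ pU') signrMK.
Qed.

(** Each transposition contributes one factor [r^-1], so an automorphism negating [r] multiplies the
    lift by the signature. This is the origin of the term (2)(d). *)
Lemma pinp_galois (s : {rmorphism F -> F}) U f b : s r = (-1) ^+ b * r ->
  pinp U f -> map_mx s U = (-1) ^+ (b && odd_perm f) * U.
Proof.
move=> sr pU; pose Q U' p := map_mx s U' = (-1) ^+ (b && p) * U'.
have sg c : map_mx s ((-1 : A) ^+ nat_of_bool c) = (-1) ^+ c by exact: rmorph_sign.
have [|i j U' p _ _ _|U' pU'] := @perm_lift_ind f Q.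
- by rewrite /Q andbF expr0 mul1r rmorph1.
- rewrite /Q rmorphM /= => ->.
  have -> : map_mx s (tlift i j) = (-1) ^+ b * tlift i j.
    rewrite /tlift map_mxZ raddfB /= !map_spm fmorphV sr invfM.
    by case: (b); rewrite ?expr0 ?invr1 ?mul1r // expr1 invrN1 !mulN1r scaleNr.
  by rewrite signrCA -mulrA sign_comb; congr ((-1) ^+ _ * _); case: (b); case: (p).
rewrite /Q => QU'; have [c ->] := pinp_unique F2 pU' pU.
by rewrite rmorphM /= sg QU' signrCA.
Qed.

Lemma bin2_parity n : odd 'C(n.+1, 2) = odd 'C(n, 2) (+) odd n.
Proof. by rewrite binS bin1 oddD. Qed.

(** Up to sign [U] is a product of [m] anticommuting elements of square 1, and squaring it reverses
    their order, at the price of one sign for each pair. The induction splits off one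
    transposition. *)
Lemma pinp_involution U f m : (f * f)%g = 1%g -> #|[set i | f i != i]| = m.*2 ->
  pinp U f -> odd_perm f = odd m /\ U * U = (-1) ^+ odd 'C(m, 2).
Proof.
elim: m U f => [|m IHm] U f ff fm pU.
  have f1 : f = 1%g.
    apply/permP => i; move/cards0_eq/setP/(_ i): fm.
    by rewrite !inE perm1 => /negbFE/eqP.
  rewrite {}f1 in pU *; split; first by rewrite odd_perm1.
  have [b ->] := pinp_unique F2 (pinp1 F I) pU.
  by rewrite mulr1 -signr_addb addbb.
have [i] : exists i, i \in [set i | f i != i].
  by apply/set0Pn; rewrite -card_gt0 fm.
rewrite inE => fi; pose t := tperm i (f i); pose f' := (t * f)%g.
have fK j : f (f j) = j by rewrite -permM ff perm1.
have fE : f = (t * f')%g by rewrite mulgA tperm2 mul1g.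
have f'i : f' i = i by rewrite permM tpermL fK.
have f'fi : f' (f i) = f i by rewrite permM tpermR.
have f'E j : j != i -> j != f i -> f' j = f j.
  by move=> ji jfi; rewrite permM tpermD // eq_sym.
have f'f' : (f' * f')%g = 1%g.
  apply/permP => j; rewrite permM perm1.
  have [->|ji] := eqVneq j i; first by rewrite !f'i.
  have [->|jfi] := eqVneq j (f i); first by rewrite !f'fi.
  rewrite (f'E j) // f'E ?fK //.
    by apply: contra jfi => /eqP <-; rewrite fK.
  by rewrite (inj_eq perm_inj).
have f'm : #|[set j | f' j != j]| = m.*2.
  apply/eqP; rewrite -(eqn_add2l 2) [X in _ == X](_ : _ = m.+1.*2) // -fm.
  have iS : i \in [set i | f i != i] by rewrite inE.
  have fiS : f i \in [set i | f i != i] :\ i by rewrite !inE fi fK eq_sym fi.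
  rewrite [X in _ == X](cardsD1 i) iS [X in _ == (_ + X)%N](cardsD1 (f i)) fiS.
  rewrite addnA; apply/eqP; congr (_ + #|pred_of_set _|)%N.
  apply/setP => j; rewrite !inE.
  have [->|ji] := eqVneq j i; first by rewrite f'i eqxx andbF.
  have [->|jfi] := eqVneq j (f i); first by rewrite f'fi eqxx.
  by rewrite f'E.
have [U' pU'] := perm_lift f'.
have [f'odd U'2] := IHm _ _ f'f' f'm pU'.
have ifi : i != f i by rewrite eq_sym.
have pT := tlift_pinp ifi.
have TT : tlift i (f i) * tlift i (f i) = 1.
  by rewrite tliftE gvec_sqr // tvec_unit.
have fodd : odd_perm f = odd m.+1.
  by have := congr1 (@odd_perm _) fE; rewrite odd_permM odd_tperm ifi f'odd.
split=> //; have pTU := pinpM pT pU'; rewrite -/t -fE in pTU.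
have [b ->] := pinp_unique F2 pTU pU.
rewrite signrCA mulrA signrMK -mulrA (mulrA U').
have -> : U' * tlift i (f i) = (-1) ^+ odd m * (tlift i (f i) * U').
  rewrite (pinp_disjoint pU' pT) => [|j f'j].
    by rewrite odd_tperm ifi andbT f'odd.
  by apply: tpermD; apply: contraNneq f'j => <-; apply/eqP.
rewrite -!mulrA signrCA [tlift _ _ * (tlift _ _ * _)]mulrA TT mul1r U'2.
by rewrite -signr_addb bin2_parity addbC.
Qed.

End Lifts.

(** * Orthonormal families and products of reflections *)

Section OrthonormalLift.
Variables (F : fieldType) (I : finType).
Hypothesis F2 : (2%:R : F) != 0.
Hypothesis sqrtF : forall a : F, exists c, c ^+ 2 = a.
Local Notation A := ('M[F]_#|{set I}|).
Implicit Types (i j k : I) (b : I -> I -> F) (u w : I -> F).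

Definition dot u w := \sum_k u k * w k.

Definition reflect u w k := w k - 2%:R * dot u w / dot u u * u k.

Definition unit_vec i k : F := (k == i)%:R.

Lemma dotC u w : dot u w = dot w u.
Proof. by apply: eq_bigr => k _; rewrite mulrC. Qed.

Lemma dotDZr u w w' c : dot u (fun k => w k + c * w' k) = dot u w + c * dot u w'.
Proof.
rewrite /dot mulr_sumr -big_split; apply: eq_bigr => k _ /=.
by rewrite mulrDr mulrCA.
Qed.

Lemma dot_unit_vec i w : dot w (unit_vec i) = w i.
Proof.
rewrite /dot (bigD1 i) //= /unit_vec eqxx mulr1 big1 ?addr0 // => k /negPf ->.
by rewrite mulr0.
Qed.

Lemma reflectE u w : reflect u w = fun k => w k + (- (2%:R * dot u w / dot u u)) * u k.
Proof. by apply/funext => k; rewrite mulNr. Qed.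

Lemma dot_reflect_self u w : dot u u != 0 -> dot u (reflect u w) = - dot u w.
Proof.
move=> u0; rewrite reflectE dotDZr mulNr mulfVK //.
by rewrite mulr_natl mulr2n opprD addrA subrr sub0r.
Qed.

Lemma dot_reflect u w w' : dot u u != 0 ->
  dot (reflect u w) (reflect u w') = dot w w'.
Proof.
move=> u0; rewrite (reflectE u w') dotDZr (dotC (reflect u w) u) dot_reflect_self //.
by rewrite (dotC _ w') (reflectE u w) dotDZr (dotC w' w) (dotC w' u); field.
Qed.

Lemma reflect_id u w : dot u w = 0 -> reflect u w = w.
Proof.
by move=> uw; apply/funext => k; rewrite /reflect uw mulr0 !mul0r subr0.
Qed.

(** A reflection is an involution, so multiplication by the normalized vector [c^-1 * u] undoes
    it. *)
Lemma reflect_lift u b p (U : A) : dot u u != 0 ->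
    pin U p (fun i => gvec (reflect u (b i))) ->
  exists U' p', pin (U' : A) p' (fun i => gvec (b i)).
Proof.
move=> u0 pU; have [c cE] := sqrtF (dot u u).
have c0 : c != 0 by apply: contraNneq u0 => c0; rewrite -cE c0 expr0n.
pose e k := c^-1 * u k.
have e1 : \sum_k e k ^+ 2 = 1.
  under eq_bigr do rewrite exprMn [u _ ^+ 2]expr2.
  by rewrite -mulr_sumr -/(dot u u) -cE exprVn mulVf ?expf_neq0.
exists (gvec e * U), (true (+) p).
apply: (pinM (gvec_pin F2 e1) pU) => i.
have dE w : \sum_k e k * w k = c^-1 * dot u w.
  by rewrite mulr_sumr; apply: eq_bigr => k _; rewrite mulrA.
rewrite gvec_reflect gvec_sqr // subrr scaler0 addr0 expr1 mulN1r; congr (- (_ * _)).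
rewrite dE dot_reflect_self // /e !gvecZ scalerA gvecB gvecZ -addrA -opprD -scalerDl.
rewrite [X in X *: _](_ : _ = 0) ?scale0r ?subr0 //.
rewrite mulrN mulrN mulNr -cE expr2 invfM -!mulrA.
by rewrite [c^-1 * (dot _ _ * _)]mulrCA subrr.
Qed.

(** Cartan-Dieudonne, by induction on the number of vectors out of place: at most two reflections
    bring [b i] to [unit_vec i], and they fix every [b j] already in place, which is orthogonal to
    their axes. *)
Lemma orthonormal_lift b : (forall i j, dot (b i) (b j) = (i == j)%:R) ->
  exists U p, pin (U : A) p (fun i => gvec (b i)).
Proof.
have [n] := ubnP #|[set i | `[< b i <> unit_vec i >]]|.
elim: n b => // n IHn b; rewrite ltnS => bn ortho.
have [/setP b0|[i]] := set_0Vmem [set i | `[< b i <> unit_vec i >]].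
  exists 1, false; apply: pin_ext (pin1 F I) => i.
  have := b0 i; rewrite !inE => /asboolPn/contrapT ->.
  by rewrite -[LHS]gvec_delta.
rewrite inE => /asboolP bi.
have IH b' : (forall i j, dot (b' i) (b' j) = (i == j)%:R) ->
    (forall j, b j = unit_vec j -> b' j = unit_vec j) -> b' i = unit_vec i ->
    exists U p, pin (U : A) p (fun i => gvec (b' i)).
  move=> ortho' b'b b'i; apply: IHn ortho'.
  apply: leq_trans bn; apply: proper_card; apply/properP; split.
    apply/fintype.subsetP => j; rewrite !inE => b'j.
    by move=> /b'b/b'j.
  by exists i; rewrite inE; [exact: asboolT|apply/asboolPn => /(_ b'i)].
have bii : dot (b i) (unit_vec i) = b i i by exact: dot_unit_vec.
have eii : dot (unit_vec i) (unit_vec i) = 1.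
  by rewrite dot_unit_vec /unit_vec eqxx.
have dvE c w : dot (fun k => b i k + c * unit_vec i k) w = dot (b i) w + c * w i.
  by rewrite dotC dotDZr dotC dot_unit_vec.
have dvv c : dot (fun k => b i k + c * unit_vec i k) (fun k => b i k + c * unit_vec i k)
    = 1 + c ^+ 2 + 2%:R * c * b i i.
  rewrite dotDZr !dvE ortho eqxx bii /unit_vec eqxx mulr1.
  by rewrite /=; ring.
have dvi c : dot (fun k => b i k + c * unit_vec i k) (b i) = 1 + c * b i i.
  by rewrite dvE ortho eqxx.
have dvj c j : b j = unit_vec j -> dot (fun k => b i k + c * unit_vec i k) (b j) = 0.
  move=> bj; have ij : i != j by apply: contra_not_neq bi => ->.
  by rewrite dvE ortho bj /unit_vec (negPf ij) mulr0 addr0.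
(* In the first case [b i - unit_vec i] is isotropic. The reflection along the sum, whose square is
   4, sends [b i] to the opposite of [unit_vec i], and the one along [unit_vec i] corrects the
   sign. *)
have [bii1|bii1] := eqVneq (b i i) 1.
  pose v k := b i k + 1 * unit_vec i k.
  have vv : dot v v = 2%:R * 2%:R.
    by rewrite dvv bii1 expr1n !mulr1 mulr_natl mulr2n.
  have v0 : dot v v != 0 by rewrite vv mulf_neq0.
  have u0 : dot (unit_vec i) (unit_vec i) != 0 by rewrite eii oner_eq0.
  suff [U [p pU]] : exists U p, pin (U : A) p
      (fun j => gvec (reflect (unit_vec i) (reflect v (b j)))).
    by have [U' [p' pU']] := reflect_lift u0 pU; exact: reflect_lift v0 pU'.
  apply: IH => [j k|j bj|].
  - by rewrite !dot_reflect.
  - rewrite (reflect_id (dvj _ _ bj)) bj reflect_id // dotC dot_unit_vec /unit_vec.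
    by case: eqP => // ij; case: bi; rewrite ij.
  - have rv : reflect v (b i) = fun k => - unit_vec i k.
      apply/funext => k; rewrite /reflect vv dvi bii1 mulr1 mulfV ?mulf_neq0 //.
      by rewrite /v !mul1r opprD addrA subrr sub0r.
    rewrite rv; apply/funext => k; rewrite /reflect dotC dot_unit_vec eii divr1.
    have -> : unit_vec i i = 1 by rewrite /unit_vec eqxx.
    by ring.
pose v k := b i k + -1 * unit_vec i k.
have vv : dot v v = 2%:R * (1 + -1 * b i i).
  by rewrite dvv sqrrN expr1n mulrDr mulr1 mulrA.
have v0 : dot v v != 0 by rewrite vv mulf_neq0 // mulN1r subr_eq0 eq_sym.
suff [U [p pU]] : exists U p, pin (U : A) p (fun j => gvec (reflect v (b j))).
  exact: reflect_lift v0 pU.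
apply: IH => [j k|j bj|].
- by rewrite !dot_reflect.
- by rewrite (reflect_id (dvj _ _ bj)).
- apply/funext => k; rewrite /reflect dvi vv mulfV -?vv //.
  by rewrite /v mul1r mulN1r opprB addrC subrK.
Qed.

End OrthonormalLift.

(** * The regular representation and its lifts *)

Section RightCosets.
Variables (gT : finGroupType) (H : {group gT}).
Local Open Scope group_scope.
Implicit Types g h w : gT.

(** The representative chosen in [H] itself is 1 ([crep_id]), so the transversal contains 1 and [H]
    is the block of 1. *)
Definition crep g : gT := fingroup.repr (H :* g).
Definition cval g : gT := g * (crep g)^-1.
Definition transv : {set gT} := [set w | crep w == w].

Lemma cvalK g : cval g * crep g = g.
Proof. exact: mulgKV. Qed.

Lemma cval_in g : cval g \in H.
Proof. by rewrite /cval -mem_rcoset rcoset_sym /crep mem_repr_rcoset. Qed.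

Lemma crepM h g : h \in H -> crep (h * g) = crep g.
Proof. by move=> hH; rewrite /crep rcosetM (rcoset_id hH). Qed.

Lemma cvalM h g : h \in H -> cval (h * g) = h * cval g.
Proof. by move=> hH; rewrite /cval crepM // mulgA. Qed.

Lemma crep_idem g : crep (crep g) = crep g.
Proof. by rewrite -[in RHS](cvalK g) [RHS]crepM ?cval_in. Qed.

Lemma crepMr g h : crep (crep g * h) = crep (g * h).
Proof. by rewrite -[in RHS](cvalK g) -mulgA [RHS]crepM ?cval_in. Qed.

Lemma crep_transv g : crep g \in transv.
Proof. by rewrite inE crep_idem. Qed.

Lemma transvP w : w \in transv -> crep w = w.
Proof. by rewrite inE => /eqP. Qed.

Lemma cval_transv w : w \in transv -> cval w = 1.
Proof. by move=> /transvP; rewrite /cval => ->; rewrite mulgV. Qed.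

Lemma crep_id h : h \in H -> crep h = 1.
Proof. by move=> hH; rewrite /crep rcoset_id // repr_group. Qed.

Lemma cvalMtransv h w : h \in H -> w \in transv -> cval (h * w) = h.
Proof. by move=> hH wW; rewrite cvalM // cval_transv // mulg1. Qed.

Lemma crepMtransv h w : h \in H -> w \in transv -> crep (h * w) = w.
Proof. by move=> hH wW; rewrite crepM // transvP. Qed.

Lemma crepMK g w : w \in transv -> crep (crep (w * g) * g^-1) = w.
Proof. by move=> wW; rewrite crepMr mulgK transvP. Qed.

Lemma crepMKV g w : w \in transv -> crep (crep (w * g^-1) * g) = w.
Proof. by move=> wW; rewrite crepMr mulgKV transvP. Qed.

(** [Psi] is a function on the cosets [H :* u], and right translation permutes these cosets. *)
Lemma big_transv_shift (R : Type) (idx : R) (op : Monoid.com_law idx)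
    (Psi : gT -> R) g :
  (forall h u, h \in H -> Psi (h * u) = Psi u) ->
  \big[op/idx]_(w in transv) Psi (w * g) = \big[op/idx]_(w in transv) Psi w.
Proof.
move=> PsiH.
have crepPsi u : Psi (crep u) = Psi u by rewrite -[in RHS](cvalK u) PsiH ?cval_in.
rewrite [RHS](reindex_onto (fun w => crep (w * g)) (fun w => crep (w * g^-1))) /=.
  apply: eq_big => [w|w _]; last by rewrite crepPsi.
  rewrite crep_transv /= inE.
  by apply/idP/idP => [/eqP wE|/eqP <-]; rewrite ?crep_idem // crepMK // inE wE.
by move=> w /crepMKV.
Qed.

Lemma card_transv : #|transv| = #|[set: gT] : H|.
Proof.
have -> : transv = fingroup.repr @: rcosets H [set: gT].
  apply/setP => w; apply/idP/imsetP => [/transvP wE|[C /rcosetsP[g _ ->] ->]].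
    by exists (H :* w) => //; apply/rcosetsP; exists w; rewrite ?inE.
  exact: crep_transv.
rewrite card_in_imset // => C D /rcosetsP[g _ ->] /rcosetsP[k _ ->] gk.
by rewrite -[LHS](rcoset_eqP (mem_repr_rcoset H g)) gk; apply/rcoset_eqP/mem_repr_rcoset.
Qed.

End RightCosets.

Section MultiplicativeLifts.
Variables (F : fieldType) (I : finType) (gT : finGroupType).
Hypothesis F2 : (2%:R : F) != 0.
Local Notation A := ('M[F]_#|{set I}|).
Implicit Types (U V : A) (g h k : gT).

Definition mult_lift (H : {group gT}) (f : gT -> {perm I}) (tau : gT -> A) : Prop :=
  {in H, forall h, pinp (tau h) (f h)} /\
  {in H &, forall h k, tau (h * k)%g = tau h * tau k}.

(** [S h U] reads: [U] is an admissible lift of [h]. When only 1 is admissible over 1,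
    multiplicativity of [S] makes admissible lifts over [H] unique, so any choice of them is a
    homomorphism. *)
Lemma split_lift (H : {group gT}) (f : gT -> {perm I}) (S : gT -> A -> Prop) :
    (forall h U, S h U -> pinp U (f h)) ->
    (forall h k U V, S h U -> S k V -> S (h * k)%g (U * V)) ->
    (forall h, h \in H -> exists U, S h U) ->
    (forall U, S 1%g U -> U = 1) ->
  exists tau, mult_lift H f tau.
Proof.
move=> Slift SM Sex S1.
have /choice[tau tauP] : forall h, exists U, h \in H -> S h U.
  by move=> h; have [/Sex[U hU]|] := boolP (h \in H); [exists U|exists 1].
exists tau; split=> [h /tauP/Slift //|h k hH kH].
have [hk hV] : ((h * k)%g \in H) /\ ((h * k)^-1%g \in H) by rewrite groupV groupM.
have V1 : tau (h * k)^-1%g * tau (h * k)%g = 1.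
  by apply: S1; rewrite -(mulVg (h * k)%g); apply: (SM); exact: tauP.
have V2 : tau (h * k)^-1%g * (tau h * tau k) = 1.
  by apply: S1; rewrite -(mulVg (h * k)%g); apply: (SM); [|apply: SM]; exact: tauP.
have V3 : tau (h * k)%g * tau (h * k)^-1%g = 1 by exact: mulmx1C.
by rewrite -[LHS]mulr1 -V2 mulrA V3 mul1r.
Qed.

Lemma pinp_exp U (f : {perm I}) n : pinp U f -> pinp (U ^+ n) (f ^+ n)%g.
Proof.
move=> pU; elim: n => [|n IHn]; first exact: pinp1.
by rewrite exprS expgS; exact: pinpM.
Qed.

(** The elements of [H] have normal forms [a ^+ m * b ^+ n]. The hypotheses ask that [U] and [V]
    obey the same commutation rule and that every normal form of 1 remain trivial. *)
Lemma two_gen_lift (H : {group gT}) (f : gT -> {perm I})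
    (a b : gT) (U V : A) e :
    {in H &, {morph f : h k / (h * k)%g}} -> a \in H -> b \in H ->
    (forall h, h \in H -> exists m n, h = (a ^+ m * b ^+ n)%g) ->
    pinp U (f a) -> pinp V (f b) ->
    (b * a = a ^+ e * b)%g -> V * U = U ^+ e * V ->
    (forall m n, (a ^+ m * b ^+ n = 1)%g -> U ^+ m * V ^+ n = 1) ->
  exists tau, mult_lift H f tau.
Proof.
move=> fM aH bH Hab pU pV ba VU UV1.
have fab m n : f (a ^+ m * b ^+ n)%g = (f a ^+ m * f b ^+ n)%g.
  have fX l : {in H, {morph f : h / (h ^+ l)%g}} := morphX (Morphism fM) l.
  by rewrite fM ?groupX // !fX.
pose S h W := exists m n, h = (a ^+ m * b ^+ n)%g /\ W = U ^+ m * V ^+ n.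
apply: (@split_lift H f S) => [h W [m [n [-> ->]]]||h /Hab[m [n ->]]|W [m [n [/esym/UV1 ? ->]]] //].
- by rewrite fab; apply: pinpM; exact: pinp_exp.
- move=> h k W W' [m [n [-> ->]]] [m' [n' [-> ->]]].
  have ba1 m1 : (b * a ^+ m1 = a ^+ (e * m1) * b)%g.
    elim: m1 => [|m1 IH]; first by rewrite muln0 !expg0 mulg1 mul1g.
    by rewrite expgS mulgA ba -mulgA IH mulgA -expgD mulnS.
  have ba2 n1 m1 : (b ^+ n1 * a ^+ m1 = a ^+ (e ^ n1 * m1) * b ^+ n1)%g.
    elim: n1 m1 => [|n1 IH] m1; first by rewrite mul1n !expg0 mulg1 mul1g.
    by rewrite [(b ^+ n1.+1)%g]expgSr -mulgA ba1 mulgA IH -mulgA mulnA -expnSr.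
  have VU1 m1 : V * U ^+ m1 = U ^+ (e * m1) * V.
    elim: m1 => [|m1 IH]; first by rewrite muln0 !expr0 mulr1 mul1r.
    by rewrite exprS mulrA VU -mulrA IH mulrA -exprD mulnS.
  have VU2 n1 m1 : V ^+ n1 * U ^+ m1 = U ^+ (e ^ n1 * m1) * V ^+ n1.
    elim: n1 m1 => [|n1 IH] m1; first by rewrite mul1n !expr0 mulr1 mul1r.
    by rewrite [V ^+ n1.+1]exprSr -mulrA VU1 mulrA IH -mulrA mulnA -expnSr.
  exists (m + e ^ n * m')%N, (n + n')%N; split.
    by rewrite -mulgA (mulgA (b ^+ n)%g) ba2 !expgD !mulgA.
  by rewrite -mulrA (mulrA (V ^+ n)) VU2 !exprD !mulrA.
- by exists (U ^+ m * V ^+ n), m, n.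
Qed.

End MultiplicativeLifts.

Section Regular.
Variables (F : fieldType) (gT : finGroupType).
Hypothesis F2 : (2%:R : F) != 0.
Variable r : F.
Hypothesis r2 : r ^+ 2 = 2%:R.
Local Notation A := ('M[F]_#|{set gT}|).
Implicit Types (U V : A) (g h k : gT).

Definition rmul g : {perm gT} := perm (mulIg g).

Lemma rmulE g h : rmul g h = (h * g)%g. Proof. by rewrite permE. Qed.

Lemma rmulM : {in [set: gT] &, {morph rmul : g h / (g * h)%g}}.
Proof. by move=> g h _ _; apply/permP => k; rewrite permM !rmulE mulgA. Qed.

Lemma rmul_mul g h : rmul (g * h)%g = (rmul g * rmul h)%g.
Proof. by rewrite rmulM ?inE. Qed.

Lemma rmul_fix g h : (rmul g h == h) = (g == 1%g).
Proof. by rewrite rmulE -{2}[h]mulg1 (inj_eq (mulgI h)). Qed.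

(** Restriction followed by transfer is multiplication by the index, here on cochains: a section [s]
    equivariant for [tau] has a sign cocycle [x] that depends only on the coset of its first
    argument, and summing over cosets exhibits the odd multiple [x] as a coboundary. *)
Lemma odd_transfer_lift (P : {group gT}) (tau : gT -> A) :
    odd #|[set: gT] : P|%g -> mult_lift P rmul tau ->
  exists tau' : gT -> A, mult_lift [set: gT]%G rmul tau'.
Proof.
move=> oddP [tauP tauM].
have /choice[s0 s0P] : forall g, exists U : A, pinp U (rmul g).
  by move=> g; exact: perm_lift r2 _.
pose s g := tau (cval P g) * s0 (crep P g).
have sP g : pinp (s g) (rmul g).
  by have := pinpM (tauP _ (cval_in P g)) (s0P (crep P g)); rewrite -rmul_mul cvalK.
have sM p g : p \in P -> s (p * g)%g = tau p * s g.
  by move=> pP; rewrite /s cvalM // crepM // tauM ?cval_in // mulrA.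
clearbody s.
have /choice[x0 x0P] : forall gh, exists b : bool,
    s gh.1 * s gh.2 = (-1) ^+ b * s (gh.1 * gh.2)%g.
  by move=> [g h]; apply: (pinp_unique F2 (sP (g * h)%g)); rewrite rmul_mul; exact: pinpM.
pose x g h := x0 (g, h).
have xP g h : s g * s h = (-1) ^+ (x g h) * s (g * h)%g by exact: x0P (g, h).
have sU g : (s g)^T * s g = 1 by exact: pin_trK (sP g).
have xH p g h : p \in P -> x (p * g)%g h = x g h.
  move=> pP; apply: (sign_injA F2 (sU (p * g * h)%g)).
  by rewrite -xP sM // -mulrA xP signrCA -mulgA (sM p).
have xC g h k : x g h (+) x (g * h)%g k = x h k (+) x g (h * k)%g.
  apply: (sign_injA F2 (sU (g * h * k)%g)).
  rewrite -!sign_comb -(xP (g * h)%g k) [LHS]mulrA -xP -mulgA -(xP g (h * k)%g).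
  by rewrite -signrCA -xP mulrA.
pose c g := \big[addb/false]_(w in transv P) x w g.
(* The cocycle identity at [(w, g, h)] is summed over [w]; [x g h] then occurs once for each coset,
   an odd number of times. *)
have cE g h : c g (+) c h (+) c (g * h)%g = x g h.
  have -> : c h = \big[addb/false]_(w in transv P) x (w * g)%g h.
    by rewrite (big_transv_shift addb g (Psi := x^~ h)) // => p u pP; rewrite xH.
  rewrite /c -!big_split /= (eq_bigr (fun=> x g h)) => [|w _].
    rewrite big_const card_transv; move: oddP; elim: #|_ : _|%g => // n IHn /=.
    case: (boolP (odd n)) => [/IHn _ //|/= nodd _].
    suff -> : iter n (addb (x g h)) false = false by rewrite addbF.
    move/negPf: nodd; elim: {IHn} n {-2}n (leqnn n) => [|m IH] [|[|n]] //=.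
    rewrite ltnS => /ltnW nm; rewrite negbK => /(IH _ nm) ->.
    by rewrite addbF addbb.
  by have := xC w g h; case: (x w g); case: (x _ h); case: (x g h); case: (x w _).
exists (fun g => (-1) ^+ (c g) * s g); split=> [g _|g h _ _]; first exact: (pin_sign _ (sP g)).
rewrite -mulrA signrCA [s g * _]xP !sign_comb -cE.
by congr ((-1) ^+ (nat_of_bool _) * _); case: (c g); case: (c h); case: (c _).
Qed.

End Regular.

Arguments rmul {gT} g.

Section TotalPerm.
Variable I : finType.
Implicit Types (f g : I -> I).

(** The default 1 separates the definition of a permutation from the proof of its injectivity. *)
Definition totperm f : {perm I} :=
  if @idP (injectiveb f) is ReflectT inj then perm (injectiveP f inj) else 1%g.

Lemma totpermE f : injective f -> totperm f =1 f.
Proof.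
move=> inj i; rewrite /totperm; case: {-}_ / idP => [inj'|]; first by rewrite permE.
by case; apply/injectiveP.
Qed.

Lemma fiber_prod (J : eqType) (phi : I -> J) (p : J -> {perm I}) (s : seq J) i :
    (forall j k, j \in s -> phi (p j k) = phi k) ->
    (forall j k, j \in s -> phi k != j -> p j k = k) -> uniq s ->
  (\prod_(j <- s) p j)%g i = if phi i \in s then p (phi i) i else i.
Proof.
elim: s i => [|j s IHs] i phip pfix /=; first by rewrite big_nil perm1.
case/andP=> js us; rewrite big_cons permM IHs // => [|k l ks|k l ks]; last first.
- by apply: pfix; rewrite inE ks orbT.
- by apply: phip; rewrite inE ks orbT.
rewrite phip ?mem_head // inE.
have [ij|ij] := eqVneq (phi i) j; last by rewrite (pfix j i (mem_head _ _) ij).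
by rewrite ij (negPf js).
Qed.

End TotalPerm.

Section ProductLift.
Variables (F : fieldType) (I : finType).
Hypothesis F2 : (2%:R : F) != 0.
Variable r : F.
Hypothesis r2 : r ^+ 2 = 2%:R.
Local Notation A := ('M[F]_#|{set I}|).
Variables (J : eqType).
Implicit Types (U V : J -> A) (s : seq J).

Lemma pinp_prod U (p : J -> {perm I}) s : (forall j, j \in s -> pinp (U j) (p j)) ->
  pinp (\prod_(j <- s) U j) (\prod_(j <- s) p j)%g.
Proof.
elim: s => [|j s IHs] sU; first by rewrite !big_nil; exact: pinp1.
rewrite !big_cons; apply: pinpM; first by apply: sU; rewrite mem_head.
by apply: IHs => k ks; apply: sU; rewrite inE ks orbT.
Qed.

Lemma odd_perm_prod_const (p : J -> {perm I}) a s :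
  (forall j, j \in s -> odd_perm (p j) = a) ->
  odd_perm (\prod_(j <- s) p j)%g = a && odd (size s).
Proof.
elim: s => [|j s IHs] sp; first by rewrite big_nil odd_perm1 andbF.
rewrite big_cons odd_permM sp ?mem_head // IHs => [|k ks].
  by rewrite /=; case: (a); case: (odd _).
by apply: sp; rewrite inE ks orbT.
Qed.

Lemma prod_sign U (c : J -> bool) s :
  \prod_(j <- s) ((-1) ^+ (c j) * U j) =
  (-1) ^+ (\big[addb/false]_(j <- s) c j) * \prod_(j <- s) U j.
Proof.
elim: s => [|j s IHs]; first by rewrite !big_nil mul1r.
by rewrite !big_cons IHs -mulrA signrCA sign_comb.
Qed.

(** Interleaving moves [V j] past every later [U k]. Their permutations move points of different
    fibres of [phi], so each pair of indices costs one sign when both parities are odd. *)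
Lemma prod_supercomm U V (phi : I -> J) (p q : J -> {perm I}) a b s :
    uniq s ->
    (forall j k, j \in s -> phi k != j -> p j k = k) ->
    (forall j k, j \in s -> phi k != j -> q j k = k) ->
    (forall j, j \in s -> pinp (U j) (p j) /\ odd_perm (p j) = a) ->
    (forall j, j \in s -> pinp (V j) (q j) /\ odd_perm (q j) = b) ->
  (\prod_(j <- s) U j) * (\prod_(j <- s) V j) =
  (-1) ^+ [&& a, b & odd 'C(size s, 2)] * \prod_(j <- s) (U j * V j).
Proof.
elim: s => [|j s IHs] us pfix qfix.
  by move=> _ _; rewrite !big_nil !andbF !mul1r.
case/andP: (us) => js us' Up Vq; rewrite !big_cons.
have Us k : k \in s -> pinp (U k) (p k) /\ odd_perm (p k) = a.
  by move=> ks; apply: Up; rewrite inE ks orbT.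
have Vs k : k \in s -> pinp (V k) (q k) /\ odd_perm (q k) = b.
  by move=> ks; apply: Vq; rewrite inE ks orbT.
have [Vj qj] := Vq j (mem_head _ _).
have pU : pinp (\prod_(k <- s) U k) (\prod_(k <- s) p k)%g.
  by apply: pinp_prod => k /Us[].
have fixp k : phi k = j -> (\prod_(l <- s) p l)%g k = k.
  move=> kj; have {}pfix l : l \in s -> p l k = k.
    move=> ls; apply: pfix; rewrite ?inE ?ls ?orbT // kj.
    by apply: contraNneq js => ->.
  elim: (s) pfix => [|l s' IH] pfix; first by rewrite big_nil perm1.
  rewrite big_cons permM pfix ?mem_head // IH // => l' ls'.
  by apply: pfix; rewrite inE ls' orbT.
have -> : U j * \prod_(k <- s) U k * (V j * \prod_(k <- s) V k) =
    U j * ((\prod_(k <- s) U k) * V j) * \prod_(k <- s) V k by rewrite !mulrA.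
rewrite (pinp_disjoint F2 r2 pU Vj) => [|k]; last first.
  by have [/fixp ->|/(qfix _ _ (mem_head _ _)) ->] := eqVneq (phi k) j; rewrite ?eqxx.
rewrite (odd_perm_prod_const (a := a)) => [|k /Us[] //].
rewrite qj signrCA -!mulrA IHs //; last 2 first.
- by move=> k l ks; apply: pfix; rewrite inE ks orbT.
- by move=> k l ks; apply: qfix; rewrite inE ks orbT.
rewrite (signrCA _ (V j)) (signrCA _ (U j)) sign_comb [size (_ :: _)]/= bin2_parity.
by congr ((-1) ^+ (nat_of_bool _) * _); case: (a); case: (b); case: (odd _); case: (odd _).
Qed.

Lemma perm_prod_comm U s1 s2 : perm_eq s1 s2 ->
    (forall j k, j \in s1 -> k \in s1 -> U j * U k = U k * U j) ->
  \prod_(j <- s1) U j = \prod_(j <- s2) U j.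
Proof.
move=> s12 UU; pose P s := {subset s <= s1} -> \prod_(j <- s1) U j = \prod_(j <- s) U j.
have PP t1 t2 t3 : P (t1 ++ t2 ++ t3) -> P (t2 ++ t1 ++ t3).
  move=> Pt ts; rewrite Pt => [|j jt]; last first.
    by apply: ts; move: jt; rewrite !mem_cat orbCA.
  rewrite !big_cat /= !mulrA; congr (_ * _).
  have {}ts : {subset t1 ++ t2 <= s1}.
    by move=> j jt; apply: ts; move: jt; rewrite !mem_cat => /orP[] ->; rewrite ?orbT.
  elim: t1 ts {Pt} => [|j t1 IH] ts; first by rewrite big_nil mulr1 mul1r.
  rewrite !big_cons -mulrA IH => [|k kt]; last by apply: ts; rewrite inE kt orbT.
  rewrite !mulrA; congr (_ * _).
  have {}ts k : k \in t2 -> U j * U k = U k * U j.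
    by move=> kt; apply: UU; apply: ts; rewrite ?inE ?eqxx // mem_cat kt !orbT.
  elim: t2 ts {IH} => [|k t2 IH] ts; first by rewrite big_nil mulr1 mul1r.
  rewrite big_cons mulrA ts ?mem_head // -mulrA IH ?mulrA // => l lt.
  by apply: ts; rewrite inE lt orbT.
have := catCA_perm_ind PP s12 (fun=> erefl _).
by apply => j; rewrite (perm_mem s12).
Qed.

End ProductLift.

(** * From the regular representation of a subgroup to that of the group *)

Section InducedLift.
Variables (F : fieldType) (gT : finGroupType) (H : {group gT}).
Hypothesis F2 : (2%:R : F) != 0.
Variable r : F.
Hypothesis r2 : r ^+ 2 = 2%:R.
Local Notation A := ('M[F]_#|{set gT}|).
Implicit Types (g h k v w i : gT).
Local Notation cval := (cval H).
Local Notation crep := (crep H).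
Local Notation transv := (transv H).

Lemma decompP i : exists2 v, v \in H & exists2 w, w \in transv & i = (v * w)%g.
Proof.
by exists (cval i); rewrite ?cval_in //; exists (crep i); rewrite ?crep_transv ?cvalK.
Qed.

(* In the notation i = v * w with v in H and w in the transversal:
   block w k maps v * w to v * k * w and fixes the other cosets;
   bswap w exchanges v * w with v; shift v g maps v * w to v * crep (w * g) and
   fixes v' * w for v' != v; vswap v exchanges v * w with w. *)
Definition block w k : {perm gT} :=
  totperm (fun i => if crep i == w then cval i * k * w else i)%g.
Definition bswap w : {perm gT} :=
  totperm (fun i => if crep i == w then cval i else
                    if crep i == 1%g then (cval i * w)%g else i).
Definition shift v g : {perm gT} :=
  totperm (fun i => if cval i == v then v * crep (i * g) else i)%g.
Definition vswap v : {perm gT} :=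
  totperm (fun i => if cval i == v then crep i else
                    if cval i == 1%g then (v * crep i)%g else i).

Lemma transv1 : 1%g \in transv.
Proof. by rewrite inE crep_id. Qed.

Definition cE := (cvalMtransv, crepMtransv).

Lemma vw_inj v w v' w' : v \in H -> v' \in H -> w \in transv -> w' \in transv ->
  (v * w = v' * w')%g -> v = v' /\ w = w'.
Proof.
move=> vH v'H wW w'W E; split.
  by have := congr1 cval E; rewrite !cE.
by have := congr1 crep E; rewrite !cE.
Qed.

Lemma coord_inj (f : gT -> gT) (f1 f2 : gT -> gT -> gT) :
    (forall v w, v \in H -> w \in transv -> f (v * w)%g = (f1 v w * f2 v w)%g) ->
    (forall v w, v \in H -> w \in transv -> f1 v w \in H) ->
    (forall v w, v \in H -> w \in transv -> f2 v w \in transv) ->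
    (forall v w v' w', v \in H -> v' \in H -> w \in transv -> w' \in transv ->
       f1 v w = f1 v' w' -> f2 v w = f2 v' w' -> v = v' /\ w = w') ->
  injective f.
Proof.
move=> fE f1H f2W f12 i j.
have [v vH [w wW ->]] := decompP i; have [v' v'H [w' w'W ->]] := decompP j.
rewrite !fE // => /vw_inj[|||//|e1 e2]; rewrite ?f1H ?f2W //.
by have [-> ->] := f12 _ _ _ _ vH v'H wW w'W e1 e2.
Qed.

Lemma blockE w k : k \in H -> w \in transv ->
  forall v w', v \in H -> w' \in transv ->
  block w k (v * w')%g = (if w' == w then v * k * w else v * w')%g.
Proof.
move=> kH wW v w' vH w'W; rewrite totpermE ?cE //.
apply: (@coord_inj _ (fun v w' => if w' == w then v * k else v)%g (fun _ w' => w')) => //.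
- by move=> {vH w'W}v {}w' vH w'W; rewrite !cE //; case: eqP => // ->.
- by move=> {vH w'W}v {}w' vH w'W; case: eqP => //; rewrite groupM.
- by move=> v1 w1 v2 w2 _ _ _ _ E ww; move: E; rewrite ww; case: eqP => // _ /mulIg ->.
Qed.

Lemma bswapE w : w \in transv ->
  forall v w', v \in H -> w' \in transv ->
  bswap w (v * w')%g = (v * (if w' == w then 1 else if w' == 1 then w else w'))%g.
Proof.
move=> wW v w' vH w'W; rewrite totpermE ?cE //; first by case: (w' == w); case: (w' == 1%g); rewrite ?mulg1.
apply: (@coord_inj _ (fun v _ => v) (fun _ w' => if w' == w then 1 else if w' == 1 then w else w')%g) => //.
- by move=> {vH w'W}v {}w' vH w'W; rewrite !cE //; case: (w' == w); case: (w' == 1%g); rewrite ?mulg1.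
- by move=> {vH w'W}v {}w' vH w'W; case: (w' == w); case: (w' == 1%g); rewrite ?transv1.
- move=> v1 w1 v2 w2 _ _ _ _ ->.
  have [->|w1w] := eqVneq w1 w; have [->|w2w] := eqVneq w2 w => //.
  + by have [->|w20] := eqVneq w2 1%g => E; split=> //; move: w20; rewrite ?E -?E ?eqxx.
  + by have [->|w10] := eqVneq w1 1%g => E; split=> //; move: w10; rewrite ?E -?E ?eqxx.
  + have [->|w10] := eqVneq w1 1%g; have [->|w20] := eqVneq w2 1%g => // E; split=> //.
      by rewrite -E eqxx in w2w.
    by rewrite E eqxx in w1w.
Qed.

Lemma shiftE v g : v \in H ->
  forall v' w, v' \in H -> w \in transv ->
  shift v g (v' * w)%g = (v' * (if v' == v then crep (w * g) else w))%g.
Proof.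
move=> vH v' w v'H wW; rewrite totpermE ?(cvalMtransv v'H wW).
  by case: eqP => // ->; rewrite -mulgA (crepM _ vH).
apply: (@coord_inj _ (fun v' _ => v') (fun v' w => if v' == v then crep (w * g) else w)%g) => //.
- move=> {v'H wW}v' {}w v'H wW; rewrite (cvalMtransv v'H wW); case: eqP => // ->.
  by rewrite -mulgA (crepM _ vH).
- by move=> {v'H wW}v' {}w v'H wW; case: eqP => // _; rewrite crep_transv.
- move=> v1 w1 v2 w2 _ _ w1W w2W ->; case: eqP => // _ E; split=> //.
  by rewrite -(crepMK g w1W) E crepMK.
Qed.

Lemma vswapE v : v \in H ->
  forall v' w, v' \in H -> w \in transv ->
  vswap v (v' * w)%g = ((if v' == v then 1 else if v' == 1 then v else v') * w)%g.
Proof.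
move=> vH v' w v'H wW; rewrite totpermE ?cE //; first by case: (v' == v); case: (v' == 1%g); rewrite ?mul1g.
apply: (@coord_inj _ (fun v' _ => if v' == v then 1 else if v' == 1 then v else v')%g (fun _ w => w)) => //.
- by move=> {v'H wW}v' {}w v'H wW; rewrite !cE //; case: (v' == v); case: (v' == 1%g); rewrite ?mul1g.
- by move=> {v'H wW}v' {}w v'H wW; case: (v' == v); case: (v' == 1%g).
- move=> v1 w1 v2 w2 _ _ _ _ E ww; move: E; rewrite {}ww.
  have [->|v1v] := eqVneq v1 v; have [->|v2v] := eqVneq v2 v => //.
  + by have [->|v20] := eqVneq v2 1%g => E; split=> //; move: v20; rewrite ?E -?E ?eqxx.
  + by have [->|v10] := eqVneq v1 1%g => E; split=> //; move: v10; rewrite ?E -?E ?eqxx.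
  + have [->|v10] := eqVneq v1 1%g; have [->|v20] := eqVneq v2 1%g => // E; split=> //.
      by rewrite -E eqxx in v2v.
    by rewrite E eqxx in v1v.
Qed.

Lemma permH (p q : {perm gT}) :
  (forall v w, v \in H -> w \in transv -> p (v * w)%g = q (v * w)%g) -> p = q.
Proof.
by move=> pq; apply/permP => i; have [v vH [w wW ->]] := decompP i; exact: pq.
Qed.

(** All shifts by [g] are conjugate to [shift 1 g], so their lifts can be chosen conjugate, with a
    common sign cocycle. [block_conj] serves the same purpose for the blocks. *)
Lemma shift_conj v g : v \in H ->
  (shift 1 g * vswap v = vswap v * shift v g)%g.
Proof.
move=> vH; apply: permH => v' w v'H wW; rewrite !permM.
have [cH dH] : crep (w * g) \in transv /\ (1%g \in H) by rewrite crep_transv group1.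
rewrite (shiftE g (group1 H) v'H wW) (vswapE vH v'H wW).
have w1W : (if v' == 1%g then crep (w * g) else w) \in transv by case: (v' == 1%g).
have v1H : (if v' == v then 1 else if v' == 1 then v else v')%g \in H.
  by case: (v' == v); case: (v' == 1%g).
rewrite (vswapE vH v'H w1W) (shiftE g vH v1H wW).
congr (_ * _)%g.
suff -> : ((if v' == v then 1 else if v' == 1 then v else v')%g == v) = (v' == 1%g) by [].
have [->|v'v] := eqVneq v' v; first by rewrite eq_sym.
have [_|v'1] := eqVneq v' 1%g; first by rewrite eqxx.
by rewrite (negPf v'v).
Qed.

Lemma block_conj w k : w \in transv -> k \in H ->
  (block 1 k * bswap w = bswap w * block w k)%g.
Proof.
move=> wW kH; apply: permH => v w' vH w'W; rewrite !permM.
have W1 := transv1.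
rewrite blockE // bswapE // blockE //; last by case: (w' == w); case: (w' == 1%g).
have -> : (if w' == 1 then v * k * 1 else v * w')%g =
    ((if w' == 1 then v * k else v) * w')%g by case: eqP => // ->.
rewrite bswapE //; last by case: eqP => // _; rewrite groupM.
have [->|w'w] := eqVneq w' w.
  by rewrite [1%g == w]eq_sym; case: eqP => // ->; rewrite !mulg1.
by have [_|_] := eqVneq w' 1%g; rewrite ?eqxx // (negPf w'w).
Qed.

Lemma shiftM g h : (shift 1 g * shift 1 h = shift 1 (g * h))%g.
Proof.
apply: permH => v w vH wW; rewrite permM !shiftE //; last by case: ifP; rewrite ?crep_transv.
by case: eqP => // _; rewrite crepMr mulgA.
Qed.

Lemma blockM w k l : w \in transv -> k \in H -> l \in H ->
  (block w k * block w l = block w (k * l))%g.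
Proof.
move=> wW kH lH; apply: permH => v w' vH w'W; rewrite permM.
rewrite (blockE kH wW vH w'W) (blockE (groupM kH lH) wW vH w'W).
case: eqP => [_|/eqP/negPf w'w]; last by rewrite blockE // w'w.
by rewrite (blockE lH wW (groupM vH kH) wW) eqxx !mulgA.
Qed.

Lemma shift_prodE g v w : v \in H -> w \in transv ->
  (\prod_(u <- enum H) shift u g)%g (v * w)%g = (v * crep (w * g))%g.
Proof.
move=> vH wW; rewrite (fiber_prod (phi := cval)) ?enum_uniq //.
- by rewrite cvalMtransv // mem_enum vH shiftE // eqxx.
- move=> u i; rewrite mem_enum; have [v' v'H [w' w'W ->]] := decompP i.
  by move=> uH; rewrite shiftE // !cvalMtransv //; case: (v' == u); rewrite ?crep_transv.
- move=> u i; rewrite mem_enum; have [v' v'H [w' w'W ->]] := decompP i.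
  by move=> uH; rewrite shiftE // cvalMtransv // => /negPf ->.
Qed.

Lemma block_prodE (c : gT -> gT) v w : (forall w', c w' \in H) ->
    v \in H -> w \in transv ->
  (\prod_(u <- enum transv) block u (c u))%g (v * w)%g = (v * c w * w)%g.
Proof.
move=> cH vH wW; rewrite (fiber_prod (phi := crep)) ?enum_uniq //.
- by rewrite crepMtransv // mem_enum wW blockE // eqxx.
- move=> u i; rewrite mem_enum; have [v' v'H [w' w'W ->]] := decompP i.
  move=> uW; rewrite blockE // [in RHS]crepMtransv //; case: eqP => [->|_]; rewrite crepMtransv //.
  by rewrite groupM.
- move=> u i; rewrite mem_enum; have [v' v'H [w' w'W ->]] := decompP i.
  by move=> uW; rewrite blockE // crepMtransv // => /negPf ->.
Qed.

(** The monomial form of an induced representation: [v * w * g] is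
    [v * cval (w * g) * crep (w * g)], a multiplication inside each block followed by a permutation
    of the blocks. *)
Lemma rmul_decomp g :
  rmul g = (\prod_(u <- enum transv) block u (cval (u * g)) *
            \prod_(u <- enum H) shift u g)%g.
Proof.
apply: permH => v w vH wW; rewrite rmulE permM block_prodE // => [|w']; last exact: cval_in.
rewrite (shift_prodE g (groupM vH (cval_in H (w * g)%g)) wW).
by rewrite -mulgA -mulgA cvalK.
Qed.

Lemma conj_lift U V (p q q' : {perm gT}) : (q * p = p * q')%g ->
  pinp U p -> pinp V q -> pinp (U^T * V * U : A) q'.
Proof.
move=> E pU qV; have -> : q' = (p^-1 * q * p)%g by rewrite -mulgA E mulKg.
by apply: pinpM => //; apply: pinpM => //; exact: pinpV.
Qed.

Lemma conj_mult (U V W : A) p : pinp U p ->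
  (U^T * V * U) * (U^T * W * U) = U^T * (V * W) * U.
Proof. by move=> pU; rewrite -!mulrA (mulrA U) (pin_unit pU) mul1r. Qed.

Section Induce.
Hypothesis H4 : (4 %| #|H|)%N.
Hypothesis even_block : forall k, k \in H -> odd_perm (block 1 k) = false.
Variables (Y : gT -> A) (y : gT -> gT -> bool).
Hypothesis Yblock : forall k, k \in H -> pinp (Y k) (block 1 k).
Hypothesis Yy : forall k l, k \in H -> l \in H ->
  Y k * Y l = (-1) ^+ (y k l) * Y (k * l)%g.

(** The shifts give |H| copies of the action on cosets. Interleaving costs C(|H|,2) signs and the
    sign cocycle of one copy occurs |H| times; both numbers are even because 4 divides |H|. *)
Lemma shift_lift : exists T : gT -> A,
  (forall g, pinp (T g) (\prod_(u <- enum H) shift u g)%g) /\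
  (forall g h, T (g * h)%g = T g * T h).
Proof.
have /choice[K pK] : forall v, exists U : A, pinp U (vswap v).
  by move=> v; exact: perm_lift r2 _.
have /choice[U1 pU1] : forall g, exists U : A, pinp U (shift 1 g).
  by move=> g; exact: perm_lift r2 _.
pose U v g := (K v)^T * U1 g * K v.
have pU v g : v \in H -> pinp (U v g) (shift v g).
  by move=> vH; apply: (conj_lift (shift_conj g vH)).
have pU_odd v g : v \in H -> odd_perm (shift v g) = odd_perm (shift 1 g).
  move=> vH; have := congr1 (@odd_perm _) (shift_conj g vH).
  by rewrite !odd_permM; case: (odd_perm (vswap v)); case: odd_perm; case: odd_perm.
exists (fun g => \prod_(v <- enum H) U v g); split=> [g|g h].
  by apply: pinp_prod => v; rewrite mem_enum => vH; exact: pU.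
have even2 : odd 'C(size (enum H), 2) = false.
  rewrite -cardE; case/dvdnP: H4 => m ->; rewrite bin2.
  have -> : (m * 4 * (m * 4).-1)%N = (m * 2 * (m * 4).-1).*2.
    by rewrite -muln2 [RHS]mulnAC -[(m * 2 * 2)%N]mulnA.
  by rewrite doubleK !oddM andbF.
rewrite (prod_supercomm F2 r2 (phi := cval) (p := fun v => shift v g)
  (q := fun v => shift v h) (a := odd_perm (shift 1 g)) (b := odd_perm (shift 1 h))).
- rewrite even2 !andbF mul1r.
  have [b bE] : exists b : bool, U1 g * U1 h = (-1) ^+ b * U1 (g * h)%g.
    by apply: (pinp_unique F2 (pU1 (g * h)%g)); rewrite -shiftM; exact: pinpM.
  rewrite [RHS](eq_bigr (fun v => (-1) ^+ b * U v (g * h)%g)) => [|v _].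
    rewrite (@prod_sign _ _ _ (fun v => U v (g * h)%g) (fun=> b)).
    rewrite big_const_seq count_predT -cardE; case/dvdnP: H4 => m ->.
    rewrite [X in _ ^+ nat_of_bool X](_ : _ = false) ?mul1r //.
    by elim: m => // m IHm; rewrite mulSn /= IHm; case: (b).
  by rewrite /U (conj_mult _ _ (pK v)) bE signrCA -!mulrA.
- exact: enum_uniq.
- move=> v i; rewrite mem_enum; have [v' v'H [w' w'W ->]] := decompP i.
  by move=> uH; rewrite shiftE // cvalMtransv // => /negPf ->.
- move=> v i; rewrite mem_enum; have [v' v'H [w' w'W ->]] := decompP i.
  by move=> uH; rewrite shiftE // cvalMtransv // => /negPf ->.
- by move=> v; rewrite mem_enum => vH; split; [exact: pU|exact: pU_odd].
- by move=> v; rewrite mem_enum => vH; split; [exact: pU|exact: pU_odd].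
Qed.

(* Up to coboundaries, the sign cocycle of the regular representation of the whole
   group is the transfer of the sign cocycle y of the regular representation of H. *)
Lemma induced_lift : exists s : gT -> A, (forall g, pinp (s g) (rmul g)) /\
  forall g h, s g * s h =
    (-1) ^+ (\big[addb/false]_(w in transv) y (cval (w * g)%g) (cval (crep (w * g) * h)%g))
    * s (g * h)%g.
Proof.
have [T [pT TM]] := shift_lift.
have /choice[M pM] : forall w, exists U : A, pinp U (bswap w).
  by move=> w; exact: perm_lift r2 _.
pose Z w k := (M w)^T * Y k * M w.
have pZ w k : w \in transv -> k \in H -> pinp (Z w k) (block w k).
  by move=> wW kH; apply: (conj_lift (block_conj wW kH)) => //; exact: Yblock.
have Z_even w k : w \in transv -> k \in H -> odd_perm (block w k) = false.
  move=> wW kH; have := congr1 (@odd_perm _) (block_conj wW kH).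
  by rewrite !odd_permM even_block //; case: odd_perm; case: odd_perm.
have ZM w k l : k \in H -> l \in H -> Z w k * Z w l = (-1) ^+ (y k l) * Z w (k * l)%g.
  by move=> kH lH; rewrite /Z (conj_mult _ _ (pM w)) Yy // signrCA -!mulrA.
pose B (c : gT -> gT) := \prod_(w <- enum transv) Z w (c w).
have pB c : (forall w, c w \in H) -> pinp (B c) (\prod_(w <- enum transv) block w (c w))%g.
  by move=> cH; apply: pinp_prod => w; rewrite mem_enum => wW; exact: pZ.
have block_fix c (cH : forall w, c w \in H) j i :
    j \in enum transv -> crep i != j -> block j (c j) i = i.
  rewrite mem_enum; have [v' v'H [w' w'W ->]] := decompP i => jW.
  by rewrite blockE // crepMtransv // => /negPf ->.
(* The blocks are even, so interleaving is free and only the cocycle [y] of each block remains. *)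
have BM c d : (forall w, c w \in H) -> (forall w, d w \in H) ->
    B c * B d = (-1) ^+ (\big[addb/false]_(w in transv) y (c w) (d w)) * B (fun w => c w * d w)%g.
  move=> cH dH; rewrite /B (prod_supercomm F2 r2 (phi := crep)
    (p := fun w => block w (c w)) (q := fun w => block w (d w)) (a := false) (b := false)).
  - rewrite mul1r (eq_bigr (fun w => (-1) ^+ (y (c w) (d w)) * Z w (c w * d w)%g)) => [|w _].
      by rewrite prod_sign big_enum.
    exact: ZM.
  - exact: enum_uniq.
  - by move=> j k; exact: block_fix.
  - by move=> j k; exact: block_fix.
  - by move=> w; rewrite mem_enum => wW; split; [exact: pZ|exact: Z_even].
  - by move=> w; rewrite mem_enum => wW; split; [exact: pZ|exact: Z_even].
have TZ g w k : w \in transv -> k \in H -> T g * Z (crep (w * g)) k = Z w k * T g.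
  move=> wW kH; set w' := crep (w * g); have w'W : w' \in transv by exact: crep_transv.
  (* The permutation under [X] carries the block of 1 to that of [w], then to that of [w'], then
     back: it fixes the block of 1 pointwise. Since [Y k] is even, the two commute without sign. *)
  pose X := M w * T g * (M w')^T.
  have pX : pinp X (bswap w * \prod_(u <- enum H) shift u g * (bswap w')^-1)%g.
    by apply: pinpM; [exact: pinpM|exact: pinpV].
  have XY : Y k * X = X * Y k.
    rewrite (pinp_disjoint F2 r2 (Yblock kH) pX) ?even_block ?mul1r // => i.
    have [v vH [u uW ->]] := decompP i; have W1 := transv1.
    rewrite blockE //; case: (eqVneq u 1%g) => [->|]; rewrite ?eqxx // => _.
    rewrite !permM bswapE // eqxx.
    have -> : (if 1 == w then 1 else w)%g = w by case: eqP.
    rewrite shift_prodE // -/w'; apply: (canLR (permK _)).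
    by rewrite bswapE // eqxx; case: eqP => // <-.
  have -> : T g * Z w' k = (M w)^T * (X * Y k) * M w'.
    by rewrite /X /Z -!mulrA (pin_trA _ (pM w)).
  by rewrite -XY /X /Z -!mulrA (pin_trK (pM w')) mulr1.
clearbody Z.
have TB g c : (forall w, c w \in H) -> T g * B c = B (fun w => c (crep (w * g)%g)) * T g.
  move=> cH; have -> : B c = \prod_(w <- enum transv) Z (crep (w * g)) (c (crep (w * g))%g).
    rewrite -(big_map (fun w => crep (w * g)%g) xpredT (fun w => Z w (c w))).
    apply: perm_prod_comm => [|j k].
      apply: uniq_perm; rewrite ?enum_uniq //.
        rewrite map_inj_in_uniq ?enum_uniq // => u v; rewrite !mem_enum => uW vW E.
        by rewrite -(crepMK g uW) E crepMK.
      move=> w; rewrite mem_enum; apply/idP/mapP => [wW|[u _ ->]]; last exact: crep_transv.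
      by exists (crep (w * g^-1)); rewrite ?mem_enum ?crep_transv ?crepMKV.
    rewrite !mem_enum => jW kW; have [->//|jk] := eqVneq j k.
    rewrite (pinp_disjoint F2 r2 (pZ _ _ jW (cH j)) (pZ _ _ kW (cH k))) ?Z_even ?mul1r // => i.
    have [v vH [u uW ->]] := decompP i; rewrite blockE //.
    case: (eqVneq u j) => [->|]; rewrite ?eqxx // => _.
    by rewrite blockE // (negPf jk).
  rewrite /B; have : {subset enum transv <= transv} by move=> w; rewrite mem_enum.
  elim: (enum _) => [|w s IHs] sW; first by rewrite !big_nil mulr1 mul1r.
  rewrite !big_cons mulrA TZ ?sW ?mem_head // -!mulrA; congr (_ * _).
  by apply: IHs => u us; apply: sW; rewrite inE us orbT.
pose c g w := cval (w * g)%g.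
have cH g w : c g w \in H by exact: cval_in.
exists (fun g => B (c g) * T g); split=> [g|g h].
  by rewrite rmul_decomp; apply: pinpM => //; exact: pB.
have -> : B (c g) * T g * (B (c h) * T h) = B (c g) * (T g * B (c h)) * T h.
  by rewrite !mulrA.
rewrite TB // mulrA BM // -!mulrA -TM; congr (_ * (_ * _)).
apply: eq_bigr => w _; congr (Z _ _).
rewrite /c (mulgA w g h).
by rewrite -[X in _ = cval (X * h)](cvalK H (w * g)%g) -(mulgA _ _ h) [RHS]cvalM ?cval_in.
Qed.

End Induce.

End InducedLift.

(** * Involutions and cyclic subgroups in the regular representation *)

Section RegularLifts.
Variables (F : fieldType) (gT : finGroupType).
Hypothesis F2 : (2%:R : F) != 0.
Variable r : F.
Hypothesis r2 : r ^+ 2 = 2%:R.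
Hypothesis n_mod8 : #|gT| = 0 %[mod 8] \/ #|gT| = 2 %[mod 8].
Local Notation A := ('M[F]_#|{set gT}|).
Implicit Types (g h k : gT) (U V : A).

Lemma bin2_even m : (m %% 4 <= 1)%N -> odd 'C(m, 2) = false.
Proof.
rewrite {2}(divn_eq m 4); case: (m %% 4)%N => [|[|//]] _; rewrite bin2 ?addn0 ?addn1 /=.
  have -> : (m %/ 4 * 4 * (m %/ 4 * 4).-1)%N = (m %/ 4 * 2 * (m %/ 4 * 4).-1).*2.
    by rewrite -muln2 [RHS]mulnAC -[(m %/ 4 * 2 * 2)%N]mulnA.
  by rewrite doubleK !oddM andbF.
have -> : ((m %/ 4 * 4).+1 * (m %/ 4 * 4))%N = ((m %/ 4 * 4).+1 * (m %/ 4 * 2)).*2.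
  by rewrite -muln2 -mulnA -[(m %/ 4 * 2 * 2)%N]mulnA.
by rewrite doubleK !oddM !andbF.
Qed.

(** Translation by [g] has no fixed point, so [pinp_involution] applies with n/2 transpositions. *)
Lemma regular_involution g U : g != 1%g -> (g * g = 1)%g -> pinp U (rmul g) ->
  U * U = 1.
Proof.
move=> g1 gg pU.
have gE : #|gT| = (#|gT|./2).*2.
  rewrite -[LHS]odd_double_half; suff -> : odd #|gT| = false by [].
  by rewrite -(odd_mod #|gT| (_ : odd 8 = false)) //; case: n_mod8 => ->.
have [||_ ->] := pinp_involution F2 r2 (m := #|gT|./2) _ _ pU.
- by rewrite -rmul_mul gg; apply/permP => h; rewrite rmulE mulg1 perm1.
- by rewrite -gE -cardsT; apply: eq_card => h; rewrite !inE rmul_fix g1.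
rewrite bin2_even // -(leq_double _ 1).
have : ((#|gT|./2).*2 %% 8 = (#|gT|./2 %% 4).*2)%N.
  by rewrite -!muln2 -[8%N]/(4 * 2)%N muln_modl.
by rewrite -gE => <-; case: n_mod8 => ->.
Qed.

Lemma sign_even (R : pzRingType) (b : bool) m : ~~ odd m -> ((-1 : R) ^+ b) ^+ m = 1.
Proof. by move=> modd; rewrite -exprM -signr_odd oddM (negPf modd) andbF. Qed.

Lemma supercomm_exp (R : pzRingType) (x y : R) (p : bool) m :
  y * x = (-1) ^+ p * (x * y) ->
  (x * y) ^+ m = (-1) ^+ (p && odd 'C(m, 2)) * (x ^+ m * y ^+ m).
Proof.
move=> xy; have yx l : y ^+ l * x = (-1) ^+ (p && odd l) * (x * y ^+ l).
  elim: l => [|l IH]; first by rewrite andbF !mul1r mulr1.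
  rewrite exprS -mulrA IH signrCA [y * (x * _)]mulrA xy -!mulrA sign_comb.
  by congr (_ ^+ (nat_of_bool _) * _); rewrite /=; case: (p); case: (odd l).
elim: m => [|m IH]; first by rewrite andbF !mulr1.
rewrite exprSr IH -!mulrA [y ^+ m * (x * y)]mulrA yx -!mulrA signrCA sign_comb.
rewrite bin2_parity [x ^+ m.+1]exprSr [y ^+ m.+1]exprSr -!mulrA.
by congr (_ ^+ (nat_of_bool _) * _); case: (p).
Qed.

(** On each coset of [<[g]>], translation by [g ^+ 2] consists of two cycles. Choosing one of them
    in every coset splits it as [d * d'], with disjoint factors conjugate under [g]. Hence [U * U]
    is a sign times [D * D'], and every sign in its [m]-th power cancels, where [m] is half the
    order of [g] and 4 divides [m]. *)
Lemma regular_order8 g U : (8 %| #[g]%g)%N -> pinp U (rmul g) -> U ^+ #[g]%g = 1.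
Proof.
move=> g8 pU; have [M oM] : exists M, #[g]%g = (4 * M).*2.
  by have /dvdnP[M ->] := g8; exists M; rewrite -muln2 mulnC mulnAC.
set m := (4 * M)%N in oM.
(* Inversion turns the cosets stable under right translation by [g] into right cosets of [P], on
   which [cval] is defined; [X i] is then the parity of the position of [i] in its coset. *)
pose P := <[g]>%G; pose X i := cval P i^-1%g \in <[(g ^+ 2)%g]>%g.
have gP : g \in P by exact: cycle_id.
have Xg2 i : X (i * g ^+ 2)%g = X i.
  by rewrite /X invMg cvalM ?groupV ?groupX // groupMl // groupV cycle_id.
have Xg i : X (i * g^-1)%g = ~~ X i.
  rewrite /X invMg invgK cvalM //; have /cycleP[k ->] := cval_in P i^-1%g.
  rewrite -expgS.
  have E l : ((g ^+ l)%g \in <[(g ^+ 2)%g]>%g) = ~~ odd l.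
    apply/idP/idP => [/cycleP[q]|].
      rewrite -expgM => /eqP; rewrite eq_expg_mod_order oM => /eqP /(congr1 odd).
      by rewrite !odd_mod ?odd_double // mul2n odd_double => ->.
    move=> lodd; rewrite -[l]odd_double_half (negPf lodd) add0n -mul2n expgM.
    exact: mem_cycle.
  by rewrite !E /= negbK.
pose d := totperm (fun i => if X i then (i * g ^+ 2)%g else i).
have dE i : d i = if X i then (i * g ^+ 2)%g else i.
  rewrite /d totpermE // => j k.
  case: (boolP (X j)) => Xj; case: (boolP (X k)) => Xk //; first exact: mulIg.
    by move=> jk; rewrite -jk Xg2 Xj in Xk.
  by move=> jk; rewrite jk Xg2 Xk in Xj.
pose d' := ((rmul g)^-1 * d * rmul g)%g.
have d'E i : d' i = if X i then i else (i * g ^+ 2)%g.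
  have gi : ((rmul g)^-1)%g i = (i * g^-1)%g.
    by apply: (canLR (permK _)); rewrite rmulE mulgKV.
  rewrite /d' !permM gi dE Xg rmulE; case: (X i) => /=; first by rewrite mulgKV.
  by rewrite expgS expg1 !mulgA mulgKV.
have [D pD] : exists D : A, pinp D d by exact: perm_lift r2 _.
pose D' := U^T * D * U.
have pD' : pinp D' d' by apply: pinpM => //; apply: pinpM => //; exact: pinpV.
have dd' : (d * d')%g = (rmul g * rmul g)%g.
  apply/permP => i; rewrite permM [in RHS]permM !rmulE d'E dE -mulgA.
  by case: (boolP (X i)) => Xi; rewrite ?Xg2 ?Xi ?(negPf Xi).
have [b UU] : exists b : bool, U * U = (-1) ^+ b * (D * D').
  by apply: (@pinp_unique _ _ F2 _ _ (d * d')%g); [exact: pinpM|rewrite dd'; exact: pinpM].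
have D'D : D' * D = (-1) ^+ (odd_perm d' && odd_perm d) * (D * D').
  by apply: (pinp_disjoint F2 r2 pD' pD) => i; rewrite d'E dE; case: (X i); rewrite ?eqxx.
have dm : (d ^+ m)%g = 1%g.
  have dk q i : (d ^+ q)%g i = if X i then (i * g ^+ (2 * q))%g else i.
    elim: q => [|q IH]; first by rewrite perm1 muln0 mulg1 if_same.
    rewrite expgSr permM IH dE; case: (boolP (X i)) => Xi; last by rewrite (negPf Xi).
    have -> : X (i * g ^+ (2 * q))%g.
      by elim: (q) => [|l IHl]; rewrite ?muln0 ?mulg1 // mulnS addnC expgD mulgA Xg2.
    by rewrite -mulgA -expgD mulnS addnC.
  by apply/permP => i; rewrite dk mul2n -oM expg_order mulg1 perm1 if_same.
have [c Dm] : exists c : bool, D ^+ m = (-1) ^+ c.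
  have pDm := pinp_exp m pD; rewrite dm in pDm.
  by have [c ->] := pinp_unique F2 (pinp1 F gT) pDm; exists c; rewrite mulr1.
(* [D'] is conjugate to [D], and the central sign [D ^+ m] is unchanged by conjugation. *)
have D'm : D' ^+ m = (-1) ^+ c.
  have -> : D' ^+ m = U^T * D ^+ m * U.
    elim: (m) => [|l IH]; first by rewrite !expr0 mulr1 (pin_trK pU).
    by rewrite exprSr IH /D' exprSr -!mulrA (mulrA U) (pin_unit pU) mul1r.
  by rewrite Dm -mulrA signrCA (pin_trK pU) mulr1.
have mC : odd 'C(m, 2) = false by rewrite bin2_even // /m mulnC modnMl.
rewrite oM -mul2n exprM expr2 UU exprMn_comm; last exact/commr_sym/commr_sign.
rewrite (supercomm_exp _ D'D) mC andbF mul1r Dm D'm -signr_addb addbb mulr1.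
by rewrite sign_even // oddM.
Qed.

Lemma cyclic_lift (P : {group gT}) : cyclic P ->
    #|P| = 2 \/ (8 %| #|P|)%N -> exists tau : gT -> A, mult_lift P rmul tau.
Proof.
case/cyclicP=> g PE oP; have [U pU] : exists U : A, pinp U (rmul g) by exact: perm_lift r2 _.
have gP : g \in P by rewrite PE cycle_id.
have oPE : #|P| = #[g]%g by rewrite PE.
have UN : U ^+ #[g]%g = 1.
  case: oP; rewrite oPE => og; last exact: regular_order8.
  rewrite og expr2; apply: regular_involution pU; last by have := expg_order g; rewrite og.
  by rewrite -order_gt1 og.
apply: (two_gen_lift (a := g) (b := 1%g) (U := U) (V := 1) (e := 1)) => //.
- by move=> h k _ _; exact: rmul_mul.
- by move=> h; rewrite PE => /cycleP[m ->]; exists m, 0%N; rewrite mulg1.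
- have -> : rmul (1 : gT) = 1%g by apply/permP => h; rewrite rmulE mulg1 perm1.
  exact: pinp1.
- by rewrite mul1g mulg1.
- by rewrite mul1r mulr1 expr1.
- move=> m k; rewrite expg1n mulg1 expr1n mulr1 => /eqP; rewrite -order_dvdn => /dvdnP[q ->].
  by rewrite mulnC exprM UN expr1n.
Qed.

End RegularLifts.

(** * Klein and quaternion subgroups of 2-groups *)

Section TwoGroups.
Variable gT : finGroupType.
Local Open Scope group_scope.
Implicit Types (P : {group gT}) (a b g h k : gT).

Definition klein_pair a b : Prop :=
  [/\ a != 1, b != 1, a != b, a * a = 1 & b * b = 1 /\ a * b = b * a].

Definition quaternion_pair a b : Prop :=
  [/\ a ^+ 4 = 1, a ^+ 2 != 1, b ^+ 2 = a ^+ 2 & b * a = a ^+ 3 * b].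

(** A non-trivial 2-group whose first Omega subgroup has order 2 is cyclic or generalized quaternion
    ([prime_Ohm1P]). Otherwise there is an involution besides a central one, and the two commute. *)
Lemma two_group_cases P : 2.-group P ->
  [\/ cyclic P, exists a b, klein_pair a b | exists a b, quaternion_pair a b].
Proof.
move=> pP; have [->|P1] := eqVneq P 1%G; first by constructor 1; exact: cyclic1.
have [/orP[cP|/eqP/quaternion_classP[n n2 isoQ]]|notC] :=
  boolP (cyclic P || (extremal_class P == Quaternion)); first by constructor 1.
  have [[x y] [_ _ ox _] [oy yx xy]] := generators_quaternion n2 isoQ.
  (* [x] has order [2 ^ (n - 1)], so this power has order 4 and, with [y], generates a quaternion
     group of order 8. *)
  constructor 3; exists (x ^+ (2 ^ (n - 3))), y.
  have yE : x ^+ (2 ^ (n - 3)) ^+ 2 = y ^+ 2.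
    rewrite yx -expgM -expnSr -subSn // ; congr (x ^+ (2 ^ _)).
    by case: (n) n2 => [|[|[|n']]] //= _; rewrite !subSS subn0.
  have y4 : y ^+ 4 = 1 by rewrite -oy expg_order.
  split; rewrite ?yE //.
  - by rewrite -[4%N]/(2 * 2)%N expgM yE -expgM.
  - by rewrite -order_dvdn oy.
  - set a := x ^+ _; have ay : a ^ y = a^-1 by rewrite conjXg xy expgVn.
    have a4 : a * a ^+ 3 = 1 by rewrite -expgS -[4%N]/(2 * 2)%N expgM yE -expgM.
    have -> : a ^+ 3 = a^-1 by apply/(mulgI a); rewrite a4 mulgV.
    have aVy : a^-1 ^ y = a by rewrite conjVg ay invgK.
    by rewrite -[a in LHS]aVy conjgE mulKVg.
have dvdZ : (2 %| #|'Z(P)|)%N.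
  have Z1 : 'Z(P) != 1 by rewrite (center_nil_eq1 (pgroup_nil pP)).
  by have [] := pgroup_pdiv (pgroupS (center_sub P) pP) Z1.
have [//|z zZ oz] := Cauchy _ dvdZ.
have zP : z \in P by apply: (fintype.subsetP (center_sub P)).
have z1 : z != 1 by rewrite -order_gt1 oz.
have zz : z * z = 1 by have := expg_order z; rewrite oz.
constructor 2; exists z; have [/exists_inP[t tP /and3P[/eqP tt t1 tz]]|] :=
  boolP [exists t in P, [&& t * t == 1, t != 1 & t != z]].
  exists t; split=> //; [by rewrite eq_sym|split=> //].
  by have /centP := fintype.subsetP (subsetIr P 'C(P)) _ zZ; apply.
rewrite negb_exists_in => /forall_inP noinv; case/negP: notC.
apply/(prime_Ohm1P pP P1); rewrite -[2%N]oz; congr #|pred_of_set _|.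
rewrite (OhmE 1 pP) expn1; apply/eqP; rewrite finset.eqEsubset cycle_subG mem_gen ?andbT.
  rewrite gen_subG; apply/fintype.subsetP => t; rewrite !inE expgS expg1 => /andP[tP tt].
  have := noinv t tP; rewrite tt /= negb_and !negbK => /orP[] /eqP ->; rewrite ?group1 //.
  exact: cycle_id.
by rewrite !inE zP expgS expg1 zz /=.
Qed.

End TwoGroups.

Section BlockLifts.
Variables (F : fieldType) (gT : finGroupType).
Hypothesis F2 : (2%:R : F) != 0.
Variable r : F.
Hypothesis r2 : r ^+ 2 = 2%:R.
Local Notation A := ('M[F]_#|{set gT}|).
Implicit Types (a b g h k : gT) (H : {group gT}) (U V : A).

Lemma block1E H k i : k \in H ->
  block H 1 k i = if i \in H then (i * k)%g else i.
Proof.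
move=> kH; have W1 := transv1 H; have [v vH [w wW ->]] := decompP H i.
rewrite blockE // groupMl //; have [->|w1] := eqVneq w 1%g; first by rewrite group1 !mulg1.
by case: ifP => // wH; rewrite -(transvP wW) crep_id ?eqxx in w1.
Qed.

Lemma block11 H : block H 1 1 = 1%g.
Proof. by apply/permP => i; rewrite block1E ?group1 // mulg1 if_same perm1. Qed.

Lemma block1M H : {in H &, {morph block H 1 : h k / (h * k)%g}}.
Proof. by move=> h k hH kH; rewrite blockM ?transv1. Qed.

Lemma klein_group a b : klein_pair a b -> exists H : {group gT},
  [/\ #|H| = 4, a \in H, b \in H,
      forall h, h \in H -> exists m n, h = (a ^+ m * b ^+ n)%g
    & forall h, h \in H -> (h * h = 1)%g].
Proof.
case=> a1 b1 ab aa [bb abC]; exists (<[a]> <*> <[b]>)%G.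
have cab : (<[b]> \subset 'C(<[a]>))%g.
  by rewrite cent_cycle cycle_subG; apply/cent1P.
have HE : (<[a]> <*> <[b]> = <[a]> * <[b]>)%g by exact: cent_joinEr.
have oa : #[a]%g = 2 by apply: nt_prime_order; rewrite // expgS expg1.
have ob : #[b]%g = 2 by apply: nt_prime_order; rewrite // expgS expg1.
have Hab h : h \in (<[a]> <*> <[b]>)%G -> exists m n, h = (a ^+ m * b ^+ n)%g.
  by rewrite /= HE => /mulsgP[x y /cycleP[m ->] /cycleP[n ->] ->]; exists m, n.
split=> //=.
- rewrite HE TI_cardMg -?orderE ?oa ?ob // prime_TIg -?orderE ?oa //.
  rewrite cycle_subG; apply/negP => /cycleP[m]; rewrite -expg_mod_order ob.
  have : (m %% 2 < 2)%N by rewrite ltn_mod.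
  case: (m %% 2)%N => [|[|//]] _; rewrite ?expg0 ?expg1 => E.
    by rewrite E eqxx in a1.
  by rewrite E eqxx in ab.
- by rewrite mem_gen // inE cycle_id.
- by rewrite mem_gen // inE cycle_id orbT.
- move=> h /Hab[m [n ->]].
  have c : commute (a ^+ m)%g (b ^+ n)%g by apply/commuteX2.
  have -> : ((a ^+ m * b ^+ n) * (a ^+ m * b ^+ n) = (a ^+ m * b ^+ n) ^+ 2)%g by [].
  by rewrite (expgMn _ c) -!expgM !(mulnC _ 2) !expgM (aa : a ^+ 2 = 1)%g (bb : b ^+ 2 = 1)%g !expg1n mulg1.
Qed.

(** A non-trivial [k] acts on the four elements of [H] by two transpositions. *)
Lemma klein_even H : #|H| = 4 -> (forall h, h \in H -> (h * h = 1)%g) ->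
  forall k, k \in H -> odd_perm (block H 1 k) = false.
Proof.
move=> oH HH k kH; have [->|k1] := eqVneq k 1%g; first by rewrite block11 odd_perm1.
have [U pU] : exists U : A, pinp U (block H 1 k) by exact: perm_lift r2 _.
have [||-> //] := pinp_involution F2 r2 (m := 2) _ _ pU.
- by rewrite -block1M // HH // block11.
- rewrite -[RHS]oH; apply: eq_card => i; rewrite !inE block1E //.
  case: (i \in H); rewrite ?eqxx //.
  by rewrite -{2}[i]mulg1 (inj_eq (mulgI i)) k1.
Qed.

(** The lifts of [a], [b] and [a * b] all have square 1 by [regular_involution], and this forces the
    lifts of [a] and [b] to commute. *)
Lemma klein_lift a b H : klein_pair a b ->
    #|gT| = 0 %[mod 8] \/ #|gT| = 2 %[mod 8] -> a \in H -> b \in H ->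
    (forall h, h \in H -> exists m n, h = (a ^+ m * b ^+ n)%g) ->
  exists tau : gT -> A, mult_lift H rmul tau.
Proof.
case=> a1 b1 ab aa [bb abC] n8 aH bH Hab.
have [U pU] : exists U : A, pinp U (rmul a) by exact: perm_lift r2 _.
have [V pV] : exists V : A, pinp V (rmul b) by exact: perm_lift r2 _.
have ab1 : (a * b)%g != 1%g.
  by apply: contraNneq ab => ab1; apply/eqP; apply: (mulgI a); rewrite aa ab1.
have UU := regular_involution F2 r2 n8 a1 aa pU.
have VV := regular_involution F2 r2 n8 b1 bb pV.
have UV1 : (U * V) * (U * V) = 1.
  apply: (regular_involution F2 r2 n8 ab1); last by rewrite rmul_mul; exact: pinpM.
  by rewrite {2}abC mulgA -(mulgA a) bb mulg1.
have VU : V * U = U * V.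
  have <- : U * ((U * V) * (U * V)) * V = V * U.
    by rewrite !mulrA UU mul1r -mulrA VV mulr1.
  by rewrite UV1 mulr1.
apply: (two_gen_lift (a := a) (b := b) (U := U) (V := V) (e := 1)) => //.
- by move=> h k _ _; exact: rmul_mul.
have pow2 (x : gT) (X : A) m : (x * x = 1)%g -> X * X = 1 ->
    (x ^+ m = if odd m then x else 1)%g /\ X ^+ m = if odd m then X else 1.
  move=> xx XX; rewrite -[m in (x ^+ m)%g]odd_double_half -[m in X ^+ m]odd_double_half.
  rewrite -mul2n expgD exprD expgM exprM (xx : x ^+ 2 = 1)%g expr2 XX expg1n expr1n.
  by rewrite mulg1 mulr1; case: odd.
move=> m n; have [-> ->] := pow2 a U m aa UU; have [-> ->] := pow2 b V n bb VV.
case: (odd m); case: (odd n); rewrite ?mulg1 ?mul1g ?mulr1 // => E.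
- by rewrite E eqxx in ab1.
- by rewrite E eqxx in a1.
- by rewrite E eqxx in b1.
Qed.

End BlockLifts.

(** * The quaternion group of order 8 *)

Section QuaternionLift.
Variables (F : fieldType) (gT : finGroupType).
Hypothesis F2 : (2%:R : F) != 0.
Variable r : F.
Hypothesis r2 : r ^+ 2 = 2%:R.
Local Notation A := ('M[F]_#|{set gT}|).
Variables a b : gT.
Hypothesis qab : quaternion_pair a b.

Let T := (bool * bool * bool)%type.
Implicit Types (s t : T).

Let q s : gT := (a ^+ (s.1.1.*2 + s.1.2) * b ^+ s.2)%g.

(* Right multiplication by a and by b, and the automorphism a -> b -> a * b -> a,
   in the coordinates q. *)
Let ra s : T := (s.1.1 (+) s.1.2 (+) s.2, ~~ s.1.2, s.2).
Let rb s : T := (s.1.1 (+) s.2, s.1.2, ~~ s.2).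
Let rot s : T := (s.1.1, s.2, s.1.2 (+) s.2).

Let a4 : (a ^+ 4 = 1)%g. Proof. by case: qab. Qed.
Let b2 : (b ^+ 2 = a ^+ 2)%g. Proof. by case: qab. Qed.
Let ba : (b * a = a ^+ 3 * b)%g. Proof. by case: qab. Qed.

Let amod m : (a ^+ m = a ^+ (m %% 4))%g.
Proof. by rewrite expg_mod // a4. Qed.

Lemma qMa s : (q s * a = q (ra s))%g.
Proof.
case: s => [[x y] t]; rewrite /q /=.
have -> : (a ^+ (x.*2 + y) * b ^+ t * a = a ^+ (x.*2 + y + (if t then 3%N else 1%N)) * b ^+ t)%g.
  case: t; rewrite /= ?expg1 ?expg0 ?mulg1; first by rewrite -mulgA ba mulgA -expgD.
  by rewrite -expgSr addn1.
by congr (_ * _)%g; rewrite [LHS]amod [RHS]amod; case: x; case: y; case: t.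
Qed.

Lemma qMb s : (q s * b = q (rb s))%g.
Proof.
case: s => [[x y] t]; rewrite /q /=; case: t => /=; rewrite ?addbT ?addbF; last first.
  by rewrite expg0 mulg1 expg1.
rewrite -mulgA expg1 expg0 mulg1 (b2 : (b * b = _)%g) -expgD.
by rewrite [LHS]amod [RHS]amod; case: x; case: y.
Qed.

Lemma q_inj : injective q.
Proof.
have a2 : (a ^+ 2)%g != 1%g by case: qab.
have bNa m : (b <> a ^+ m)%g.
  move=> bE; have ab : (b * a = a * b)%g by rewrite bE -expgSr -expgS.
  case/eqP: a2; apply: (mulgI a); rewrite mulg1 -expgS; apply: (mulIg b).
  by rewrite -ba ab.
have o4 : #[a]%g = 4.
  have : (#[a]%g %| 4)%N by rewrite order_dvdn a4.
  rewrite -[4%N]/(2 ^ 2)%N => /(dvdn_pfactor _ _ (isT : prime 2))[[|[|[|//]]] // _ oa];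
    by case/negP: a2; rewrite -order_dvdn oa.
move=> [[x y] t] [[x' y'] t']; rewrite /q /= => E.
have tt' : t = t'.
  apply: contrapT => tt'.
  have [m [n]] : exists m n, (a ^+ m * b = a ^+ n)%g.
    case: t t' tt' E => [] [] //= _ E;
      [exists (x.*2 + y)%N, (x'.*2 + y')%N
      |exists (x'.*2 + y')%N, (x.*2 + y)%N];
    by move: E; rewrite ?expg1 ?expg0 ?mulg1.
  move=> E'; apply: (bNa (3 * m + n)%N); rewrite expgD -E' mulgA -expgD -mulSnr.
  by rewrite expgM a4 expg1n mul1g.
move: E; rewrite tt' => /mulIg/eqP; rewrite eq_expg_mod_order o4.
by case: x; case: y; case: x'; case: y'.
Qed.

Let qset : {set gT} := [set x in codom q].

Lemma qsetP x : Bool.reflect (exists s, x = q s) (x \in qset).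
Proof. by rewrite inE; apply: (iffP codomP) => -[s ->]; exists s. Qed.

Lemma qset_mul s m n : exists t, (q s * (a ^+ m * b ^+ n) = q t)%g.
Proof.
have [t ->] : exists t, (q s * (a ^+ m * b ^+ n) = q t * b ^+ n)%g.
  elim: m s => [|m IH] s; first by exists s; rewrite mul1g.
  by have [t E] := IH (ra s); exists t; rewrite -E expgS -qMa !mulgA.
elim: n t => [|n IH] t; first by exists t; rewrite mulg1.
by have [u E] := IH (rb t); exists u; rewrite -E expgS -qMb !mulgA.
Qed.

Lemma qset_group : group_set qset.
Proof.
apply/group_setP; split; first by apply/qsetP; exists (false, false, false); rewrite /q mulg1.
move=> _ _ /qsetP[s ->] /qsetP[t ->]; apply/qsetP.
by have [u] := qset_mul s (t.1.1.*2 + t.1.2) t.2; exists u.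
Qed.

Let H : {group gT} := Group qset_group.

Lemma card_quaternion_set : #|H| = 8.
Proof.
rewrite /H /= /qset cardsE card_codom; last exact: q_inj.
by rewrite !card_prod card_bool.
Qed.

Let aH : a \in H.
Proof. by apply/qsetP; exists (false, true, false); rewrite /q mulg1. Qed.

Let bH : b \in H.
Proof. by apply/qsetP; exists (false, false, true); rewrite /q mul1g. Qed.

Lemma quaternion_genP h : h \in H -> exists m n, h = (a ^+ m * b ^+ n)%g.
Proof. by case/qsetP=> s ->; exists (s.1.1.*2 + s.1.2)%N, (s.2 : nat). Qed.

(** The automorphism [rot] of [H], extended by the identity to a permutation of the whole group. *)
Let theta : {perm gT} :=
  totperm (fun i => if [pick s | q s == i] is Some s then q (rot s) else i).

Let rot_inj : injective rot.
Proof. by move=> [[[] []] []] [[[] []] []]. Qed.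

Let theta_fun i :
  (forall s, i = q s ->
    (if [pick s | q s == i] is Some s then q (rot s) else i) = q (rot s)) /\
  (i \notin H -> (if [pick s | q s == i] is Some s then q (rot s) else i) = i).
Proof.
case: pickP => [s /eqP sE|iq]; split=> //.
- by move=> t iE; rewrite (q_inj (etrans sE iE)).
- by case/negP; apply/qsetP; exists s.
- by move=> s iE; have := iq s; rewrite iE eqxx.
Qed.

Let theta_inj :
  injective (fun i => if [pick s | q s == i] is Some s then q (rot s) else i).
Proof.
move=> i j; case: (boolP (i \in H)) => [/qsetP[s iE]|iH]; case: (boolP (j \in H)) => [/qsetP[t jE]|jH].
- by rewrite ((theta_fun i).1 s iE) ((theta_fun j).1 t jE) iE jE => /q_inj/rot_inj ->.
- rewrite ((theta_fun i).1 s iE) ((theta_fun j).2 jH) => E.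
  by case/negP: jH; apply/qsetP; exists (rot s).
- rewrite ((theta_fun i).2 iH) ((theta_fun j).1 t jE) => E.
  by case/negP: iH; apply/qsetP; exists (rot t).
- by rewrite ((theta_fun i).2 iH) ((theta_fun j).2 jH).
Qed.

Lemma thetaE s : theta (q s) = q (rot s).
Proof. by rewrite /theta totpermE; [exact: (theta_fun _).1|exact: theta_inj]. Qed.

Lemma theta_fix i : i \notin H -> theta i = i.
Proof. by move=> iH; rewrite /theta totpermE; [exact: (theta_fun _).2|exact: theta_inj]. Qed.

Let blk := block H 1%g.

Lemma theta_conj k l : k \in H -> l \in H ->
    (forall s, theta (q s * k)%g = (theta (q s) * l)%g) ->
  (blk k * theta = theta * blk l)%g.
Proof.
move=> kH lH kl; apply/permP => i; rewrite !permM /blk !block1E //.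
case: (boolP (i \in H)) => iH; last by rewrite theta_fix // (negPf iH).
have /qsetP[s iE] := iH; rewrite iE kl thetaE.
by case: ifP => // /negP[]; apply/qsetP; exists (rot s).
Qed.

Lemma theta_a : (blk a * theta = theta * blk b)%g.
Proof.
apply: theta_conj => // -[[x y] t]; rewrite qMa !thetaE qMb; congr (q (_, _, _)) => /=.
- by case: x; case: y; case: t.
- by case: y; case: t.
Qed.

Lemma theta_b : (blk b * theta = theta * blk (a * b)%g)%g.
Proof.
apply: theta_conj => [//||[[x y] t]]; first exact: groupM.
rewrite qMb !thetaE mulgA qMa qMb; congr (q (_, _, _)) => /=.
- by case: x; case: y; case: t.
- by case: y; case: t.
Qed.

Lemma theta3 : (theta ^+ 3)%g = 1%g.
Proof.
apply/permP => i; rewrite !expgS expg0 mulg1 !permM perm1.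
case: (boolP (i \in H)) => [/qsetP[s ->]|iH]; last by rewrite !theta_fix.
by rewrite !thetaE; congr q; case: s => [[x y] t]; rewrite /rot /=; case: y; case: t.
Qed.

Let blkM : {in H &, {morph blk : h k / (h * k)%g}}.
Proof. exact: block1M. Qed.

(** Conjugation by [theta] gives [a], [b] and [a * b] equal parities, and the third is the sum of
    the first two. *)
Lemma quaternion_even k : k \in H -> odd_perm (blk k) = false.
Proof.
have odd_ab : odd_perm (blk a) = odd_perm (blk b).
  have := congr1 (@odd_perm _) theta_a; rewrite !odd_permM.
  by case: (odd_perm theta); case: (odd_perm _); case: (odd_perm _).
have odd_b : odd_perm (blk b) = false.
  have := congr1 (@odd_perm _) theta_b; rewrite blkM // !odd_permM odd_ab.
  by case: (odd_perm theta); case: (odd_perm _).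
move=> kH; have [m [n ->]] := quaternion_genP kH; rewrite blkM ?groupX // odd_permM.
have oddX h l : h \in H -> odd_perm (blk h) = false -> odd_perm (blk (h ^+ l)%g) = false.
  move=> hH h0; elim: l => [|l IH]; first by rewrite /blk block11 odd_perm1.
  by rewrite expgS blkM ?groupX // odd_permM h0 IH.
by rewrite !oddX // odd_ab.
Qed.

(** Conjugation by the lift [R] of [theta] permutes [U], [V], [W] cyclically, because [R ^+ 3] is a
    central sign. So [U * V], [V * W] and [W * U] equal [W], [U] and [V] up to one common sign [e],
    which cancels in [V * U * V = U] and [U * V * U = V]. These two identities imply the quaternion
    relations. *)
Lemma quaternion_block_lift : exists Y : gT -> A, mult_lift H blk Y.
Proof.
have [U pU] : exists U : A, pinp U (blk a) by exact: perm_lift r2 _.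
have [R pR] : exists R : A, pinp R theta by exact: perm_lift r2 _.
pose V := R^T * U * R; pose W := R^T * V * R.
have pV : pinp V (blk b) by exact: conj_lift theta_a pR pU.
have pW : pinp W (blk (a * b)%g) by exact: conj_lift theta_b pR pV.
have WR : R^T * W * R = U.
  have pR3 := pinp_exp 3 pR; rewrite theta3 in pR3.
  have [c Rc] := pinp_unique F2 (pinp1 F gT) pR3; rewrite mulr1 in Rc.
  have RR := pin_trK pR; have RR' := pin_unit pR.
  have UR : U * R ^+ 3 = R ^+ 3 * U by rewrite Rc; exact: commr_sign.
  rewrite /W /V -!mulrA; have -> : U * (R * (R * R)) = R * (R * (R * U)).
    by move: UR; rewrite !exprS expr0 mulr1 -!mulrA.
  by rewrite !(pin_trA _ pR).
have [e UV] : exists e : bool, U * V = (-1) ^+ e * W.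
  by apply: (pinp_unique F2 pW); rewrite blkM //; exact: pinpM.
have conjM X Z : R^T * (X * Z) * R = (R^T * X * R) * (R^T * Z * R).
  by rewrite (conj_mult _ _ pR).
have conjS (c : bool) X : R^T * ((-1) ^+ c * X) * R = (-1) ^+ c * (R^T * X * R).
  by rewrite signrCA -!mulrA.
have VW : V * W = (-1) ^+ e * U.
  by have := congr1 (fun X => R^T * X * R) UV; rewrite conjM conjS -/V -/W WR.
have WU : W * U = (-1) ^+ e * V.
  by have := congr1 (fun X => R^T * X * R) VW; rewrite conjM conjS -/V -/W WR.
clearbody W V.
have WE : W = (-1) ^+ e * (U * V) by rewrite UV signrMK.
have VUV : V * U * V = U.
  by move: VW; rewrite WE signrCA => /(inv_inj (signrMK _)); rewrite mulrA.
have UVU : U * V * U = V.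
  by have E := WU; rewrite WE -mulrA in E; exact: (inv_inj (signrMK _) E).
have UU := pin_trK pU; have UU' := pin_unit pU; have VV := pin_trK pV.
have VU : V * U = U^T * V by rewrite -{2}UVU -!mulrA (pin_trA _ pU).
have V2 : V * V = U * U.
  have E : U^T * (V * V) = U by rewrite mulrA -VU.
  by rewrite -[LHS]mul1r -UU' -mulrA E.
have U2 : U * U = U^T * U^T.
  have E : U * U * V = U^T * U^T * V by rewrite -V2 -mulrA V2 mulrA VU -mulrA VU mulrA.
  by have := congr1 (fun X => X * V^T) E; rewrite /= -!mulrA (pin_unit pV) !mulr1.
have U4 : U ^+ 4 = 1.
  by rewrite -[4%N]/(2 * 2)%N exprM !expr2 {2}U2 -mulrA (mulrA U U^T) UU' mul1r.
have UT : U^T = U ^+ 3.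
  by rewrite -[LHS]mulr1 -U4 [in LHS]exprS mulrA UU mul1r.
apply: (two_gen_lift (a := a) (b := b) (U := U) (V := V) (e := 3)) => //.
- exact: quaternion_genP.
- by rewrite VU UT.
have X4 (x : gT) (X : A) m : (x ^+ 4 = 1)%g -> X ^+ 4 = 1 ->
    (x ^+ m = x ^+ (m %% 4))%g /\ X ^+ m = X ^+ (m %% 4).
  move=> x4 X41; split; first by rewrite expg_mod // x4.
  by rewrite {1}(divn_eq m 4) exprD mulnC exprM X41 expr1n mul1r.
move=> m n E.
(* Squares of [b] are absorbed into powers of [a], and likewise for [V] and [U]; [q_inj] then reads
   off the exponents of a trivial normal form. *)
have nE : n = (n./2.*2 + odd n)%N by rewrite addnC odd_double_half.
have bn : (b ^+ n = a ^+ n./2.*2 * b ^+ odd n)%g.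
  by rewrite {1}nE expgD -!mul2n !expgM b2.
have Vn : V ^+ n = U ^+ n./2.*2 * V ^+ odd n.
  by rewrite {1}nE exprD -!mul2n !exprM !expr2 V2.
have [mn nodd] : (4 %| m + n./2.*2)%N /\ odd n = false.
  move: E; rewrite bn mulgA -expgD; set l := (m + _)%N => E.
  have : q (odd (l %% 4)./2, odd (l %% 4), odd n) = q (false, false, false).
    rewrite /q /= !mulg1 -[RHS]E [in RHS]amod; congr (_ ^+ _ * _)%g.
    by have := ltn_pmod l (isT : (0 < 4)%N); case: (l %% 4)%N => [|[|[|[|//]]]].
  move=> /q_inj [l2 l1 ->]; split=> //; rewrite /dvdn.
  by move: l2 l1; have := ltn_pmod l (isT : (0 < 4)%N); case: (l %% 4)%N => [|[|[|[|//]]]].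
rewrite Vn nodd mulr1 -exprD; have /dvdnP[l ->] := mn.
by rewrite mulnC exprM U4 expr1n.
Qed.

End QuaternionLift.

Lemma quaternion_case (F : fieldType) (gT : finGroupType) (r : F) (a b : gT) :
    (2%:R : F) != 0 -> r ^+ 2 = 2%:R -> quaternion_pair a b ->
  exists H : {group gT}, [/\ #|H| = 8,
    forall k, k \in H -> odd_perm (block H 1 k) = false &
    exists Y : gT -> 'M[F]_#|{set gT}|, mult_lift H (block H 1) Y].
Proof.
move=> F2 r2 qab; exists (Group (qset_group qab)); split.
- exact: card_quaternion_set.
- exact: quaternion_even.
- exact: (quaternion_block_lift F2 r2 qab).
Qed.

(** * Cocycles and the transfer *)

Section CohomologyClasses.
Variable G : topGroupType.
Local Open Scope quotient_scope.

Definition coh_class m (z : cocycle G m) : cohomology G m := \pi_(cohomology G m) z.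

Lemma coh_classB m (y z : cocycle G m) : coh_class (y - z) = coh_class y - coh_class z.
Proof. by rewrite /coh_class; exact: (raddfB \pi_({ideal_quot (coboundaries G m)})). Qed.

Lemma coh_class_sum m (J : finType) (P : pred J) (z : J -> cocycle G m) :
  \sum_(j | P j) coh_class (z j) = coh_class (\sum_(j | P j) z j).
Proof. by rewrite /coh_class; exact/esym/(raddf_sum \pi_({ideal_quot (coboundaries G m)})). Qed.

Lemma coh_class_eq m (y z : cocycle G m) :
  coh_class y = coh_class z <-> coboundary (cocycle_val y - cocycle_val z).
Proof.
have E : (y - z \in coboundaries G m) = (y == z %[mod {ideal_quot (coboundaries G m)}]).
  exact: Quotient.idealrBE.
split=> [/eqP yz|yz].
  have : y - z \in coboundaries G m by rewrite E.
  by move/asboolP; rewrite [cocycle_val _](raddfB \val).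
apply/eqP; rewrite -[_ == _]E; apply/asboolP.
by rewrite [cocycle_val _](raddfB \val).
Qed.

Lemma coh_class_eq0 m (z : cocycle G m) :
  coh_class z = 0 <-> coboundary (cocycle_val z).
Proof.
have -> : (0 : cohomology G m) = coh_class 0.
  by rewrite -[X in coh_class X](subrr z) coh_classB subrr.
by rewrite coh_class_eq [X in _ - X](raddf0 \val) subr0.
Qed.

Lemma coh_reprK m (x : cohomology G m) : coh_class (repr x) = x.
Proof. exact: reprK. Qed.

(* A one-dimensional coboundary vanishes because the action is trivial. *)
Lemma coh_repr_low m (z : cocycle G m) : (m <= 1)%N -> repr (coh_class z) = z.
Proof.
move=> m1; have /coh_class_eq := coh_reprK (coh_class z).
move: (repr _) => y yz; apply: val_inj; apply/eqP; rewrite -subr_eq0; apply/eqP.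
case: m m1 z y yz => [|[|//]] _ z y //= [c _ ->].
apply/funext => x; rewrite /cobound !big_ord_recl big_ord0 addr0.
have E (f f' : 'I_0 -> G) : f = f' by apply: funext => -[].
by rewrite [X in c X + _](E _ (fun=> 1%g)) [X in _ + c X](E _ (fun=> 1%g)) addff2.
Qed.

(** [cup] multiplies the cocycles picked by [repr]; in degrees at most 1 these are the given ones,
    by [coh_repr_low]. *)
Lemma cup_class1 m (y : cocycle G 1) (z : cocycle G m) (m1 : (m <= 1)%N) :
  cup (coh_class y) (coh_class z) =
  coh_class (Cocycle (cup_cocycle (cocycleP y) (cocycleP z))).
Proof.
rewrite /cup -[LHS]/(coh_class _); congr coh_class; apply: val_inj => /=.
by rewrite !coh_repr_low.
Qed.

End CohomologyClasses.

Section Points.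
Variable G : groupType.

Definition pt m (s : seq G) : 'I_m -> G := fun i => nth 1%g s i.

End Points.

(** Reduces an identity between cochains to its values on explicit lists of entries. *)
Lemma pt_eta (G : groupType) m (x : 'I_m.+1 -> G) :
  x = pt (mkseq (fun k => x (inord k)) m.+1).
Proof. by apply/funext => i; rewrite /pt nth_mkseq // inord_val. Qed.

Section LowDegree.
Variable G : topGroupType.
Implicit Types g h k l : G.

Lemma cobound1E (f : ('I_1 -> G) -> 'F_2) g h :
  cobound f (pt [:: g; h]) = f (pt [:: h]) + f (pt [:: (g * h)%g]) + f (pt [:: g]).
Proof.
rewrite /cobound !big_ord_recl big_ord0 addr0 addrA.
by congr (f _ + f _ + f _); apply/funext => -[[|//] ?].
Qed.

Lemma cobound2E (f : ('I_2 -> G) -> 'F_2) g h k :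
  cobound f (pt [:: g; h; k]) =
  f (pt [:: h; k]) + f (pt [:: (g * h)%g; k]) + f (pt [:: g; (h * k)%g]) + f (pt [:: g; h]).
Proof.
rewrite /cobound !big_ord_recl big_ord0 addr0 !addrA.
by congr (f _ + f _ + f _ + f _); apply/funext => -[[|[|//]] ?].
Qed.

Lemma cobound3E (f : ('I_3 -> G) -> 'F_2) g h k l :
  cobound f (pt [:: g; h; k; l]) =
  f (pt [:: h; k; l]) + f (pt [:: (g * h)%g; k; l]) + f (pt [:: g; (h * k)%g; l])
  + f (pt [:: g; h; (k * l)%g]) + f (pt [:: g; h; k]).
Proof.
rewrite /cobound !big_ord_recl big_ord0 addr0 !addrA.
by congr (f _ + f _ + f _ + f _ + f _); apply/funext => -[[|[|[|//]]] ?].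
Qed.

Lemma cup_cochain22 (f g : ('I_2 -> G) -> 'F_2) (x y z t : G) :
  cup_cochain f g (pt [:: x; y; z; t]) = f (pt [:: x; y]) * g (pt [:: z; t]).
Proof. by congr (f _ * g _); apply/funext => -[[|[|//]] ?]. Qed.

End LowDegree.

(** A finite product of discrete spaces is discrete. *)
Lemma discrete_locally_constant (gT : groupType) m
    (f : ('I_m -> discrete_topology gT) -> 'F_2) : locally_constant f.
Proof.
move=> x; have Fx := nbhs_filter (x : {ptws 'I_m -> discrete_topology gT}).
have : nbhs (x : {ptws 'I_m -> discrete_topology gT})
    (fun y : {ptws 'I_m -> discrete_topology gT} => forall i, y i = x i).
  apply: (@filter_forall _ _ (fun i (y : {ptws 'I_m -> discrete_topology gT}) => y i = x i)
    (nbhs (x : {ptws 'I_m -> discrete_topology gT})) _) => i.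
  exact: (@proj_continuous 'I_m (fun=> discrete_topology gT) i x _ (discrete_set1 _)).
by apply: filterS => y yx; congr f; apply/funext.
Qed.

Section TransferNilpotent.
Variables (gT : finGroupType) (H : {group gT}).
Local Notation G := (discrete_topology gT).
Implicit Types g h k l w u : gT.

Lemma addF2_eq (a b : 'F_2) : a + b = 0 -> a = b.
Proof. by move/eqP; rewrite addr_eq0 oppF2 => /eqP. Qed.

(* x = tr Y + dt, where Y is a cocycle of H, and x = dz over H.  Then
   x * x = tr (Y * x) + d (...) = d (tr (Y * z) + ...). *)
Lemma transfer_nilpotent (x z : gT -> gT -> 'F_2) (t : gT -> 'F_2)
    (Y : gT -> gT -> gT -> 'F_2) :
    two_reduced gT ->
    (forall v g k, v \in H -> z (v * g)%g k = z g k) ->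
    (forall g k l, x k l = z g k + z (g * k)%g l + z g (k * l)%g) ->
    (forall v g h k, v \in H -> Y (v * g)%g h k = Y g h k) ->
    (forall w g h k, Y w g h = Y (w * g)%g h k + Y w (g * h)%g k + Y w g (h * k)%g) ->
    (forall g h, x g h = \sum_(w in transv H) Y w g h + (t g + t h + t (g * h)%g)) ->
  exists c : gT -> 'F_2, forall g h, x g h = c g + c h + c (g * h)%g.
Proof.
move=> G_red zH xz YH YC xY.
have xC g h k : x h k + x (g * h)%g k + x g (h * k)%g + x g h = 0.
  rewrite (xz g h k) (xz 1%g (g * h)%g k) (xz 1%g g (h * k)%g) (xz 1%g g h).
  rewrite !mul1g mulgA.
  (* [ring] ignores the characteristic, so the terms that cancel in ['F_2] are first paired by
     hand. *)
  rewrite (_ : _ + _ = (z g h + z g h) + (z (g * h)%g k + z (g * h)%g k)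
    + (z g (h * k)%g + z g (h * k)%g) + (z 1%g (g * h)%g + z 1%g (g * h)%g)
    + (z 1%g (g * h * k)%g + z 1%g (g * h * k)%g) + (z 1%g g + z 1%g g)); last by ring.
  by rewrite !addff2 ?addr0.
pose X (p : 'I_2 -> G) : 'F_2 := x (p ord0) (p (lift ord0 ord0)).
have Xpt (g h : G) : X (pt [:: g; h]) = x g h by [].
have Xcocycle : X \in cocycles G 2.
  apply/cocyclesP; split; first exact: discrete_locally_constant.
  by apply/funext => p; rewrite (pt_eta p) /= cobound2E !Xpt xC.
pose xi := coh_class (Cocycle Xcocycle).
suff xi0 : xi = 0.
  have [c _ XE] : coboundary X by apply/(coh_class_eq0 (Cocycle Xcocycle)).
  exists (fun g => c (pt [:: (g : G)])) => g h.
  by rewrite -(Xpt g h) XE cobound1E [c _ + _ + _]addrAC [c _ + c _]addrC.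
apply: G_red; exists 2%N.
(* [cup_exp xi 2] unfolds to [cup xi (cup xi 1)]. The cocycles that [repr] picks for its two factors
   differ from [x] by the coboundaries of [a1] and [a2]. *)
pose c1 := repr xi; pose eta := cup xi (cohomology1 G); pose c2 := repr eta.
have [a1 a1E] : exists a1 : gT -> 'F_2, forall g h : G,
    c1 (pt [:: g; h]) = x g h + (a1 g + a1 h + a1 (g * h)%g).
  have /coh_class_eq[c _ cE] := coh_reprK xi.
  exists (fun g => c (pt [:: (g : G)])) => g h.
  have := congr1 (fun f => f (pt [:: (g : G); (h : G)])) cE.
  rewrite /= !fctE cobound1E Xpt => /eqP; rewrite subr_eq => /eqP ->.
  by rewrite addrC; congr (_ + _); rewrite addrAC [X in X + _]addrC.
have one : repr (cohomology1 G) = Cocycle (@cst1_cocycle G) by exact: coh_repr_low.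
have [a2 a2E] : exists a2 : gT -> 'F_2, forall g h : G,
    c2 (pt [:: g; h]) = x g h + (a2 g + a2 h + a2 (g * h)%g).
  have /coh_class_eq := coh_reprK eta.
  rewrite -/c2 /= one => -[c _ cE].
  exists (fun g => a1 g + c (pt [:: (g : G)])) => g h.
  have := congr1 (fun f => f (pt [:: (g : G); (h : G)])) cE.
  rewrite /= !fctE /cup_cochain /= mulr1 => /eqP; rewrite subr_eq => /eqP ->.
  have -> : pt [:: g; h] \o @lshift 2 0 = pt [:: g; h] by apply/funext => -[[|[|//]] ?].
  rewrite a1E (cobound1E c g h) addrCA; congr (_ + _).
  by rewrite [_ + a1 _]addrC [_ + (_ + _)]addrC; ring.
have c2C h k l : c2 (pt [:: (k : G); (l : G)]) = c2 (pt [:: (h : G); (k : G)]) +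
    c2 (pt [:: (h * k)%g : G; (l : G)]) + c2 (pt [:: (h : G); (k * l)%g : G]).
  have /cocyclesP[_ /(congr1 (fun f => f (pt [:: (h : G); (k : G); (l : G)])))] := cocycleP c2.
  rewrite (cobound2E c2) => /addF2_eq E.
  apply: addF2_eq; rewrite -E.
  rewrite (_ : _ + _ = (c2 (pt [:: (k : G); (l : G)]) + c2 (pt [:: (k : G); (l : G)]))
    + (c2 (pt [:: (h * k)%g : G; (l : G)]) + c2 (pt [:: (h * k)%g : G; (l : G)]))
    + (c2 (pt [:: (h : G); (k * l)%g : G]) + c2 (pt [:: (h : G); (k * l)%g : G]))); last by ring.
  by rewrite !addff2 ?addr0.
(* The corrections are absorbed: [c1] is the transfer of [Y] plus the coboundary of [t'], and [c2]
   is the coboundary of [z'] over [H]. *)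
pose t' g := t g + a1 g.
pose z' g k := z g k + a2 k.
have z'E g k l : z' (g * k)%g l = c2 (pt [:: (k : G); (l : G)]) + z' g k + z' g (k * l)%g.
  rewrite a2E (xz g) /z'.
  rewrite [RHS](_ : _ = z (g * k)%g l + a2 l + (z g k + z g k) + (z g (k * l)%g + z g (k * l)%g)
    + (a2 k + a2 k) + (a2 (k * l)%g + a2 (k * l)%g)); last by ring.
  by rewrite !addff2 !addr0.
(* A primitive of the cup product of [c1] and [c2]: the transfer of the product of [Y] and [z'],
   plus the product of [t'] and [c2]. The coset [w] has moved to [w * (g * h)] when [z'] is
   evaluated. *)
pose C (p : 'I_3 -> G) : 'F_2 :=
  \sum_(w in transv H) Y w (p (inord 0)) (p (inord 1)) *
     z' (w * (p (inord 0) * p (inord 1)))%g (p (inord 2))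
  + t' (p (inord 0)) * c2 (pt [:: p (inord 1); p (inord 2)]).
have Cpt (g h k : G) : C (pt [:: g; h; k]) =
    \sum_(w in transv H) Y w g h * z' (w * (g * h))%g k + t' g * c2 (pt [:: h; k]).
  by rewrite /C /pt /= !inordK.
change (cup xi eta = 0); apply/coh_class_eq0.
exists C; first exact: discrete_locally_constant.
apply/funext => p; rewrite (pt_eta p) /=.
set g : G := p (inord 0); set h : G := p (inord 1); set k : G := p (inord 2); set l : G := p (inord 3).
rewrite (cup_cochain22 c1 c2) cobound3E !Cpt a1E xY.
(* The face dropping [g] starts at [w] instead of [w * g]; the summand depends only on the coset. *)
have shift : \sum_(w in transv H) Y w h k * z' (w * (h * k))%g l =
    \sum_(w in transv H) Y (w * g)%g h k * z' (w * (g * h * k))%g l.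
  rewrite -(@big_transv_shift _ H _ _ _ (fun u => Y u h k * z' (u * (h * k))%g l) g).
    by apply: eq_bigr => w _; rewrite !mulgA.
  by move=> v u vH; rewrite YH // -mulgA /z' zH.
rewrite shift; pose K := c2 (pt [:: k; l]); rewrite -/K.
have -> : (\sum_(w in transv H) Y w g h + (t g + t h + t (g * h)%g) +
    (a1 g + a1 h + a1 (g * h)%g)) * K =
    \sum_(w in transv H) Y w g h * K + (t' g + t' h + t' (g * h)%g) * K.
  by rewrite -mulr_suml /t'; ring.
have -> : \sum_(w in transv H) Y w g h * K =
    \sum_(w in transv H) Y (w * g)%g h k * z' (w * (g * h * k))%g l +
    \sum_(w in transv H) Y w (g * h)%g k * z' (w * (g * h * k))%g l +
    \sum_(w in transv H) Y w g (h * k)%g * z' (w * (g * (h * k)))%g l +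
    \sum_(w in transv H) Y w g h * z' (w * (g * h))%g (k * l)%g +
    \sum_(w in transv H) Y w g h * z' (w * (g * h))%g k.
  rewrite -!big_split /=; apply: eq_bigr => w _.
  rewrite [(g * (h * k))%g]mulgA -mulrDl -mulrDl -(YC w g h k).
  rewrite [(w * (g * h * k))%g]mulgA z'E -/K.
  set z1 := z' _ _; set z2 := z' _ _.
  rewrite [RHS](_ : _ = Y w g h * K + (Y w g h * z1 + Y w g h * z1) + (Y w g h * z2 + Y w g h * z2)).
    by rewrite !addff2 !addr0.
  by ring.
have -> : (t' g + t' h + t' (g * h)%g) * K =
    t' g * (c2 (pt [:: h; k]) + c2 (pt [:: (h * k)%g; l]) + c2 (pt [:: h; (k * l)%g])) +
    (t' h * K + t' (g * h)%g * K).
  by rewrite -(c2C h k l) -/K; ring.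
by ring.
Qed.

End TransferNilpotent.

(** * A multiplicative lift of the regular representation *)

Section RegularLift.
Variables (F : fieldType) (gT : finGroupType).
Hypothesis F2 : (2%:R : F) != 0.
Variable r : F.
Hypothesis r2 : r ^+ 2 = 2%:R.
Local Notation A := ('M[F]_#|{set gT}|).
Implicit Types (g h k : gT) (U V : A) (H : {group gT}).

Lemma natF2_addb (b c : bool) : (b (+) c)%:R = b%:R + c%:R :> 'F_2.
Proof. by case: b; case: c => //; rewrite ?addr0 ?add0r // addff2. Qed.

Lemma natF2_inj (b c : bool) : b%:R = c%:R :> 'F_2 -> b = c.
Proof. by case: b; case: c. Qed.

Lemma natF2_surj (a : 'F_2) : exists b : bool, a = b%:R.
Proof.
by case: a => [[|[|//]] ?]; [exists false|exists true]; apply: val_inj.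
Qed.

Lemma pinp_sign_choice (J : Type) (U V : J -> A) (p : J -> {perm gT}) :
    (forall j, pinp (U j) (p j)) -> (forall j, pinp (V j) (p j)) ->
  exists b : J -> bool, forall j, U j = (-1) ^+ (b j) * V j.
Proof.
move=> pU pV; have /choice[b bE] : forall j, exists b : bool, U j = (-1) ^+ b * V j.
  by move=> j; exact: (pinp_unique F2 (pV j)).
by exists b.
Qed.

(* y is the sign cocycle of an arbitrary lift Y of the regular representation of H,
   and the restriction to H of the class of G is trivialized by tau. *)
Lemma klein_regular_lift (H : {group gT}) : two_reduced gT -> (4 %| #|H|)%N ->
    (forall k, k \in H -> odd_perm (block H 1 k) = false) ->
    (exists tau : gT -> A, mult_lift H rmul tau) ->
  exists tau : gT -> A, mult_lift [set: gT]%G rmul tau.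
Proof.
move=> G_red H4 Heven [tau [tauP tauM]].
have /choice[Y pY] : forall k, exists U : A, pinp U (block H 1 k).
  by move=> k; exact: perm_lift r2 _.
have [y0 y0E] : exists y0 : gT * gT -> bool, forall kl, kl.1 \in H -> kl.2 \in H ->
    Y kl.1 * Y kl.2 = (-1) ^+ (y0 kl) * Y (kl.1 * kl.2)%g.
  have /choice[y0 y0E] : forall kl, exists b : bool, kl.1 \in H -> kl.2 \in H ->
      Y kl.1 * Y kl.2 = (-1) ^+ b * Y (kl.1 * kl.2)%g.
    move=> [k l] /=; have [kH|_] := boolP (k \in H); last by exists false.
    have [lH|_] := boolP (l \in H); last by exists false.
    have pYY : pinp (Y k * Y l) (block H 1 (k * l)) by rewrite block1M //; exact: pinpM.
    by have [b bE] := pinp_unique F2 (pY (k * l)%g) pYY; exists b.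
  by exists y0.
pose y k l := y0 (k, l).
have yE k l : k \in H -> l \in H -> Y k * Y l = (-1) ^+ (y k l) * Y (k * l)%g.
  by move=> kH lH; exact: y0E (k, l) kH lH.
have [s [sP sM]] := induced_lift F2 r2 H4 Heven (fun k _ => pY k) yE.
(* [s'] is equivariant for [tau] under left translation by [H]. The sign [z] between [s' g * s k]
   and [s' (g * k)] therefore depends only on the coset of [g], and it trivializes the class of [x]
   over [H]. *)
pose s' g := tau (cval H g) * s (crep H g).
have s'P g : pinp (s' g) (rmul g).
  by have := pinpM (tauP _ (cval_in H g)) (sP (crep H g)); rewrite -rmul_mul cvalK.
have s'M v g : v \in H -> s' (v * g)%g = tau v * s' g.
  by move=> vH; rewrite /s' cvalM // crepM // tauM ?cval_in // mulrA.
clearbody s'.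
have [z0 z0E] : exists z0 : gT * gT -> bool, forall gk,
    s' gk.1 * s gk.2 = (-1) ^+ (z0 gk) * s' (gk.1 * gk.2)%g.
  apply: (@pinp_sign_choice _ _ _ (fun gk => rmul (gk.1 * gk.2)%g)) => gk //.
  by rewrite rmul_mul; exact: pinpM.
pose z g k := z0 (g, k).
have zE g k : s' g * s k = (-1) ^+ (z g k) * s' (g * k)%g by exact: z0E (g, k).
pose x g h := \big[addb/false]_(w in transv H) y (cval H (w * g)%g) (cval H (crep H (w * g) * h)%g).
have xE g h : s g * s h = (-1) ^+ (x g h) * s (g * h)%g by exact: sM.
have s'U g : (s' g)^T * s' g = 1 by exact: pin_trK (s'P g).
have YU k : (Y k)^T * Y k = 1 by exact: pin_trK (pY k).
have sU k : (s k)^T * s k = 1 by exact: pin_trK (sP k).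
have yC k l m : k \in H -> l \in H -> m \in H ->
    y k l (+) y (k * l)%g m = y l m (+) y k (l * m)%g.
  move=> kH lH mH; apply: (sign_injA F2 (YU (k * l * m)%g)).
  rewrite -!sign_comb -(yE (k * l)%g m) ?groupM // [LHS]mulrA -yE // -mulgA.
  by rewrite -(yE k (l * m)%g) ?groupM // -signrCA -yE // mulrA.
(* The cocycle [y] of [H] as a cocycle of the group with values in functions of the coset of [w];
   its sum over the transversal is [x]. *)
pose Yt w g h := y (cval H (crep H w * g)%g) (cval H (crep H (w * g) * h)%g).
have cvC w g h : (cval H (crep H w * g) * cval H (crep H (w * g) * h))%g =
    cval H (crep H w * (g * h))%g.
  rewrite (mulgA (crep H w) g h) -[X in _ = cval H (X * h)](cvalK H (crep H w * g)%g).
  by rewrite crepMr -(mulgA _ _ h) [RHS]cvalM ?cval_in.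
have [c cE] : exists c : gT -> 'F_2, forall g h, (x g h)%:R = c g + c h + c (g * h)%g.
  apply: (@transfer_nilpotent _ H _ (fun g k => (z g k)%:R) (fun=> 0)
    (fun w g h => (Yt w g h)%:R)) => //.
  - move=> v g k vH; congr (nat_of_bool _)%:R; apply: (sign_injA F2 (s'U (v * g * k)%g)).
    by rewrite -zE s'M // -mulrA zE signrCA -mulgA (s'M v).
  - move=> g k l; rewrite -!natF2_addb; congr (nat_of_bool _)%:R.
    have : s' g * s k * s l = s' g * (s k * s l) by rewrite mulrA.
    rewrite zE xE -mulrA zE (signrCA _ (s' g)) zE !sign_comb mulgA => /(sign_injA F2 (s'U _)) E.
    by move: E; case: (z g k); case: (z _ l); case: (x k l); case: (z g _).
  - by move=> v g h k vH; rewrite /Yt -(mulgA v g h) !(crepM _ vH).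
  - move=> w g h k; rewrite -!natF2_addb; congr (nat_of_bool _)%:R.
    have := yC (cval H (crep H w * g)%g) (cval H (crep H (w * g) * h)%g)
      (cval H (crep H (w * g * h) * k)%g) (cval_in H _) (cval_in H _) (cval_in H _).
    rewrite /Yt (mulgA w g h) -(cvC w g h) -(cvC (w * g)%g h k).
    by case: (y _ _); case: (y _ _); case: (y _ _); case: (y _ _).
  - move=> g h; rewrite !addr0 /x.
    rewrite (big_morph (fun b : bool => b%:R : 'F_2) natF2_addb (erefl _)).
    by apply: eq_bigr => w wW; rewrite /Yt (transvP wW).
have /choice[d dE] : forall g, exists b : bool, c g = b%:R by move=> g; exact: natF2_surj.
exists (fun g => (-1) ^+ (d g) * s g); split=> [g _|g h _ _]; first exact: (pin_sign _ (sP g)).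
rewrite -mulrA signrCA [s g * _]xE !sign_comb.
have : x g h = d g (+) d h (+) d (g * h)%g.
  by apply: natF2_inj; rewrite cE !dE !natF2_addb.
by move=> ->; congr ((-1) ^+ (nat_of_bool _) * _); case: (d g); case: (d h); case: (d _).
Qed.

Lemma regular_lift : two_reduced gT ->
    #|gT| = 0 %[mod 8] \/ #|gT| = 2 %[mod 8] ->
  exists tau : gT -> A, mult_lift [set: gT]%G rmul tau.
Proof.
move=> G_red n8; have [P sylP] := Sylow_exists 2 [set: gT].
have n_gt0 : (0 < #|gT|)%N by apply/card_gt0P; exists 1%g.
have oP : #|P| = (2 ^ logn 2 #|gT|)%N by rewrite (card_Hall sylP) cardsT p_part.
have [cP|[a [b ab]]|[a [b ab]]] := two_group_cases (pHall_pgroup sylP).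
- have oddP : odd #|[set: gT] : P|%g.
    by rewrite odd_2'nat; case/and3P: sylP.
  have [|tau tauP] := cyclic_lift F2 r2 n8 cP.
    (* For n = 0 mod 8 the order of the Sylow subgroup is divisible by 8; for n = 2 mod 8 it is
       2. *)
    case: n8 => n8; [right|left]; rewrite oP.
      rewrite -[8%N]/(2 ^ 3)%N dvdn_exp2l // -pfactor_dvdn //.
      by rewrite /dvdn n8.
    suff -> : logn 2 #|gT| = 1%N by [].
    have n2 : (2 %| #|gT|)%N.
      by rewrite /dvdn -(@modn_dvdm 8) // n8.
    have n4 : ~~ (4 %| #|gT|)%N.
      by rewrite /dvdn -(@modn_dvdm 8) // n8.
    apply/eqP; rewrite eqn_leq -pfactor_dvdn // n2 andbT leqNgt.
    by apply: contra n4; rewrite -[4%N]/(2 ^ 2)%N pfactor_dvdn.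
  exact: (odd_transfer_lift F2 r2 oddP tauP).
- have [H [oH aH bH Hab HH]] := klein_group ab.
  apply: (klein_regular_lift (H := H)) => //; rewrite ?oH //.
    exact: (klein_even F2 r2 oH HH).
  exact: (klein_lift F2 r2 ab n8 aH bH Hab).
- have [H [oH Heven [Y [pY YM]]]] := quaternion_case F2 r2 ab.
  have H4 : (4 %| #|H|)%N by rewrite oH.
  (* The lift on the blocks is multiplicative, so its sign cocycle is zero and the induced lift
     carries no sign. *)
  have [|s [sP sM]] := induced_lift F2 r2 H4 Heven pY (y := fun _ _ => false).
    by move=> k l kH lH; rewrite mul1r YM.
  exists s; split=> [g _|g h _ _]; first exact: sP.
  by rewrite sM big1 ?mul1r.
Qed.

End RegularLift.

(** * Galois algebras and trace forms *)

Section SeparableClosure.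
Variables (K Ks : fieldType) (iota : {rmorphism K -> Ks}).
Hypothesis Ks_sep : separable_closure iota.

Lemma closure_sqrt (a : Ks) : (2%:R : Ks) != 0 -> exists c, c ^+ 2 = a.
Proof.
move=> F2; have [->|a0] := eqVneq a 0; first by exists 0; rewrite expr0n.
have [||c] := separable_closure_closed Ks_sep (q := 'X^2 - a%:P).
- rewrite separable_poly.unlock; apply/Bezout_coprimepP.
  (* The polynomial and its derivative generate the constant [a], which is non-zero here. *)
  exists (-1, (2%:R^-1)%:P * 'X) => /=.
  rewrite !derivE subr0 mulN1r opprB mul1r mulr1 -mulr2n.
  have -> : (2%:R^-1)%:P * 'X * ('X *+ 2) = 'X^2 :> {poly Ks}.
    rewrite -(mulr_natl (polyX Ks) 2) mulrACA -polyC_natr -polyCM mulVf //.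
    by rewrite mul1r expr2.
  by rewrite subrK polyC_eqp1.
- by rewrite size_XnsubC.
by rewrite rootE !hornerE subr_eq0 => /eqP; exists c.
Qed.

(** A primitive element is sent to a root of its minimal polynomial. The expression [P y] of [y] in
    the generator is arbitrary; [uniq] makes its value at [t] independent of the choice, and the
    morphism laws follow from that. *)
Lemma fieldext_embedding (E : fieldExtType K) : separable 1 {:E}%VS ->
  exists f : E -> Ks, [/\ GRing.zmod_morphism f, GRing.monoid_morphism f
    & forall a, f (in_alg E a) = iota a].
Proof.
move=> sepE; pose z := separable_generator 1 {:E}%VS.
have Ez : {:E}%VS = <<1; z>>%VS :> {vspace _}.
  by apply: eq_adjoin_separable_generator => //; exact: subvf.
have /choice[P PE] : forall y : E, exists p, y = (map_poly (in_alg E) p).[z].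
  by move=> y; apply/Fadjoin1_polyP; rewrite -Ez memvf.
have /polyOver1P[q qE] := minPolyOver 1 z.
have sepq : separable_poly q.
  by rewrite -(separable_map (in_alg E)) -qE; exact: separable_generatorP.
have [||t qt] := separable_closure_closed Ks_sep (q := map_poly iota q).
- by rewrite separable_map.
- rewrite size_map_poly -(size_map_poly (in_alg E)) -qE size_minPoly.
  by rewrite eqSS.
have uniq p p' : (map_poly (in_alg E) p).[z] = (map_poly (in_alg E) p').[z] ->
    (map_poly iota p).[t] = (map_poly iota p').[t].
  move=> /eqP; rewrite -subr_eq0 -hornerN -hornerD -rmorphB -rootE => pz.
  have : minPoly 1 z %| map_poly (in_alg E) (p - p').
    by apply: minPoly_dvdp => //; apply/polyOver1P; exists (p - p').
  rewrite qE dvdp_map -(dvdp_map iota) => /dvdpP[u uE].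
  apply/eqP; rewrite -subr_eq0 -hornerN -hornerD -rmorphB /= uE.
  by rewrite hornerM (rootP qt) mulr0.
exists (fun y => (map_poly iota (P y)).[t]); split.
- move=> x y; rewrite -hornerN -hornerD -rmorphB; apply: uniq.
  by rewrite -PE rmorphB hornerD hornerN -!PE.
- split=> [|x y].
    rewrite -[RHS](hornerC 1 t) -[1%:P](rmorph1 (map_poly iota)); apply: uniq.
    by rewrite -PE rmorph1 hornerC.
  by rewrite -hornerM -rmorphM; apply: uniq; rewrite -PE rmorphM hornerM -!PE.
- move=> a; rewrite -[RHS](hornerC _ t) -map_polyC; apply: uniq.
  by rewrite -PE map_polyC hornerC.
Qed.

Lemma etale_embedding (L : falgType K) : etale L ->
  exists f : {lrmorphism L -> Ks | iota \; *%R}, True.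
Proof.
move=> [r [E [p [sepE pE]]]].
(* An empty product would identify 0 and 1 in [L]; the embedding is then built on the factor of
   index 0. *)
have r0 : (0 < r)%N.
  rewrite lt0n; apply/eqP => r0; subst r.
  have [x [_ xu]] := pE (fun i => 0).
  have : (0 : L) = 1 by rewrite -(xu 0) ?(xu 1) // => -[].
  by move/eqP; rewrite eq_sym oner_eq0.
pose i := Ordinal r0; have [h [hB hM hK]] := fieldext_embedding (sepE i).
pose f (x : L) := h (p i x).
have fB : GRing.zmod_morphism f by move=> x y; rewrite /f rmorphB hB.
have fM : GRing.monoid_morphism f.
  by case: hM => h1 hM; split=> [|x y]; rewrite /f ?rmorph1 ?rmorphM ?h1 ?hM.
have fZ : scalable_for (iota \; *%R) f.
  by move=> a x; rewrite /f linearZ /= -mulr_algl; case: hM => _ ->; rewrite [h _]hK.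
pose fl : {lrmorphism L -> Ks | iota \; *%R} := HB.pack f
  (GRing.isZmodMorphism.Build _ _ f fB) (GRing.isMonoidMorphism.Build _ _ f fM)
  (GRing.isScalable.Build _ _ _ _ f fZ).
by exists fl.
Qed.

End SeparableClosure.

(** Dedekind's argument, by induction on the number of non-zero coefficients: weighting the relation
    by [f k y - f i y] removes the index [i], and keeps [j] when [f j y != f i y]. *)
Lemma characters_independent (R : pzRingType) (F : fieldType) (J : finType)
    (f : J -> R -> F) :
    (forall j, f j 1 = 1) -> (forall j x y, f j (x * y) = f j x * f j y) ->
    (forall i j, f i =1 f j -> i = j) ->
  forall c : J -> F, (forall x, \sum_j c j * f j x = 0) -> forall j, c j = 0.
Proof.
move=> f1 fM finj c; have [n] := ubnP #|[set j | c j != 0]|.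
elim: n c => // n IHn c; rewrite ltnS => cn cf i.
apply/eqP; apply: contraT => ci.
have c0 j : j != i -> c j = 0.
  move=> ji; have [y fy] : exists y, f j y != f i y.
    apply: contrapT => /forallNP ny; case/eqP: ji; apply: finj => y.
    by apply/eqP; rewrite -[_ == _]negbK; apply/negP/ny.
  pose c' k := c k * (f k y - f i y).
  have : c' j = 0.
    apply: IHn => [|x].
      apply: leq_trans cn; apply: proper_card; apply/properP; split.
        by apply/fintype.subsetP => k; rewrite !inE /c'; apply: contraNneq => ->; rewrite mul0r.
      by exists i; rewrite !inE // /c' subrr mulr0 eqxx.
    have -> : \sum_k c' k * f k x = \sum_k c k * f k (y * x) - f i y * \sum_k c k * f k x.
      by rewrite mulr_sumr -sumrB; apply: eq_bigr => k _; rewrite fM /c'; ring.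
    by rewrite !cf mulr0 subr0.
  by move/eqP; rewrite mulf_eq0 subr_eq0 (negPf fy) orbF => /eqP.
have := cf 1; rewrite (bigD1 i) //= f1 mulr1 big1 ?addr0 => [/eqP|j /c0 ->].
  by rewrite (negPf ci).
by rewrite mul0r.
Qed.

Section TraceSum.
Variables (K Ks : fieldType) (iota : {rmorphism K -> Ks}).
Variables (gT : finGroupType) (L : falgType K) (act : gT -> {lrmorphism L -> L}).
Hypothesis L_gal : galois_algebra iota act.
Variable f0 : {lrmorphism L -> Ks | iota \; *%R}.
Local Notation n := (\dim {:L}).
Implicit Types (g h : gT) (x y : L).

(** The conjugates of the base embedding [f0]; with the inverse, the absolute Galois group acts on
    their indices through right multiplications ([galois_hom]). *)
Definition conj_emb g x : Ks := f0 (act g^-1%g x).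

Lemma conj_embM g x y : conj_emb g (x * y) = conj_emb g x * conj_emb g y.
Proof. by rewrite /conj_emb !rmorphM. Qed.

Lemma conj_emb1 g : conj_emb g 1 = 1.
Proof. by rewrite /conj_emb !rmorph1. Qed.

Lemma conj_embZ g a x : conj_emb g (a *: x) = iota a * conj_emb g x.
Proof. by rewrite /conj_emb !linearZ. Qed.

Lemma conj_emb_sum g (J : finType) (x : J -> L) :
  conj_emb g (\sum_j x j) = \sum_j conj_emb g (x j).
Proof. by rewrite /conj_emb !rmorph_sum. Qed.

Lemma conj_emb_inj g h : conj_emb g =1 conj_emb h -> g = h.
Proof.
move=> gh; pose f : {lrmorphism L -> Ks | iota \; *%R} := f0 \o act h^-1%g.
have [k [_ ku]] := galois_algebra_simply_transitive L_gal f0 f.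
by rewrite -(ku g) ?(ku h) // => x; exact: gh.
Qed.

Lemma conj_emb_independent (c : gT -> Ks) :
  (forall x, \sum_g c g * conj_emb g x = 0) -> forall g, c g = 0.
Proof.
apply: characters_independent; [exact: conj_emb1|exact: conj_embM|exact: conj_emb_inj].
Qed.

Let deg : n = #|gT| := galois_algebra_degree L_gal.
Let idx (l : 'I_n) : gT := enum_val (cast_ord deg l).

Let idx_bij : bijective idx.
Proof.
exists (fun g => cast_ord (esym deg) (enum_rank g)) => [l|g].
  by rewrite /idx enum_valK cast_ordK.
by rewrite /idx cast_ordKV enum_rankK.
Qed.

Let emb_mx : 'M[Ks]_n := \matrix_(k, l) conj_emb (idx l) (vbasis {:L})`_k.

Lemma emb_mx_unit : emb_mx \in unitmx.
Proof.
rewrite -unitmx_tr -row_free_unit; apply: inj_row_free => u uE.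
have uF : forall g, (fun g => \sum_l u 0 l *+ (idx l == g)) g = 0.
  apply: conj_emb_independent => x; rewrite (coord_vbasis (memvf x)).
  under eq_bigr do rewrite conj_emb_sum mulr_sumr.
  rewrite exchange_big big1 //= => k _.
  under eq_bigr do rewrite conj_embZ mulrCA.
  rewrite -mulr_sumr; have := congr1 (fun v : 'rV_n => v 0 k) uE; rewrite !mxE => uk.
  rewrite (_ : \sum_g _ = 0) ?mulr0 // -[RHS]uk.
  rewrite (reindex idx) /=; last exact: onW_bij.
  apply: eq_bigr => l _; rewrite !mxE; congr (_ * _).
  rewrite (bigD1 l) //= eqxx big1 ?addr0 // => j jl.
  by rewrite (bij_eq idx_bij) (negPf jl).
apply/rowP => l; rewrite mxE -[RHS](uF (idx l)) (bigD1 l) //= eqxx big1 ?addr0 // => j jl.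
by rewrite (bij_eq idx_bij) (negPf jl).
Qed.

(** The matrix of the embeddings, invertible by Dedekind's lemma, diagonalizes multiplication by [x]
    with the conjugates of [x] on the diagonal. *)
Lemma trace_sum x : iota (alg_trace x) = \sum_g conj_emb g x.
Proof.
rewrite /alg_trace; set X := passmx.mxof _ _ _.
have XE (k : 'I_n) : x * (vbasis {:L})`_k = \sum_j X k j *: (vbasis {:L})`_j.
  rewrite {1}(coord_vbasis (memvf (x * _))); apply: eq_bigr => j _.
  by rewrite mxE /= mxE passmx.vecof_delta lfunE.
have E : map_mx iota X *m emb_mx = emb_mx *m diag_mx (\row_l conj_emb (idx l) x).
  apply/matrixP => k l; rewrite mul_mx_diag !mxE mulrC -conj_embM XE conj_emb_sum.
  by apply: eq_bigr => j _; rewrite !mxE conj_embZ.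
rewrite -trace_map_mx -[map_mx _ _]mulmx1 -(mulmxV emb_mx_unit) mulmxA E mxtrace_mulC.
rewrite mulmxA mulVmx ?emb_mx_unit // mul1mx mxtrace_diag (reindex idx) /=.
  by apply: eq_bigr => l _; rewrite mxE.
exact: onW_bij.
Qed.

Lemma trace_mul_sum x y : iota (alg_trace (x * y)) = \sum_g conj_emb g x * conj_emb g y.
Proof. by rewrite trace_sum; apply: eq_bigr => g _; rewrite conj_embM. Qed.

Lemma trace_mulC x y : alg_trace (x * y) = alg_trace (y * x).
Proof.
apply: (fmorph_inj iota); rewrite !trace_mul_sum.
by apply: eq_bigr => g _; rewrite mulrC.
Qed.

Lemma trace_nondegenerate x : (forall y, alg_trace (x * y) = 0) -> x = 0.
Proof.
move=> x0; have c0 : forall g, conj_emb g x = 0.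
  by apply: conj_emb_independent => y; rewrite -trace_mul_sum x0 rmorph0.
have : \row_k iota (coord (vbasis {:L}) k x) *m emb_mx = 0.
  apply/rowP => l; rewrite !mxE -[RHS](c0 (idx l)) [in RHS](coord_vbasis (memvf x)).
  by rewrite conj_emb_sum; apply: eq_bigr => k _; rewrite !mxE conj_embZ.
move/(congr1 (mulmx^~ (invmx emb_mx))); rewrite mulmxK ?emb_mx_unit // mul0mx => /rowP x0'.
rewrite (coord_vbasis (memvf x)) big1 // => k _.
by have /eqP := x0' k; rewrite !mxE fmorph_eq0 => /eqP ->; rewrite scale0r.
Qed.

End TraceSum.

(** * Orthogonal bases for symmetric bilinear forms *)

Section OrthogonalBasis.
Variables (K : fieldType) (V : vectType K) (B : V -> V -> K).
Hypothesis K2 : (2%:R : K) != 0.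
Hypothesis BC : forall x y, B x y = B y x.
Hypothesis BL : forall a x x' y, B (a *: x + x') y = a * B x y + B x' y.
Hypothesis B_nondeg : forall x, (forall y, B x y = 0) -> x = 0.
Implicit Types (x y : V) (s : seq V).

Lemma bilin0 y : B 0 y = 0.
Proof. by have := BL 1 0 0 y; rewrite scaler0 addr0 mul1r => /eqP; rewrite -subr_eq subrr eq_sym => /eqP. Qed.

Lemma bilinD x x' y : B (x + x') y = B x y + B x' y.
Proof. by rewrite -[x in LHS]scale1r BL mul1r. Qed.

Lemma bilinZ a x y : B (a *: x) y = a * B x y.
Proof. by rewrite -[_ *: x]addr0 BL bilin0 addr0. Qed.

Lemma bilin_sum (J : Type) (r : seq J) (P : pred J) (u : J -> V) y :
  B (\sum_(j <- r | P j) u j) y = \sum_(j <- r | P j) B (u j) y.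
Proof. exact: (big_morph (B^~ y) (fun x x' => bilinD x x' y) (bilin0 y)). Qed.

Definition orthogonal_seq s : Prop :=
  (forall i j, (i < size s)%N -> (j < size s)%N -> i != j -> B s`_i s`_j = 0) /\
  (forall i, (i < size s)%N -> B s`_i s`_i != 0).

Lemma orthogonal_sum s (c : nat -> K) j : orthogonal_seq s -> (j < size s)%N ->
  B (\sum_(i < size s) c i *: s`_i) s`_j = c j * B s`_j s`_j.
Proof.
move=> [s0 _] js; rewrite bilin_sum (bigD1 (Ordinal js)) //= bilinZ big1 ?addr0 // => i ij.
rewrite bilinZ s0 ?mulr0 //; apply: contraNneq ij => ij.
Qed.

Lemma orthogonal_free s : orthogonal_seq s -> free s.
Proof.
move=> os; apply/(@freeP _ _ _ (in_tuple s)) => c c0 i.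
have := @orthogonal_sum s (fun k => if insub k is Some j then c j else 0) i os (ltn_ord i).
rewrite valK (eq_bigr (fun j => c j *: s`_j)) => [|j _]; last by rewrite valK.
rewrite [X in B X _]c0 bilin0 => /esym/eqP; rewrite mulf_eq0 => /orP[/eqP //|].
by rewrite (negPf (os.2 _ (ltn_ord i))).
Qed.

(** Gram-Schmidt may produce an isotropic [w]. Non-degeneracy gives [y'], orthogonal to [s] as well,
    with [B w y' != 0]; since 2 is invertible, one of [w], [y'] and [w + y'] is anisotropic. *)
Lemma orthogonal_extend s : orthogonal_seq s -> (size s < \dim {:V})%N ->
  exists x, orthogonal_seq (rcons s x).
Proof.
move=> os sV; have [s0 s1] := os.
pose proj x := x + \sum_(i < size s) (- (B x s`_i / B s`_i s`_i)) *: s`_i.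
have projs x j : (j < size s)%N -> B (proj x) s`_j = 0.
  move=> js; rewrite bilinD (orthogonal_sum (fun i => - (B x s`_i / B s`_i s`_i)) os js).
  by rewrite mulNr divfK ?subrr // s1.
have [x xs] : exists x, x \notin <<s>>%VS.
  apply: contrapT => /forallNP allx; move: sV; rewrite ltnNge => /negP[].
  apply: leq_trans (dim_span s); apply: dimvS; apply/subvP => x _.
  by apply: contrapT => /negP; exact: allx.
pose w := proj x.
have w0 : w != 0.
  apply: contraNneq xs; rewrite /w /proj => /eqP; rewrite addr_eq0 => /eqP ->.
  by rewrite rpredN rpred_sum // => i _; rewrite rpredZ // memv_span // mem_nth.
have [y wy] : exists y, B w y != 0.
  apply: contrapT => /forallNP ally; case/eqP: w0; apply: B_nondeg => y.
  by apply/eqP; rewrite -[_ == _]negbK; apply/negP/ally.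
pose y' := proj y.
have wy' : B w y' != 0.
  rewrite (BC w) /y' /proj bilinD (BC y w) bilin_sum big1 ?addr0 // => i _.
  by rewrite bilinZ (BC _ w) projs ?mulr0.
have extend u : (forall j, (j < size s)%N -> B u s`_j = 0) -> B u u != 0 ->
    orthogonal_seq (rcons s u).
  move=> us uu; split=> [i j|i]; rewrite !size_rcons !ltnS !nth_rcons.
    rewrite leq_eqVlt => /orP[/eqP ->|si]; rewrite leq_eqVlt => /orP[/eqP ->|sj] ij.
    - by rewrite eqxx in ij.
    - by rewrite ltnn eqxx sj us.
    - by rewrite ltnn eqxx si BC us.
    - by rewrite si sj s0.
  rewrite leq_eqVlt => /orP[/eqP ->|si]; first by rewrite ltnn eqxx.
  by rewrite si s1.
have ws : forall j, (j < size s)%N -> B w s`_j = 0 by move=> j; exact: projs.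
have ys : forall j, (j < size s)%N -> B y' s`_j = 0 by move=> j; exact: projs.
clearbody y' w.
have [ww|ww] := eqVneq (B w w) 0; last by exists w; exact: extend.
have [yy|yy] := eqVneq (B y' y') 0; last by exists y'; exact: extend.
exists (w + y'); apply: extend => [j js|]; first by rewrite bilinD ws ?ys ?addr0.
rewrite bilinD (BC w (w + y')) (BC y' (w + y')) !bilinD ww yy (BC y' w) addr0 add0r -mulr2n -mulr_natl.
by rewrite mulf_neq0.
Qed.

Lemma orthogonal_basis : exists e : (\dim {:V}).-tuple V,
  [/\ basis_of {:V} e, forall i j : 'I_(\dim {:V}), i != j -> B e`_i e`_j = 0
    & forall i : 'I_(\dim {:V}), B e`_i e`_i != 0].
Proof.
have [s [os sz]] : exists s, orthogonal_seq s /\ size s = \dim {:V}.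
  have: (\dim {:V} <= \dim {:V})%N by [].
  elim: {1 3}(\dim {:V}) => [|m IH] mV; first by exists [::].
  have [s [os sz]] := IH (ltnW mV).
  have [|x ox] := orthogonal_extend os; first by rewrite sz.
  by exists (rcons s x); rewrite size_rcons sz.
have szE : size s == \dim {:V} by rewrite sz.
exists (Tuple szE); split=> /=.
- by rewrite basisEfree orthogonal_free // subvf sz leqnn.
- by move=> i j ij; apply: os.1; rewrite ?sz.
- by move=> i; apply: os.2; rewrite sz.
Qed.

End OrthogonalBasis.

(** * Serre's formula *)

Section SignElement.
Variables (F : fieldType) (I : finType) (i0 : I).
Hypothesis F2 : (2%:R : F) != 0.
Local Notation A := ('M[F]_#|{set I}|).
Local Notation gamn k := (@gam F I (nth i0 (enum I) k)).
Implicit Types (eps del : nat -> bool).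

(** The generators come in decreasing order, so that merging two such products crosses exactly the
    pairs [i < j] with [eps i] and [del j], the pairs that occur in w_2. *)
Fixpoint sign_elt eps m : A :=
  if m is m'.+1 then (if eps m' then gamn m' else 1) * sign_elt eps m' else 1.

Definition total eps m : bool := \big[addb/false]_(k < m) eps k.

Lemma pin_gam_elt i : pin (@gam F I i) true
  (fun j => (-1) ^+ (i == j) * gam F j).
Proof.
have u1 : \sum_k ((k == i)%:R : F) ^+ 2 = 1.
  rewrite (bigD1 i) //= eqxx expr1n big1 ?addr0 // => k /negPf ->.
  by rewrite expr0n.
have := gvec_pin F2 u1; rewrite gvec_delta; apply: pin_ext => j.
rewrite eq_sym; case: (i =P j) => [->|_]; last by rewrite mulr0 scale0r subr0 mul1r.
rewrite mulr1 scaler_nat mulr2n opprD addrA subrr sub0r expr1 mulN1r.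
by [].
Qed.

Lemma sign_elt_pin eps m : (m <= #|I|)%N ->
  pin (sign_elt eps m) (total eps m)
    (fun i => (-1) ^+ ((index i (enum I) < m)%N && eps (index i (enum I))) * gam F i).
Proof.
elim: m => [|m IH] mI.
  rewrite /total big_ord0; apply: pin_ext (pin1 F I) => i.
  by rewrite mul1r.
have pm := IH (ltnW mI).
have iE i : (index i (enum I) < m.+1)%N && eps (index i (enum I)) =
    (eps m && (nth i0 (enum I) m == i)) (+)
    ((index i (enum I) < m)%N && eps (index i (enum I))).
  have -> : (nth i0 (enum I) m == i) = (index i (enum I) == m).
    apply/eqP/eqP => [<-|<-]; last by rewrite nth_index // mem_enum.
    by rewrite index_uniq // ?enum_uniq // -cardE.
  rewrite ltnS leq_eqVlt; case: eqP => [->|_] /=; last by rewrite andbF.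
  by rewrite ltnn andbT addbF.
rewrite /total big_ord_recr /= -/(total eps m) addbC.
have [epsm|epsm] := boolP (eps m); last first.
  rewrite mul1r; apply: pin_ext pm => i.
  by rewrite iE (negPf epsm).
apply: (pinM (pin_gam_elt _) pm) => i.
rewrite signrCA (pin_gam (pin_gam_elt _)) iE epsm /=.
by rewrite expr1 !mulN1r mulrN -!mulrA sign_comb addbC.
Qed.

Lemma sign_elt_map (s : {rmorphism F -> F}) eps m :
  map_mx s (sign_elt eps m) = sign_elt eps m.
Proof.
elim: m => [|m IH]; first exact: rmorph1.
by rewrite /= rmorphM /= IH; case: (eps m); rewrite ?map_spm ?rmorph1.
Qed.

(** When [eps] and [del] record the actions of [s] and [t] on the square roots of the diagonal
    coefficients, this is the value at [(s, t)] of the natural cocycle for w_2. *)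
Definition sign_form eps del m : bool :=
  \big[addb/false]_(j < m) (total eps j && del j).

Lemma sign_elt_mul eps del m : (m <= #|I|)%N ->
  sign_elt eps m * sign_elt del m =
  (-1) ^+ (sign_form eps del m) * sign_elt (fun k => eps k (+) del k) m.
Proof.
elim: m => [|m IH] mI; first by rewrite /sign_form big_ord0 !mul1r.
have mI' := ltnW mI.
rewrite /sign_form big_ord_recr /= -/(sign_form eps del m).
set g := gamn m; set X := sign_elt eps m; set Y := sign_elt del m.
have gX : X * g = (-1) ^+ (total eps m) * (g * X).
  rewrite (pin_gam (sign_elt_pin eps mI')) index_uniq ?enum_uniq -?cardE // ltnn.
  by rewrite mul1r.
have gg : g * g = 1 by exact: gam_sqr.
have -> : (if eps m then g else 1) * X * ((if del m then g else 1) * Y) =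
    (-1) ^+ (total eps m && del m) * (((if eps m then g else 1) * (if del m then g else 1)) * (X * Y)).
  case: (del m); last by rewrite andbF mulr1 !mul1r mulrA.
  rewrite andbT -(mulrA _ X) (mulrA X g) gX -!mulrA.
  by rewrite signrCA.
rewrite IH // [X in _ * (X * _)](_ : _ = if eps m (+) del m then g else 1); last first.
  by case: (eps m); case: (del m); rewrite ?mulr1 ?mul1r.
by rewrite signrCA sign_comb addbC.
Qed.

End SignElement.

Section SquareRoots.
Variables (K Ks : fieldType) (iota : {rmorphism K -> Ks}).
Hypothesis Ks_sep : separable_closure iota.
Hypothesis F2 : (2%:R : Ks) != 0.
Implicit Types (s t : galois_group iota) (a : K).

Lemma root2_sqr a : root2 iota a ^+ 2 = iota a.
Proof.
rewrite /root2; case: xgetP => [r _ //|nr].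
by have [c cE] := closure_sqrt Ks_sep (iota a) F2; case: (nr c).
Qed.

Lemma root2_neq0 a : a != 0 -> root2 iota a != 0.
Proof.
move=> a0; have: root2 iota a ^+ 2 != 0 by rewrite root2_sqr fmorph_eq0.
by rewrite expf_eq0.
Qed.

Definition galois_rmorphism s : {rmorphism Ks -> Ks} :=
  let: And4 sB sM _ _ := galois_is_aut s in
  HB.pack (galois_fun s) (GRing.isZmodMorphism.Build _ _ (galois_fun s) sB)
    (GRing.isMonoidMorphism.Build _ _ (galois_fun s) sM).

Lemma galois_rmorphismE s x : galois_rmorphism s x = s x.
Proof. by rewrite /galois_rmorphism; case: galois_is_aut. Qed.

Definition root_sign a s : bool := s (root2 iota a) != root2 iota a.

Lemma root_signE a s : s (root2 iota a) = (-1) ^+ (root_sign a s) * root2 iota a.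
Proof.
rewrite /root_sign; have [->|E] := eqVneq (s (root2 iota a)) (root2 iota a).
  by rewrite mul1r.
by case: (galois_root2 s a) => [E'|->]; [rewrite E' eqxx in E|rewrite expr1 mulN1r].
Qed.

Lemma root_signP a s (b : bool) : a != 0 ->
  s (root2 iota a) = (-1) ^+ b * root2 iota a -> root_sign a s = b.
Proof.
move=> a0; rewrite root_signE => /(mulIf (root2_neq0 a0)); exact: sign_inj.
Qed.

Lemma root_signM a s t : a != 0 -> root_sign a (s * t)%g = root_sign a s (+) root_sign a t.
Proof.
move=> a0; apply: root_signP => //.
rewrite [LHS](_ : _ = s (t (root2 iota a))) // root_signE.
rewrite -!galois_rmorphismE rmorphM rmorph_sign galois_rmorphismE root_signE.
by rewrite mulrA -signr_addb addbC.
Qed.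

End SquareRoots.

Section GaloisAction.
Variables (K Ks : fieldType) (iota : {rmorphism K -> Ks}).
Variables (gT : finGroupType) (L : falgType K) (act : gT -> {lrmorphism L -> L}).
Hypothesis L_gal : galois_algebra iota act.
Variable f0 : {lrmorphism L -> Ks | iota \; *%R}.
Implicit Types (s t : galois_group iota) (g h : gT) (x y : L).

(** [s \o f0] is again an embedding of [L], so simple transitivity writes it as
    [f0 \o act (phi s)]. *)
Lemma galois_hom : exists phi : galois_group iota -> gT,
  (forall s g x, s (conj_emb act f0 g x) = conj_emb act f0 (g * (phi s)^-1)%g x) /\
  (forall s t, phi (s * t)%g = (phi s * phi t)%g).
Proof.
have /choice[phi phiE] : forall s, exists g, forall x, s (f0 x) = f0 (act g x).
  move=> s.
  have fZ : scalable_for (iota \; *%R) (fun x => s (f0 x)).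
    move=> a x; rewrite linearZ /= -!galois_rmorphismE rmorphM /= galois_rmorphismE.
    by have [_ _ _ ->] := galois_is_aut s.
  have fB : GRing.zmod_morphism (fun x => s (f0 x)).
    by move=> x y; rewrite -!galois_rmorphismE !rmorphB.
  have fM : GRing.monoid_morphism (fun x => s (f0 x)).
    by split=> [|x y]; rewrite -!galois_rmorphismE ?rmorph1 ?rmorphM.
  pose f : {lrmorphism L -> Ks | iota \; *%R} := HB.pack (fun x => s (f0 x))
    (GRing.isZmodMorphism.Build _ _ _ fB) (GRing.isMonoidMorphism.Build _ _ _ fM)
    (GRing.isScalable.Build _ _ _ _ _ fZ).
  have [g [gE _]] := galois_algebra_simply_transitive L_gal f0 f.
  by exists g^-1%g => x; rewrite gE.
have phiJ s g x : s (conj_emb act f0 g x) = conj_emb act f0 (g * (phi s)^-1)%g x.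
  by rewrite /conj_emb phiE invMg invgK (galois_algebra_actM L_gal).
exists phi; split=> // s t; apply: invg_inj.
apply: (conj_emb_inj L_gal) => x.
have := phiJ (s * t)%g 1%g x; rewrite mul1g => E; apply: etrans (esym E) _.
by rewrite [LHS](_ : _ = s (t (conj_emb act f0 1%g x))) // !phiJ mul1g invMg.
Qed.

End GaloisAction.

Section PinVectors.
Variables (F : fieldType) (I : finType).

Lemma gvec_map (s : {rmorphism F -> F}) (u : I -> F) :
  map_mx s (gvec u) = gvec (fun k => s (u k)).
Proof. by rewrite /gvec raddf_sum; apply: eq_bigr => k _; rewrite /= map_mxZ map_spm. Qed.

Lemma pinp_gvec (u : I -> F) (U : 'M[F]_#|{set I}|) (f : {perm I}) : pinp U f ->
  U * gvec u = (-1) ^+ odd_perm f * (gvec (fun k => u (f k)) * U).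
Proof.
move=> pU; rewrite /gvec mulr_sumr mulr_suml mulr_sumr (reindex_inj (@perm_inj _ f)).
apply: eq_bigr => k _ /=; rewrite scaleAr (pinp_gam _ pU) scaleAl scaleAr.
by [].
Qed.

End PinVectors.

Section SerreFormula.
Variables (K Ks : fieldType) (iota : {rmorphism K -> Ks}).
Hypothesis Ks_sep : separable_closure iota.
Hypothesis F2 : (2%:R : Ks) != 0.
Variables (I : finType) (i0 : I) (n : nat).
Hypothesis In : #|I| = n.
Variables (a : nat -> K) (b : I -> I -> Ks) (f : galois_group iota -> {perm I}).
Hypothesis a0 : forall k, a k != 0.
Hypothesis b_on : forall i j, dot (b i) (b j) = (i == j)%:R.
Hypothesis bE : forall (s : galois_group iota) i j,
  s (b i j) = (-1) ^+ root_sign (a (index i (enum I))) s * b i ((f s)^-1 j)%g.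
Variables (tau : galois_group iota -> 'M[Ks]_#|{set I}|).
Hypothesis tauP : forall s, pinp (tau s) (f s).
Hypothesis tauM : forall s t, tau (s * t)%g = tau s * tau t.
Implicit Types (s t : galois_group iota).

Definition root_signs s (k : nat) : bool := root_sign (a k) s.

(* c s is the sign in s(U) = +- (tau s)^-1 U E(s); its coboundary is found by comparing
   (s t)(U) with s(t(U)). *)
Lemma serre_formula : exists (U : 'M[Ks]_#|{set I}|) (c : galois_group iota -> bool),
  [/\ forall s, odd_perm (f s) = total (root_signs s) n,
    forall s t, (forall i j, s (U i j) = t (U i j)) -> tau s = tau t ->
      (forall k, (k < n)%N -> root_signs s k = root_signs t k) -> c s = c t
  & forall s t, c (s * t)%g = c s (+) c t (+) (root_sign 2%:R s && f t) (+)
      sign_form (root_signs s) (root_signs t) n].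
Proof.
pose r := root2 iota 2%:R.
have r2 : r ^+ 2 = 2%:R by rewrite root2_sqr // rmorph_nat.
have [U [p pU]] := orthonormal_lift F2 (fun x => closure_sqrt Ks_sep x F2) b_on.
pose E s := sign_elt Ks i0 (root_signs s) n.
have pE s := sign_elt_pin i0 F2 (root_signs s) (eq_leq (esym In)).
(* This matrix and the conjugate of [U] by [s] lift the same orthonormal family, the images under
   [s] of the vectors [b i]. *)
have pTUE s : pin ((tau s)^T * U * E s) ((odd_perm (f s)^-1%g (+) p) (+) total (root_signs s) n)
    (fun i => map_mx (galois_rmorphism s) (gvec (b i))).
  pose w i := (-1) ^+ root_signs s (index i (enum I)) * gvec (b i).
  have pUE : pin (U * E s) (p (+) total (root_signs s) n) w.
    apply: (pinM pU (pE s)) => i; have -> : (index i (enum I) < n)%N by rewrite -In cardE index_mem mem_enum.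
    rewrite signrCA (pin_gam pU) /w -mulrA [in RHS]signrCA.
    by [].
  rewrite -mulrA -addbA; apply: (pinM (pinpV (tauP s)) pUE) => i.
  rewrite /w signrCA (pinp_gvec _ (pinpV (tauP s))) signrCA; congr (_ * _).
  rewrite gvec_map [X in _ = gvec X * _](_ : _ = fun k =>
      (-1) ^+ root_signs s (index i (enum I)) * b i ((f s)^-1 k)%g).
    by rewrite gvecZ scaleAl mulr_sign scaler_sign.
  by apply/funext => k; rewrite galois_rmorphismE bE.
have ex s : odd_perm (f s) = total (root_signs s) n /\
    exists c : bool, map_mx s U = (-1) ^+ c * ((tau s)^T * U * E s).
  (* The parity half of uniqueness identifies the signature of [f s] with the action of [s] on the
     product of the square roots, that is, on the root of the discriminant. *)
  have [pp [c cE]] := pin_unique F2 (pTUE s) (pin_map (galois_rmorphism s) pU).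
  have addb_cancel (x y z : bool) : x (+) y (+) z = y -> x = z by case: x y z => [] [] [].
  split; first by rewrite -odd_permV; exact: addb_cancel pp.
  exists c; rewrite -cE; apply/matrixP => i j.
  by rewrite !mxE galois_rmorphismE.
have /choice[c cE] : forall s, exists c : bool, map_mx s U = (-1) ^+ c * ((tau s)^T * U * E s).
  by move=> s; have [] := ex s.
have TT u : tau u * (tau u)^T = 1 := pin_unit (tauP u).
have UU : U^T * U = 1 := pin_trK pU.
have EE u : (E u)^T * E u = 1 := pin_trK (pE u).
exists U, c; split=> [s|s t UE tauE signE|s t]; first by have [] := ex s.
  (* The sign [c s] depends only on the conjugate of [U], on [tau s] and on [E s]; this will give
     its continuity. *)
  have Est : E s = E t.
    rewrite /E; have : (n <= n)%N by [].
    elim: {1 3 4}n => //= m IH mn; rewrite signE // IH //.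
    exact: ltnW.
  have : map_mx s U = map_mx t U by apply/matrixP => i j; rewrite !mxE UE.
  rewrite !cE tauE Est => E0.
  apply: (sign_injA F2 (W := (E t)^T * (U^T * tau t)) _ E0).
  by rewrite -!mulrA (mulrA (tau t)) TT mul1r (mulrA U^T) UU mul1r.
have EU : E (s * t)%g = sign_elt Ks i0 (fun k => root_signs s k (+) root_signs t k) n.
  congr sign_elt; apply/funext => k; exact: root_signM.
have sU (u : galois_group iota) (X : 'M[Ks]_#|{set I}|) :
    map_mx u X = map_mx (galois_rmorphism u) X.
  by apply/matrixP => i j; rewrite !mxE galois_rmorphismE.
have := cE (s * t)%g; rewrite -/(E _).
have -> : map_mx (s * t)%g U = map_mx s (map_mx t U) by rewrite -map_mx_comp.
rewrite cE sU !rmorphM /= rmorph_sign sign_elt_map -map_trmx.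
(* The entries of [tau t] involve the square root of 2, so [s] moves [tau t] by the sign that
   represents (2)(d). *)
rewrite (pinp_galois F2 r2 (b := root_sign 2%:R s) _ (tauP t)); last first.
  by rewrite galois_rmorphismE root_signE.
rewrite -sU cE -/(E s) -/(E t).
have trS (d : bool) (X : 'M[Ks]_#|{set I}|) : ((-1) ^+ d * X)^T = (-1) ^+ d * X^T.
  by rewrite !mulr_sign; case: d; rewrite ?linearN.
have trM (X Y : 'M[Ks]_#|{set I}|) : (X * Y)^T = Y^T * X^T by exact: trmx_mul.
rewrite trS tauM trM EU.
set Es := sign_elt Ks i0 _ n.
have EEs : E s * E t = (-1) ^+ sign_form (root_signs s) (root_signs t) n * Es.
  by apply: (sign_elt_mul i0 F2); rewrite In.
have comb (R : pzRingType) (b1 b2 b3 b4 : bool) (x y z u v w : R) :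
    u * v = (-1) ^+ b4 * w ->
    (-1) ^+ b1 * ((-1) ^+ b2 * x * ((-1) ^+ b3 * (y * z * u)) * v) =
    (-1) ^+ (b3 (+) b1 (+) b2 (+) b4) * (x * y * z * w).
  rewrite !mulr_sign => uv.
  by case: b1; case: b2; case: b3; case: b4 uv => uv;
    rewrite /= ?(mulrN, mulNr, opprK) -!mulrA uv ?(mulrN, opprK).
rewrite (comb _ _ _ _ _ _ _ _ _ _ _ EEs).
move=> E0; apply/esym; apply: (sign_injA F2 (W := Es^T * (U^T * (tau s * tau t))) _ E0).
have EsK : Es^T * Es = 1 by rewrite -[Es]EU.
rewrite -!mulrA (mulrA (tau t)) TT mul1r (mulrA (tau s)) TT mul1r (mulrA U^T) UU mul1r.
exact: EsK.
Qed.

End SerreFormula.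

Section TraceFormDiagonal.
Variables (K Ks : fieldType) (iota : {rmorphism K -> Ks}).
Variables (gT : finGroupType) (L : falgType K) (act : gT -> {lrmorphism L -> L}).
Hypothesis L_gal : galois_algebra iota act.
Variable f0 : {lrmorphism L -> Ks | iota \; *%R}.
Hypothesis K2 : (2%:R : K) != 0.
Local Notation n := (\dim {:L}).
Local Notation B := (fun x y : L => alg_trace (x * y)).
Implicit Types (e : n.-tuple L) (a : 'I_n -> K) (x y z : L).

Lemma trace_mul_linear c x y z :
  alg_trace ((c *: x + y) * z) = c * alg_trace (x * z) + alg_trace (y * z).
Proof.
apply: (fmorph_inj iota); rewrite rmorphD rmorphM /= !(trace_mul_sum L_gal f0).
rewrite mulr_sumr -big_split; apply: eq_bigr => g _ /=.
by rewrite {1}/conj_emb !linearP /= -!/(conj_emb _ _ _ _) mulrDl mulrA.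
Qed.

Local Notation BL := trace_mul_linear.
Local Notation BC := (trace_mulC L_gal f0).

Lemma trace_form_sum e (x : 'I_n -> K) : (forall i j : 'I_n, i != j -> B e`_i e`_j = 0) ->
  trace_form (\sum_i x i *: tnth e i) = \sum_(i < n) B e`_i e`_i * x i ^+ 2.
Proof.
move=> e0; rewrite /trace_form expr2 (bilin_sum BL); apply: eq_bigr => i _.
rewrite (bilinZ BL) BC (bilin_sum BL) (bigD1 i) //= (bilinZ BL) big1 ?addr0 => [|j ji].
  by rewrite (tnth_nth 0) mulrC -mulrA -expr2 mulrC mulrA [in LHS]mulrC mulrC.
by rewrite (bilinZ BL) !(tnth_nth 0) e0 ?mulr0.
Qed.

Lemma trace_form_diagonalizable : exists e a, diagonalizes (@trace_form K L) e a.
Proof.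
have [e [eb e0 e1]] := orthogonal_basis K2 BC BL (trace_nondegenerate L_gal f0).
exists e, (fun i : 'I_n => B e`_i e`_i); split=> // x.
exact: trace_form_sum.
Qed.

Section Diagonalization.
Variables (e : n.-tuple L) (a : 'I_n -> K).
Hypothesis ea : diagonalizes (@trace_form K L) e a.

(** Polarization: the value of the form at [e_i + e_j] determines twice the off-diagonal entry. *)
Lemma diagonalizes_trace (i j : 'I_n) : B e`_i e`_j = a i *+ (i == j).
Proof.
have [eb _ eE] := ea.
have ei (k : 'I_n) : B e`_k e`_k = a k.
  have := eE (fun l => (l == k)%:R).
  rewrite (bigD1 k) //= [in RHS](bigD1 k) //= eqxx scale1r !big1 => [||l /negPf ->]; first last.
  - by rewrite scale0r.
  - by move=> l /negPf ->; rewrite expr0n mulr0.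
  by rewrite !addr0 expr1n mulr1 (tnth_nth 0).
have [<-|ij] := eqVneq i j; first exact: ei.
have := eE (fun l => (l == i)%:R + (l == j)%:R).
rewrite (eq_bigr (fun l => (l == i)%:R *: tnth e l + (l == j)%:R *: tnth e l)); last first.
  by move=> l _; rewrite scalerDl.
have pick (k : 'I_n) : \sum_l (l == k)%:R *: tnth e l = e`_k.
  rewrite (bigD1 k) //= eqxx scale1r big1 ?addr0 ?(tnth_nth 0) // => l /negPf ->.
  by rewrite scale0r.
rewrite big_split /= !pick.
rewrite (bigD1 i) //= [in RHS](bigD1 j) 1?eq_sym //= !eqxx [j == i]eq_sym (negPf ij).
rewrite big1 => [|l /andP[/negPf -> /negPf ->]]; last by rewrite addr0 expr0n mulr0.
rewrite !addr0 add0r !expr1n !mulr1.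
rewrite /trace_form expr2 (bilinD BL) (BC _ (_ + _)) (BC e`_j (_ + _)) !(bilinD BL) !ei.
rewrite (BC e`_j) addrACA [_ + a j]addrC addrA => /eqP.
rewrite mulr0n (_ : _ + _ + _ + _ = (a i + a j) + 2%:R * alg_trace (e`_i * e`_j)); last by ring.
by rewrite -subr_eq0 addrAC subrr add0r mulf_eq0 (negPf K2) => /eqP.
Qed.

(** The Gram matrices of [e] and of [vbasis] are congruent. The determinant of the base change is
    non-zero because the product of the [a i] is. *)
Lemma diagonalizes_disc : exists2 P : K, P != 0 & \prod_i a i = P ^+ 2 * alg_disc L.
Proof.
have [eb a0 _] := ea.
pose P : 'M[K]_n := \matrix_(i < n, k < n) coord (vbasis {:L}) k e`_i.
have PE : diag_mx (\row_(i < n) a i) = P *m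
    (\matrix_(i < n, j < n) alg_trace ((vbasis {:L})`_i * (vbasis {:L})`_j)) *m P^T.
  rewrite -mulmxA; apply/matrixP => i j; rewrite [LHS]mxE [X in X *+ _]mxE [RHS]mxE -diagonalizes_trace.
  rewrite {1}(coord_vbasis (memvf e`_i)) (bilin_sum BL).
  apply: eq_bigr => k _; rewrite (bilinZ BL) !mxE; congr (_ * _).
  rewrite BC {1}(coord_vbasis (memvf e`_j)) (bilin_sum BL); apply: eq_bigr => l _.
  by rewrite (bilinZ BL) !mxE BC mulrC.
have dE : \prod_i a i = (\det P) ^+ 2 * alg_disc L.
  have := congr1 determinant PE; rewrite det_diag !det_mulmx det_tr mulrAC -expr2 => <-.
  by apply: eq_bigr => i _; rewrite mxE.
exists (\det P) => //; apply: contraTneq isT => P0; move: dE.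
rewrite P0 expr0n mul0r => /eqP; rewrite prodf_seq_eq0 => /hasP[i _ /=].
by rewrite (negPf (a0 i)).
Qed.

End Diagonalization.

End TraceFormDiagonal.

(** Prescribing the images of finitely many elements is an open condition in the Krull topology. *)
Lemma galois_locally_constant (K Ks : fieldType) (iota : {rmorphism K -> Ks}) (xs : seq Ks)
    (c : galois_group iota -> bool) :
  (forall s t : galois_group iota, (forall x, x \in xs -> t x = s x) -> c t = c s) ->
  locally_constant (fun p : 'I_1 -> galois_group iota => (c (p ord0))%:R).
Proof.
move=> cE p; have Fp := nbhs_filter (p : {ptws 'I_1 -> galois_group iota}).
have near_i (i : 'I_(size xs)) : nbhs (p : {ptws 'I_1 -> galois_group iota})
    (fun q : {ptws 'I_1 -> galois_group iota} => q ord0 xs`_i = p ord0 xs`_i).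
  exact: (@proj_continuous 'I_1 (fun=> galois_group iota) ord0 p _
    (nbhs_galois (p ord0) xs`_i)).
have := @filter_forall _ _ _ _ Fp near_i.
apply: filterS => q qp; rewrite (cE (p ord0) (q ord0)) // => x xxs.
have xi : (index x xs < size xs)%N by rewrite index_mem.
by have := qp (Ordinal xi); rewrite /= nth_index.
Qed.

Section TraceFormClass.
Variables (K Ks : fieldType) (iota : {rmorphism K -> Ks}).
Hypothesis Ks_sep : separable_closure iota.
Hypothesis F2 : (2%:R : Ks) != 0.
Variable gT : finGroupType.
Hypothesis G_red : two_reduced gT.
Hypothesis n_mod8 : #|gT| = 0 %[mod 8] \/ #|gT| = 2 %[mod 8].
Variables (L : falgType K) (act : gT -> {lrmorphism L -> L}).
Hypothesis L_gal : galois_algebra iota act.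
Local Notation n := (\dim {:L}).
Variables (e : n.-tuple L) (a : 'I_n -> K).
Hypothesis ea : diagonalizes (@trace_form K L) e a.
Implicit Types (s t : galois_group iota).

Let K2 : (2%:R : K) != 0.
Proof. by rewrite -(fmorph_eq0 iota) rmorph_nat. Qed.

(** The default 1 keeps all coefficients non-zero, as [serre_formula] requires. *)
Let a_ (k : nat) : K := oapp a 1 (insub k).

Let a_E (i : 'I_n) : a_ i = a i.
Proof. by rewrite /a_ valK. Qed.

Let a_0 k : a_ k != 0.
Proof. by rewrite /a_; case: insub => [i|] /=; [have [] := ea | rewrite oner_eq0]. Qed.

(** Up to sign, the product of the square roots of the [a i] is the root of the discriminant times
    an element of K. *)
Lemma root_sign_disc t : root_sign (alg_disc L) t = total (root_signs a_ t) n.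
Proof.
have [f0 _] := etale_embedding Ks_sep (galois_algebra_etale L_gal).
have [P P0 PE] := diagonalizes_disc L_gal f0 K2 ea.
have d0 : alg_disc L != 0.
  have : \prod_i a i != 0 by rewrite prodf_seq_neq0; apply/allP => i _ /=; rewrite -a_E.
  by rewrite PE mulf_eq0 negb_or => /andP[].
have [h hE] : exists h : bool, \prod_(i < n) root2 iota (a_ i) =
    (-1) ^+ h * (iota P * root2 iota (alg_disc L)).
  have : (\prod_(i < n) root2 iota (a_ i)) ^+ 2 = (iota P * root2 iota (alg_disc L)) ^+ 2.
    rewrite -prodrXl exprMn root2_sqr // -rmorphXn -rmorphM -PE rmorph_prod.
    by apply: eq_bigr => i _; rewrite root2_sqr // a_E.
  move/eqP; rewrite eqf_sqr => /orP[] /eqP ->.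
    by exists false; rewrite mul1r.
  by exists true; rewrite mulN1r.
apply: root_signP => //.
have : t (\prod_(i < n) root2 iota (a_ i)) =
    (-1) ^+ total (root_signs a_ t) n * \prod_(i < n) root2 iota (a_ i).
  rewrite -galois_rmorphismE rmorph_prod /total.
  elim/big_rec3: _ => [|i x y z _ ->]; first by rewrite mul1r.
  by rewrite signr_addb galois_rmorphismE root_signE mulrACA.
rewrite hE -galois_rmorphismE !rmorphM rmorph_sign /= !galois_rmorphismE.
have [_ _ _ ->] := galois_is_aut t.
rewrite [in RHS]signrCA => /(can_inj (signrMK _)).
by rewrite -signrCA => H; apply: mulfI H; rewrite fmorph_eq0.
Qed.

Lemma trace_form_cochain : exists c : galois_group iota -> bool,
  locally_constant (fun p : 'I_1 -> galois_group iota => (c (p ord0))%:R) /\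
  forall s t, c (s * t)%g = c s (+) c t (+) (root_sign 2%:R s && root_sign (alg_disc L) t)
    (+) sign_form (root_signs a_ s) (root_signs a_ t) n.
Proof.
have [f0 _] := etale_embedding Ks_sep (galois_algebra_etale L_gal).
have [phi [phiE phiM]] := galois_hom L_gal f0.
have deg : #|gT| = n by rewrite (galois_algebra_degree L_gal).
have r2 : root2 iota 2%:R ^+ 2 = 2%:R by rewrite root2_sqr // rmorph_nat.
have [tau [tauP tauM]] := regular_lift F2 r2 G_red n_mod8.
have index_n (g : gT) : (index g (enum gT) < n)%N by rewrite -deg cardE index_mem mem_enum.
(* The orthogonal basis is renumbered by the group, so that the vectors and their coordinates share
   one index set. *)
pose k (g : gT) : 'I_n := Ordinal (index_n g).
pose b g h := conj_emb act f0 h e`_(k g) / root2 iota (a_ (k g)).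
have b_on g h : dot (b g) (b h) = (g == h)%:R.
  rewrite /dot (eq_bigr (fun l => conj_emb act f0 l e`_(k g) * conj_emb act f0 l e`_(k h) *
    ((root2 iota (a_ (k g)))^-1 * (root2 iota (a_ (k h)))^-1))); last first.
    by move=> l _; rewrite /b mulrACA.
  rewrite -mulr_suml -(trace_mul_sum L_gal) (diagonalizes_trace L_gal f0 K2 ea).
  have [<-|gh] := eqVneq g h.
    rewrite eqxx mulr1n -a_E -(root2_sqr Ks_sep F2) -invfM -expr2 divff //.
    by rewrite expf_neq0 // root2_neq0.
  rewrite (_ : (k g == k h) = false) ?mulr0n ?rmorph0 ?mul0r //.
  apply: contraNF gh => /eqP/(congr1 val)/= E.
  by rewrite -(nth_index 1%g (mem_enum gT g)) E nth_index ?mem_enum.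
have bE s g h : s (b g h) =
    (-1) ^+ root_sign (a_ (index g (enum gT))) s * b g ((rmul (phi s))^-1 h)%g.
  rewrite /b -galois_rmorphismE rmorphM fmorphV /= !galois_rmorphismE phiE root_signE.
  rewrite invfM invr_sign mulrCA; congr (_ * (conj_emb _ _ _ _ * _)).
  by apply: (perm_inj (s := rmul (phi s))); rewrite permKV rmulE mulgVK.
have tauP' s : pinp (tau (phi s)) (rmul (phi s)) by apply: tauP; rewrite inE.
have tauM' s t : tau (phi (s * t)%g) = tau (phi s) * tau (phi t).
  by rewrite phiM tauM ?inE.
have [U [c [par cU cM]]] := serre_formula Ks_sep F2 (1%g : gT) deg a_0 b_on bE tauP' tauM'.
exists c; split; last first.
  by move=> s t; rewrite cM par root_sign_disc.
(* The images of these elements determine [c]: the entries of [U], the square roots, and the values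
   of one embedding on a basis, which determine [phi]. *)
pose xs := [seq U ij.1 ij.2 | ij : _ * _] ++ [seq root2 iota (a_ i) | i : 'I_n] ++
  [seq conj_emb act f0 1%g x | x <- vbasis {:L}].
apply: (galois_locally_constant (xs := xs)) => s t st.
have phi_st : phi t = phi s.
  apply: invg_inj; apply: (conj_emb_inj L_gal (f0 := f0)) => x.
  have := phiE t 1%g x; have := phiE s 1%g x; rewrite !mul1g => <- <-.
  rewrite (coord_vbasis (memvf x)) conj_emb_sum -!galois_rmorphismE !rmorph_sum.
  apply: eq_bigr => i _; rewrite conj_embZ !rmorphM /= !galois_rmorphismE.
  have [_ _ _ ->] := galois_is_aut t; have [_ _ _ ->] := galois_is_aut s.
  rewrite st // !mem_cat map_f ?orbT //.
  by rewrite mem_nth ?size_tuple.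
apply: cU => [i j||i ni]; last 2 first.
- by rewrite phi_st.
- rewrite /root_signs /root_sign st // !mem_cat.
  by apply/or3P/Or32/mapP; exists (Ordinal ni); rewrite ?mem_enum.
rewrite st // !mem_cat.
by apply/or3P/Or31/mapP; exists (i, j); rewrite ?mem_enum.
Qed.


End TraceFormClass.

(** * Comparison with the cocycle of w_2 *)

Section CupSquares.
Variable G : topGroupType.
Implicit Types y z : cocycle G 1.

Definition cup2 y z : cocycle G 2 := Cocycle (cup_cocycle (cocycleP y) (cocycleP z)).

Lemma cup2E y z (s t : G) : cup2 y z (pt [:: s; t]) = y (pt [:: s]) * z (pt [:: t]).
Proof. by congr (cocycle_val y _ * cocycle_val z _); apply/funext => -[[|//] ?]. Qed.

(** The recursion for [cup_prod] ends with the unit class, whose cocycle is the constant 1; every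
    cup product met here has factors of degree at most 1. *)
Lemma cup_prod2 (z : 'I_2 -> cocycle G 1) :
  cup_prod (fun j => coh_class (z j)) = coh_class (cup2 (z ord0) (z (lift ord0 ord0))).
Proof.
rewrite /= (cup_class1 (z (lift ord0 ord0)) (Cocycle (@cst1_cocycle G)) (m := 0)) //.
rewrite (cup_class1 (z ord0) (m := 1)) //; congr coh_class; apply: val_inj.
apply/funext => p; rewrite /= /cup_cochain /= /cup_cochain /= mulr1.
by congr (cocycle_val _ _ * cocycle_val _ _); apply/funext => -[[|//] ?]; congr p; apply: val_inj.
Qed.

Lemma cocycle_sumE m (J : finType) (P : pred J) (z : J -> cocycle G m) p :
  cocycle_val (\sum_(j | P j) z j) p = \sum_(j | P j) cocycle_val (z j) p.
Proof.
by apply: (big_morph (fun y : cocycle G m => cocycle_val y p)) => // y1 y2.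
Qed.

End CupSquares.

Lemma sum_increasing_pairs (R : pzRingType) n (x y : 'I_n -> R) :
  \sum_(i : {ffun 'I_2 -> 'I_n} |
     [forall j : 'I_2, forall k : 'I_2, (j < k)%N ==> (i j < i k)%N])
    x (i ord0) * y (i (lift ord0 ord0)) = \sum_(j < n) \sum_(i < n | (i < j)%N) x i * y j.
Proof.
rewrite (reindex (fun p : 'I_n * 'I_n => [ffun k : 'I_2 => if k == ord0 then p.2 else p.1])) /=.
  rewrite pair_big_dep /=; apply: eq_big => [p|p _]; last by rewrite !ffunE.
  apply/forallP/idP => [/(_ ord0)/forallP/(_ (lift ord0 ord0))|p12 j]; first by rewrite !ffunE.
  apply/forallP => k; apply/implyP; rewrite !ffunE.
  by case: j k => [[|[|//]] ?] [[|[|//]] ?].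
exists (fun i => (i (lift ord0 ord0), i ord0)) => [[u v] _|i _]; first by rewrite !ffunE.
apply/ffunP => k; rewrite ffunE.
by case: k => [[|[|//]] ?] /=; congr (i _); apply: val_inj.
Qed.

Lemma sign_formE (eps del : nat -> bool) n :
  (sign_form eps del n)%:R =
  \sum_(j < n) \sum_(i < n | (i < j)%N) (eps i)%:R * (del j)%:R :> 'F_2.
Proof.
have natF2_sum m (f : 'I_m -> bool) :
    (\big[addb/false]_(i < m) f i)%:R = \sum_(i < m) (f i)%:R :> 'F_2.
  exact: (big_morph (fun b : bool => b%:R : 'F_2) natF2_addb).
rewrite /sign_form natF2_sum; apply: eq_bigr => j _.
rewrite -mulr_suml -mulnb natrM /total natF2_sum; congr (_ * _).
exact: (big_ord_widen n (fun i => (eps i)%:R : 'F_2) (ltnW (ltn_ord j))).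
Qed.

Theorem theorem1p3 (K Ks : fieldType) (iota : {rmorphism K -> Ks})
    (Ks_sep : separable_closure iota)
    (charK : 2%N \notin [pchar K])
    (gT : finGroupType) (G_red : two_reduced gT)
    (n_mod8 : #|gT| = 0 %[mod 8] \/ #|gT| = 2 %[mod 8])
    (L : falgType K) (act : gT -> {lrmorphism L -> L})
    (L_gal : galois_algebra iota act) :
  hasse_witt iota 2 (@trace_form K L) =
    cup (kummer iota 2%:R) (kummer iota (alg_disc L)).
Proof.
have K2 : (2%:R : K) != 0 by move: charK; rewrite inE.
have F2 : (2%:R : Ks) != 0 by rewrite -(rmorph_nat iota) fmorph_eq0.
have [f0 _] := etale_embedding Ks_sep (galois_algebra_etale L_gal).
pose kum x := Cocycle (kummer_cocycle iota x).
have kumE x s : kum x (pt [:: s]) = (root_sign x s)%:R by [].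
(* The diagonalization behind [hasse_witt] is an arbitrary choice of [xget], so the formula is
   proved for all of them; existence of one excludes the default value. *)
suff diagE e a : diagonalizes (@trace_form K L) e a ->
    hasse_witt_diag iota 2 a = cup (kummer iota 2%:R) (kummer iota (alg_disc L)).
  rewrite /hasse_witt; case: xgetP => [w _ [e [a [ea ->]]]|nw]; first exact: diagE ea.
  have [e [a ea]] := trace_form_diagonalizable L_gal f0 K2.
  by case: (nw (hasse_witt_diag iota 2 a)); exists e, a.
move=> ea; have [c [c_lc cM]] := trace_form_cochain Ks_sep F2 G_red n_mod8 L_gal ea.
rewrite (cup_class1 (kum _) (kum _)) // /hasse_witt_diag.
under eq_bigr do rewrite (cup_prod2 (fun j => kum (a (_ j)))).
(* The sign [c] of Serre's formula is the cochain whose coboundary is the difference of the two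
   sides. *)
rewrite coh_class_sum; apply/coh_class_eq; exists (fun p => (c (p ord0))%:R) => //.
apply/funext => p; rewrite (pt_eta p) /= !fctE cobound1E.
set s := p (inord 0); set t := p (inord 1).
rewrite cocycle_sumE.
under eq_bigr do rewrite cup2E !kumE.
rewrite (sum_increasing_pairs (fun i => (root_sign (a i) s)%:R)
  (fun i => (root_sign (a i) t)%:R)).
have -> : cup_cochain (kummer_cochain 2%:R) (kummer_cochain (alg_disc L))
    (pt (mkseq (fun k => p (inord k)) 2)) =
    (root_sign 2%:R s)%:R * (root_sign (alg_disc L) t)%:R := cup2E (kum _) (kum _) s t.
rewrite -[c (pt [:: (s * t)%g] ord0)]/(c (s * t)%g) cM !natF2_addb sign_formE.
rewrite -mulnb natrM oppF2.
have -> : \sum_(j < \dim {:L}) \sum_(i < \dim {:L} | (i < j)%N)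
    (root_sign (a i) s)%:R * (root_sign (a j) t)%:R =
    \sum_(j < \dim {:L}) \sum_(i < \dim {:L} | (i < j)%N)
    (root_signs (fun k => oapp a 1 (insub k)) s i)%:R *
    (root_signs (fun k => oapp a 1 (insub k)) t j)%:R :> 'F_2.
  by apply: eq_bigr => j _; apply: eq_bigr => i _; rewrite /root_signs !valK.
set w := \sum_(j < _) _; rewrite -!/(c s) -!/(c t) /pt /=.
set u := _%:R * _%:R; set x := (c s)%:R; set y := (c t)%:R.
rewrite [RHS](_ : _ = (u + w) + (x + x) + (y + y)); last by ring.
by rewrite !addff2 !addr0 addrC.
Qed.
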